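(* For a finitely generated abelian group $A$ the group $H^n(A,\mathbb F_2)$ is naturally isomorphic to the cokernel of a map $$\bigoplus_{2k+l+2m=n;\ k\geq 1}\mathrm{Sym}^k((A/2)^\vee)\otimes\mathrm{Sym}^l((A/2)^\vee)\otimes\mathrm{Sym}^m(({}_2A)^\vee)\longrightarrow\bigoplus_{i+2j=n}\mathrm{Sym}^i((A/2)^\vee)\otimes\mathrm{Sym}^j(({}_2A)^\vee).$$ In particular, there is a short exact sequence $$0\longrightarrow (A/2)^\vee\longrightarrow \mathrm{Sym}^2((A/2)^\vee)\oplus({}_2A)^\vee\longrightarrow H^2(A,\mathbb F_2)\longrightarrow 0,$$ where the first map is $x\mapsto(x^2,\tilde\beta^\vee(x))$, and a short exact sequence $$0\longrightarrow (A/2)^\vee\otimes(A/2)^\vee\longrightarrow\mathrm{Sym}^3((A/2)^\vee)\oplus\big((A/2)^\vee\otimes({}_2A)^\vee\big)\longrightarrow H^3(A,\mathbb F_2)\longrightarrow 0,$$ where the first map is $x\otimes y\mapsto(x^2y,\ y\otimes\tilde\beta^\vee(x))$.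
   Context: $H^n(A,\mathbb F_2)$ is the $n$-th cohomology of the group $A$ with coefficients in $\mathbb F_2$. $A/2=A/2A$, ${}_2A=\{a\in A\mid 2a=0\}$, and $(-)^\vee$ is the dual $\mathbb F_2$-vector space. $\mathrm{Sym}=\bigoplus_k\mathrm{Sym}^k$ is the symmetric algebra over $\mathbb F_2$, and $\otimes$ is over $\mathbb F_2$. The map $\tilde\beta:{}_2A\to A/2$ is the composition of the embedding ${}_2A\hookrightarrow A$ and the projection $A\twoheadrightarrow A/2$, and $\tilde\beta^\vee:(A/2)^\vee\to({}_2A)^\vee$ is its dual. *)

(* Defs.v *)
From HB Require Import structures.
From mathcomp Require Import all_boot all_order all_algebra.
From mathcomp Require Import generic_quotient ring_quotient freeg.
From mathcomp Require Import boolp classical_sets functions.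

Set Implicit Arguments.
Unset Strict Implicit.
Unset Printing Implicit Defensive.

Import GRing.Theory.
Local Open Scope ring_scope.
Local Open Scope quotient_scope.

Lemma addrBB (V : zmodType) (x y : V) : x + y - x - y = 0.
Proof. by rewrite -addrA -opprD subrr. Qed.

Section SpanQuotient.
Variables (K : fieldType) (M : lmodType K) (P : M -> Prop).

Definition in_span (x : M) : Prop :=
  exists (n : nat) (c : 'I_n -> K) (g : 'I_n -> M),
    (forall i, P (g i)) /\ x = \sum_i c i *: g i.

Definition span_of : {pred M} := fun x => `[< in_span x >].

Lemma span_ofP x : reflect (in_span x) (x \in span_of).
Proof. exact: asboolP. Qed.

Lemma span_of_gen x : P x -> x \in span_of.
Proof.
move=> Px; apply/span_ofP; exists 1%N, (fun=> 1), (fun=> x); split=> //.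
by rewrite big_ord1 scale1r.
Qed.

Lemma span_of_submod : submod_closed span_of.
Proof.
split.
  by apply/span_ofP; exists 0%N, (fun=> 0), (fun=> 0); split=> [[]//|]; rewrite big_ord0.
move=> a _ _ /span_ofP[n [c [g [Pg ->]]]] /span_ofP[m [d [h [Ph ->]]]].
apply/span_ofP; exists (n + m)%N.
exists (fun i : 'I_(n + m) => match fintype.split i with inl j => a * c j | inr k => d k end).
exists (fun i : 'I_(n + m) => match fintype.split i with inl j => g j | inr k => h k end).
split=> [i|]; first by case: (fintype.split i).
rewrite big_split_ord /= scaler_sumr; congr (_ + _); apply: eq_bigr => i _.
  by rewrite -/(unsplit (inl i)) unsplitK scalerA.
by rewrite -/(unsplit (inr i)) unsplitK.
Qed.

HB.instance Definition _ := GRing.isSubmodClosed.Build K M span_of span_of_submod.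

Definition lquot := {ideal_quot span_of}.
HB.instance Definition _ := GRing.Zmodule.on lquot.

Definition lpi (x : M) : lquot := \pi_{ideal_quot span_of} x.
Definition lrepr (q : lquot) : M := repr (q : {ideal_quot span_of}).

Lemma lreprK q : lpi (lrepr q) = q.
Proof. exact: reprK. Qed.

Lemma lpi_eq x y : (lpi x = lpi y) <-> (x - y \in span_of).
Proof.
by rewrite Quotient.idealrBE; split=> [e|/eqP//]; apply/eqP.
Qed.

Lemma lpiD x y : lpi (x + y) = lpi x + lpi y.
Proof. by rewrite /lpi raddfD. Qed.

Definition lquot_scale (a : K) (q : lquot) : lquot := lpi (a *: lrepr q).

Lemma lpiZ a x : lpi (a *: x) = lquot_scale a (lpi x).
Proof.
by apply/lpi_eq; rewrite -scalerBr rpredZ // -(lpi_eq _ _) lreprK.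
Qed.

Lemma lquot_scaleA a b q : lquot_scale a (lquot_scale b q) = lquot_scale (a * b) q.
Proof. by rewrite -[q]lreprK -!lpiZ scalerA. Qed.
Lemma lquot_scale1 : left_id 1 lquot_scale.
Proof. by move=> q; rewrite -[q]lreprK -!lpiZ scale1r. Qed.
Lemma lquot_scaleDr : right_distributive lquot_scale +%R.
Proof.
by move=> a p q; rewrite -[p]lreprK -[q]lreprK -!(lpiD, lpiZ) scalerDr.
Qed.
Lemma lquot_scaleDl q : {morph lquot_scale^~ q : a b / a + b}.
Proof. by move=> a b; rewrite -[q]lreprK -!(lpiD, lpiZ) scalerDl. Qed.

HB.instance Definition _ := GRing.Zmodule_isLmodule.Build K lquot
  lquot_scaleA lquot_scale1 lquot_scaleDr lquot_scaleDl.

Lemma lpi_linear : linear lpi.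
Proof. by move=> a x y; rewrite lpiD lpiZ. Qed.
HB.instance Definition _ := GRing.isLinear.Build K M lquot _ lpi lpi_linear.

Lemma lpi_rel x : P x -> lpi x = 0.
Proof.
by move=> Px; rewrite -[RHS](linear0 lpi); apply/lpi_eq; rewrite subr0 span_of_gen.
Qed.

Section Lift.
Variables (N : lmodType K) (f : {linear M -> N}).
Hypothesis fP : forall x, P x -> f x = 0.

Definition lquot_lift_fun (q : lquot) : N := f (lrepr q).

Lemma lquot_liftE x : lquot_lift_fun (lpi x) = f x.
Proof.
apply/eqP; rewrite -subr_eq0 -linearB.
have /lpi_eq/span_ofP[n [c [g [Pg ->]]]] := lreprK (lpi x).
by rewrite linear_sum big1 // => i _; rewrite linearZ /= fP // scaler0.
Qed.

Lemma lquot_lift_linear : linear lquot_lift_fun.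
Proof.
move=> a p q; rewrite -[p]lreprK -[q]lreprK -linearP !lquot_liftE.
exact: linearP.
Qed.

Definition lquot_lift : {linear lquot -> N} :=
  HB.pack lquot_lift_fun
    (GRing.isLinear.Build K lquot N _ lquot_lift_fun lquot_lift_linear).
End Lift.

End SpanQuotient.

Section FreeLift.
Variables (K : fieldType) (X : choiceType) (M : lmodType K) (f : X -> M).

Lemma fglift_linear : linear (fglift f : {freeg X / K} -> M).
Proof.
have addf : {morph (fglift f : {freeg X / K} -> M) : x y / x + y}.
  have aB := lift_is_additive f.
  have a0 : fglift f (0 : {freeg X / K}) = 0.
    by have := aB 0 0; rewrite !subrr.
  move=> x y; have := aB x (- y); rewrite opprK => ->.
  by have := aB 0 y; rewrite !sub0r a0 sub0r => ->; rewrite opprK.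
move=> a x y; rewrite addf; congr (_ + _).
have a0 : fglift f (0 : {freeg X / K}) = 0.
  by have := lift_is_additive f 0 0; rewrite !subrr.
have fsum I (r : seq I) (F : I -> {freeg X / K}) :
   fglift f (\sum_(i <- r) F i) = \sum_(i <- r) fglift f (F i).
  by elim/big_rec2: _ => [//|i u v _ <-]; rewrite addf.
rewrite -[in RHS](freeg_sumE x) [a *: x]/(fgscale a x) /fgscale !fsum scaler_sumr.
by apply: eq_bigr => i _; rewrite !liftU scalerA.
Qed.

Definition free_lift : {linear {freeg X / K} -> M} :=
  HB.pack (fglift f : {freeg X / K} -> M)
    (GRing.isLinear.Build K {freeg X / K} M _ (fglift f) fglift_linear).

Lemma free_liftE x : free_lift << x >> = f x.
Proof. by rewrite /= liftU scale1r. Qed.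
End FreeLift.

Section TensorProduct.
Variables (K : fieldType).

Inductive tensor_rel (U V : lmodType K) : {freeg (U * V)%type / K} -> Prop :=
| TensorLinl c u1 u2 v :
    tensor_rel (<< (c *: u1 + u2, v) >> - c *: << (u1, v) >> - << (u2, v) >>)
| TensorLinr c u v1 v2 :
    tensor_rel (<< (u, c *: v1 + v2) >> - c *: << (u, v1) >> - << (u, v2) >>).

Definition tensor (U V : lmodType K) := lquot (@tensor_rel U V).
HB.instance Definition _ U V := GRing.Lmodule.on (tensor U V).

Definition tens (U V : lmodType K) (u : U) (v : V) : tensor U V :=
  lpi (@tensor_rel U V) << (u, v) >>.

Lemma tens_linl (U V : lmodType K) (v : V) : linear (fun u : U => tens u v).
Proof.
move=> c u1 u2; have := lpi_rel (TensorLinl c u1 u2 v).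
by rewrite !linearB linearZ /= => /subr0_eq/(canRL (subrK _)); rewrite addrC.
Qed.

Lemma tens_linr (U V : lmodType K) (u : U) : linear (fun v : V => tens u v).
Proof.
move=> c v1 v2; have := lpi_rel (TensorLinr c u v1 v2).
by rewrite !linearB linearZ /= => /subr0_eq/(canRL (subrK _)); rewrite addrC.
Qed.

Section Map.
Variables (U U' V V' : lmodType K) (f : {linear U -> U'}) (g : {linear V -> V'}).

Definition tensor_map_free : {linear {freeg (U * V)%type / K} -> tensor U' V'} :=
  free_lift (fun p : U * V => tens (f p.1) (g p.2)).

Lemma tensor_map_rel x : tensor_rel x -> tensor_map_free x = 0.
Proof.
case=> [c u1 u2 v|c u v1 v2]; rewrite !linearB linearZ !free_liftE linearP.
  by rewrite tens_linl; exact: addrBB.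
by rewrite tens_linr; exact: addrBB.
Qed.

Definition tensor_map : {linear tensor U V -> tensor U' V'} :=
  lquot_lift tensor_map_rel.

Lemma tensor_mapE u v : tensor_map (tens u v) = tens (f u) (g v).
Proof. exact: etrans (lquot_liftE tensor_map_rel _) (free_liftE _ _). Qed.
End Map.

End TensorProduct.

Section SymmetricPower.
Variables (K : fieldType).

Inductive sym_rel (k : nat) (V : lmodType K) : {freeg (k.-tuple V) / K} -> Prop :=
| SymLin (i : 'I_k) c (r s t : k.-tuple V) :
    tnth t i = c *: tnth r i + tnth s i ->
    (forall j, j != i -> tnth r j = tnth t j /\ tnth s j = tnth t j) ->
    sym_rel (<< t >> - c *: << r >> - << s >>)
| SymPerm (s t : k.-tuple V) :
    perm_eq s t -> sym_rel (<< s >> - << t >>).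

(* The degree k part of the symmetric algebra of V, as the coinvariants of the
   symmetric group acting on the k-th tensor power of V. *)
Definition sym (k : nat) (V : lmodType K) := lquot (@sym_rel k V).
HB.instance Definition _ k V := GRing.Lmodule.on (sym k V).

(* The elements of the tuple t have degree 1, and smon t is their product in
   the symmetric algebra; smon [tuple] is its unit. *)
Definition smon (k : nat) (V : lmodType K) (t : k.-tuple V) : sym k V :=
  lpi (@sym_rel k V) << t >>.

Lemma smon_lin k (V : lmodType K) (i : 'I_k) c (r s t : k.-tuple V) :
  tnth t i = c *: tnth r i + tnth s i ->
  (forall j, j != i -> tnth r j = tnth t j /\ tnth s j = tnth t j) ->
  smon t = c *: smon r + smon s.
Proof.
move=> ti tj; have := lpi_rel (SymLin ti tj).
by rewrite !linearB linearZ /= => /subr0_eq/(canRL (subrK _)); rewrite addrC.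
Qed.

Lemma smon_perm k (V : lmodType K) (s t : k.-tuple V) :
  perm_eq s t -> smon s = smon t.
Proof. by move=> st; have := lpi_rel (SymPerm st); rewrite linearB => /subr0_eq. Qed.

Section Map.
Variables (k : nat) (V V' : lmodType K) (f : {linear V -> V'}).

Definition sym_map_free : {linear {freeg (k.-tuple V) / K} -> sym k V'} :=
  free_lift (fun t : k.-tuple V => smon (map_tuple f t)).

Lemma sym_map_rel x : sym_rel x -> sym_map_free x = 0.
Proof.
case=> [i c r s t ti tj|s t st]; last first.
  by rewrite linearB !free_liftE (@smon_perm _ _ _ (map_tuple f t)) ?subrr //= perm_map.
rewrite !(linearB sym_map_free) (linearZ_LR sym_map_free) !free_liftE.
rewrite (@smon_lin _ _ i c (map_tuple f r) (map_tuple f s)).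
- exact: addrBB.
- by rewrite !tnth_map ti linearP.
- by move=> j /tj[rj sj]; rewrite !tnth_map rj sj.
Qed.

Definition sym_map : {linear sym k V -> sym k V'} := lquot_lift sym_map_rel.

Lemma sym_mapE t : sym_map (smon t) = smon (map_tuple f t).
Proof. exact: etrans (lquot_liftE sym_map_rel _) (free_liftE _ _). Qed.
End Map.

End SymmetricPower.

Section DirectSum.
Variables (K : fieldType) (I : finType).

(* As I is finite, the direct sum of the V i is their product. *)
Definition dsum (V : I -> lmodType K) := forall i, V i.

Section Lmod.
Variable V : I -> lmodType K.
HB.instance Definition _ := Choice.on (dsum V).

Let add (f g : dsum V) : dsum V := fun i => f i + g i.
Let opp (f : dsum V) : dsum V := fun i => - f i.
Let zero : dsum V := fun i => 0.
Let scale (a : K) (f : dsum V) : dsum V := fun i => a *: f i.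

Let addA : associative add.
Proof. by move=> f g h; apply: functional_extensionality_dep => i; apply: addrA. Qed.
Let addC : commutative add.
Proof. by move=> f g; apply: functional_extensionality_dep => i; apply: addrC. Qed.
Let add0 : left_id zero add.
Proof. by move=> f; apply: functional_extensionality_dep => i; apply: add0r. Qed.
Let addN : left_inverse zero opp add.
Proof. by move=> f; apply: functional_extensionality_dep => i; apply: addNr. Qed.

HB.instance Definition _ := GRing.isZmodule.Build (dsum V) addA addC add0 addN.

Let scaleA a b f : scale a (scale b f) = scale (a * b) f.
Proof. by apply: functional_extensionality_dep => i; apply: scalerA. Qed.
Let scale1 : left_id 1 scale.
Proof. by move=> f; apply: functional_extensionality_dep => i; apply: scale1r. Qed.
Let scaleDr : right_distributive scale +%R.
Proof. by move=> a f g; apply: functional_extensionality_dep => i; apply: scalerDr. Qed.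
Let scaleDl f : {morph scale^~ f : a b / a + b}.
Proof. by move=> a b; apply: functional_extensionality_dep => i; apply: scalerDl. Qed.

HB.instance Definition _ := GRing.Zmodule_isLmodule.Build K (dsum V)
  scaleA scale1 scaleDr scaleDl.

Definition dinj (i : I) (v : V i) : dsum V :=
  fun j => if i =P j is ReflectT e then ecast k (V k) e v else 0.
End Lmod.

Section Map.
Variables (V W : I -> lmodType K) (f : forall i, {linear V i -> W i}).
Definition dsum_map_fun (x : dsum V) : dsum W := fun i => f i (x i).
Lemma dsum_map_linear : linear dsum_map_fun.
Proof. by move=> a x y; apply: functional_extensionality_dep => i; apply: linearP. Qed.
Definition dsum_map : {linear dsum V -> dsum W} :=
  HB.pack dsum_map_fun
    (GRing.isLinear.Build K (dsum V) (dsum W) _ dsum_map_fun dsum_map_linear).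
End Map.

End DirectSum.

Section Dual.
Variable K : fieldType.

Section Def.
Variable V : lmodType K.

Definition linform : {pred (V -> K^o)} := fun f => `[< linear f >].

Lemma linform_submod : submod_closed linform.
Proof.
split=> [|a f g /asboolP lf /asboolP lg]; apply/asboolP => c x y.
  by rewrite scaler0 addr0.
have E z : (a *: f + g) z = a * f z + g z by [].
have ME (u v : K^o) : u *: v = u * v by [].
by rewrite !E lf lg !ME !mulrDr !mulrA (mulrC a c) addrACA.
Qed.
HB.instance Definition _ :=
  GRing.isSubmodClosed.Build K (V -> K^o) linform linform_submod.

Record dual := Dual { dual_val :> V -> K^o; dual_valP : dual_val \in linform }.
HB.instance Definition _ := [isSub for dual_val].
HB.instance Definition _ := [Choice of dual by <:].
HB.instance Definition _ := [SubChoice_isSubLmodule of dual by <:].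
End Def.

Section Map.
Variables (U V : lmodType K) (f : {linear U -> V}).

Lemma dual_map_subproof (x : dual V) : (x \o f : U -> K^o) \in linform (V := U).
Proof.
have /asboolP lx := dual_valP x.
by apply/asboolP => c u v; rewrite /= linearP lx.
Qed.
Definition dual_map_fun (x : dual V) : dual U := Dual (dual_map_subproof x).
Lemma dual_map_linear : linear dual_map_fun.
Proof. by move=> a x y; apply: val_inj. Qed.
Definition dual_map : {linear dual V -> dual U} :=
  HB.pack dual_map_fun
    (GRing.isLinear.Build K (dual V) (dual U) _ dual_map_fun dual_map_linear).
End Map.
End Dual.

Section Coker.
Variables (K : fieldType) (U V : lmodType K) (f : {linear U -> V}).
Definition coker := lquot (fun y => exists x, y = f x).
HB.instance Definition _ := GRing.Lmodule.on coker.
Definition coker_pi : V -> coker := lpi (fun y => exists x, y = f x).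
HB.instance Definition _ := GRing.Linear.on coker_pi.
End Coker.

Definition short_exact (K : fieldType) (U V W : lmodType K)
    (f : {linear U -> V}) (g : {linear V -> W}) : Prop :=
  [/\ injective f,
      forall y, g y = 0 <-> (exists x, y = f x)
    & forall z, exists y, z = g y].

Section F2Module.
Variable A : zmodType.
Hypothesis A2 : forall a : A, a *+ 2 = 0.

Definition F2scale (c : 'F_2) (a : A) : A := a *+ c.

Let mod2 n (a : A) : a *+ (n %% 2) = a *+ n.
Proof. by rewrite [in RHS](divn_eq n 2) mulrnDr mulnC mulrnA A2 mul0rn add0r. Qed.

Lemma F2scaleA a b x : F2scale a (F2scale b x) = F2scale (a * b) x.
Proof. by rewrite /F2scale -mulrnA mod2 mulnC. Qed.
Lemma F2scale1 : left_id 1 F2scale.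
Proof. by []. Qed.
Lemma F2scaleDr : right_distributive F2scale +%R.
Proof. by move=> a x y; apply: mulrnDl. Qed.
Lemma F2scaleDl x : {morph F2scale^~ x : a b / a + b}.
Proof. by move=> a b; rewrite /F2scale mod2 mulrnDr. Qed.
End F2Module.

Lemma zmod_F2linear (U V : lmodType 'F_2) (f : {additive U -> V}) : linear f.
Proof.
move=> c x y; rewrite raddfD; congr (_ + _).
have cE : c = (c : nat)%:R by rewrite natr_Zp.
by rewrite cE !scaler_nat raddfMn.
Qed.

Section Mod2.
Variable A : zmodType.

Definition two_mul : {pred A} := fun a => `[< exists b, a = b *+ 2 >].
Lemma two_mul_zmod : zmod_closed two_mul.
Proof.
split=> [|_ _ /asboolP[a ->] /asboolP[b ->]]; apply/asboolP.
  by exists 0; rewrite mul0rn.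
by exists (a - b); rewrite mulrnBl.
Qed.
HB.instance Definition _ := GRing.isZmodClosed.Build A two_mul two_mul_zmod.

Definition mod2 := {ideal_quot two_mul}.
HB.instance Definition _ := GRing.Zmodule.on mod2.

Definition mod2_pi (a : A) : mod2 := \pi_{ideal_quot two_mul} a.
Definition mod2_repr (q : mod2) : A := repr (q : {ideal_quot two_mul}).
Lemma mod2_reprK q : mod2_pi (mod2_repr q) = q.
Proof. exact: reprK. Qed.
Lemma mod2_piB : zmod_morphism mod2_pi.
Proof. by move=> a b; rewrite /mod2_pi raddfB. Qed.
HB.instance Definition _ := GRing.isZmodMorphism.Build A mod2 mod2_pi mod2_piB.

Lemma mod2_pi_eq a b : (mod2_pi a = mod2_pi b) <-> exists c, a - b = c *+ 2.
Proof.
split=> [/eqP|[c e]]; first by rewrite -Quotient.idealrBE => /asboolP.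
by apply/eqP; rewrite -Quotient.idealrBE; apply/asboolP; exists c.
Qed.

Lemma mod2_2 (q : mod2) : q *+ 2 = 0.
Proof.
rewrite -[q]mod2_reprK -raddfMn -[RHS](raddf0 mod2_pi).
by apply/mod2_pi_eq; exists (mod2_repr q); rewrite subr0.
Qed.
HB.instance Definition _ := GRing.Zmodule_isLmodule.Build 'F_2 mod2
  (F2scaleA mod2_2) (@F2scale1 mod2) (@F2scaleDr mod2) (F2scaleDl mod2_2).

Definition two_tors : {pred A} := fun a => a *+ 2 == 0.
Lemma two_tors_zmod : zmod_closed two_tors.
Proof.
split=> [|a b /eqP a2 /eqP b2]; apply/eqP; first by rewrite mul0rn.
by rewrite mulrnBl a2 b2 subrr.
Qed.
HB.instance Definition _ := GRing.isZmodClosed.Build A two_tors two_tors_zmod.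

Record tors2 := Tors2 { tors2_val :> A; tors2_valP : tors2_val \in two_tors }.
HB.instance Definition _ := [isSub for tors2_val].
HB.instance Definition _ := [Choice of tors2 by <:].
HB.instance Definition _ := [SubChoice_isSubZmodule of tors2 by <:].

Lemma tors2_2 (x : tors2) : x *+ 2 = 0.
Proof.
by apply: val_inj; rewrite raddfMn raddf0; apply/eqP/(tors2_valP x).
Qed.
HB.instance Definition _ := GRing.Zmodule_isLmodule.Build 'F_2 tors2
  (F2scaleA tors2_2) (@F2scale1 tors2) (@F2scaleDr tors2) (F2scaleDl tors2_2).

Definition beta_fun (x : tors2) : mod2 := mod2_pi (tors2_val x).
Lemma beta_zmod : zmod_morphism beta_fun.
Proof. by move=> x y; rewrite /beta_fun -raddfB. Qed.
HB.instance Definition _ :=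
  GRing.isZmodMorphism.Build tors2 mod2 beta_fun beta_zmod.
Definition beta : {linear tors2 -> mod2} :=
  HB.pack beta_fun
    (GRing.isLinear.Build 'F_2 tors2 mod2 _ beta_fun (zmod_F2linear beta_fun)).
End Mod2.

Section Mod2Map.
Variables (A B : zmodType) (h : {additive A -> B}).

Definition mod2_map_fun (q : mod2 A) : mod2 B := mod2_pi (h (mod2_repr q)).
Lemma mod2_mapE a : mod2_map_fun (mod2_pi a) = mod2_pi (h a).
Proof.
have /mod2_pi_eq[c e] := mod2_reprK (mod2_pi a).
by apply/mod2_pi_eq; exists (h c); rewrite -raddfB e raddfMn.
Qed.
Lemma mod2_map_zmod : zmod_morphism mod2_map_fun.
Proof.
by move=> p q; rewrite -[p]mod2_reprK -[q]mod2_reprK -raddfB !mod2_mapE !raddfB.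
Qed.
HB.instance Definition _ :=
  GRing.isZmodMorphism.Build (mod2 A) (mod2 B) mod2_map_fun mod2_map_zmod.
Definition mod2_map : {linear mod2 A -> mod2 B} :=
  HB.pack mod2_map_fun (GRing.isLinear.Build 'F_2 (mod2 A) (mod2 B) _
    mod2_map_fun (zmod_F2linear mod2_map_fun)).

Lemma tors2_map_subproof (x : tors2 A) : h (tors2_val x) \in two_tors (A := B).
Proof.
have /eqP x2 := tors2_valP x.
by apply/eqP; rewrite -raddfMn x2 raddf0.
Qed.
Definition tors2_map_fun (x : tors2 A) : tors2 B := Tors2 (tors2_map_subproof x).
Lemma tors2_map_zmod : zmod_morphism tors2_map_fun.
Proof. by move=> x y; apply: val_inj; rewrite /= raddfB. Qed.
HB.instance Definition _ :=
  GRing.isZmodMorphism.Build (tors2 A) (tors2 B) tors2_map_fun tors2_map_zmod.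
Definition tors2_map : {linear tors2 A -> tors2 B} :=
  HB.pack tors2_map_fun (GRing.isLinear.Build 'F_2 (tors2 A) (tors2 B) _
    tors2_map_fun (zmod_F2linear tors2_map_fun)).
End Mod2Map.

(* Cohomology of the (additively written) group A with coefficients in the
   trivial A-module K, by inhomogeneous cochains. *)
Section Cohomology.
Variables (K : fieldType).

Definition cochain (n : nat) (A : Type) := ('I_n -> A) -> K^o.
HB.instance Definition _ n A := GRing.Lmodule.on (cochain n A).

Section Def.
Variable A : zmodType.

(* face i (a_0, ..., a_n) omits a_0 if i = 0, omits a_n if i = n + 1, and
   replaces a_(i-1), a_i by a_(i-1) + a_i otherwise. *)
Definition face (n : nat) (i : 'I_n.+2) (a : 'I_n.+1 -> A) : 'I_n -> A :=
  fun j =>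
    if (j.+1 < i)%N then a (widen_ord (leqnSn n) j)
    else if j.+1 == i :> nat then a (widen_ord (leqnSn n) j) + a (fintype.lift ord0 j)
    else a (fintype.lift ord0 j).

Definition cobound (n : nat) (f : cochain n A) : cochain n.+1 A :=
  fun a => \sum_(i < n.+2) (-1) ^+ i * f (face i a).

Lemma cobound_linear n : linear (@cobound n).
Proof.
move=> c f g; apply/funext => a.
have E m (u v : cochain m A) x : (c *: u + v) x = c * u x + v x by [].
rewrite E /cobound mulr_sumr -big_split /=.
by apply: eq_bigr => i _; rewrite E mulrDr mulrCA.
Qed.
HB.instance Definition _ n := GRing.isLinear.Build K (cochain n A)
  (cochain n.+1 A) _ (@cobound n) (@cobound_linear n).

Definition is_cocycle n : {pred (cochain n A)} := fun f => cobound f == 0.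
Lemma is_cocycle_submod n : submod_closed (@is_cocycle n).
Proof.
split=> [|a f g /eqP df /eqP dg]; apply/eqP; first by rewrite linear0.
by rewrite cobound_linear df dg scaler0 addr0.
Qed.
HB.instance Definition _ n := GRing.isSubmodClosed.Build K (cochain n A)
  (@is_cocycle n) (@is_cocycle_submod n).

Record cocycle n := Cocycle
  { cocycle_val :> cochain n A; cocycle_valP : cocycle_val \in @is_cocycle n }.
HB.instance Definition _ n := [isSub for @cocycle_val n].
HB.instance Definition _ n := [Choice of cocycle n by <:].
HB.instance Definition _ n := [SubChoice_isSubLmodule of cocycle n by <:].

Definition is_coboundary (n : nat) : cochain n A -> Prop :=
  match n with
  | 0 => fun f => f = 0
  | m.+1 => fun f => exists g : cochain m A, f = cobound g
  end.

Definition coho (n : nat) :=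
  lquot (fun f : cocycle n => is_coboundary (cocycle_val f)).
HB.instance Definition _ n := GRing.Lmodule.on (coho n).

Definition coho_class n (f : cocycle n) : coho n :=
  lpi (fun f : cocycle n => is_coboundary (cocycle_val f)) f.
HB.instance Definition _ n := GRing.isLinear.Build K (cocycle n) (coho n) _
  (@coho_class n) (lpi_linear (fun f : cocycle n => is_coboundary (cocycle_val f))).
End Def.

Section Map.
Variables (A B : zmodType) (h : {additive A -> B}) (n : nat).

Definition cochain_map m (f : cochain m B) : cochain m A := fun a => f (h \o a).

Lemma cochain_map_cobound m (f : cochain m B) :
  cobound (cochain_map f) = cochain_map (cobound f).
Proof.
apply/funext => a; apply: eq_bigr => i _; congr (_ * f _).
apply/funext => j; rewrite /face /=; case: ifP => // _; case: ifP => // _.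
by rewrite raddfD.
Qed.

Lemma cocycle_map_subproof (f : cocycle B n) :
  cochain_map f \in @is_cocycle A n.
Proof.
by apply/eqP; rewrite cochain_map_cobound; have /eqP-> := cocycle_valP f.
Qed.
Definition cocycle_map (f : cocycle B n) : cocycle A n :=
  Cocycle (cocycle_map_subproof f).

Definition cocycle_class_map (f : cocycle B n) : coho A n :=
  coho_class (cocycle_map f).
Lemma cocycle_class_map_linear : linear cocycle_class_map.
Proof. by move=> c f g; rewrite -linearP; congr (lpi _ _); apply: val_inj. Qed.
HB.instance Definition _ := GRing.isLinear.Build K (cocycle B n) (coho A n) _
  cocycle_class_map cocycle_class_map_linear.

Lemma cocycle_class_map_coboundary (f : cocycle B n) :
  is_coboundary (cocycle_val f) -> cocycle_class_map f = 0.
Proof.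
move=> bf; apply: lpi_rel.
case: f bf => f /= _; case: n f => [|m] f /=; first by move=> ->.
by case=> g ->; exists (cochain_map g); rewrite cochain_map_cobound.
Qed.

Definition coho_map : {linear coho B n -> coho A n} :=
  lquot_lift cocycle_class_map_coboundary.

Lemma coho_mapE f : coho_map (coho_class f) = coho_class (cocycle_map f).
Proof. exact: lquot_liftE cocycle_class_map_coboundary _. Qed.
End Map.
End Cohomology.

Definition fin_gen (A : zmodType) : Prop :=
  exists (n : nat) (g : 'I_n -> A),
    forall a, exists c : 'I_n -> int, a = \sum_i g i *~ c i.

Record fgAb := FgAb { fgAb_sort :> zmodType; fgAb_fin_gen : fin_gen fgAb_sort }.

Definition bideg (n : nat) :=
  {p : 'I_n.+1 * 'I_n.+1 | (p.1 + 2 * p.2 == n)%N}.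

Definition trideg (n : nat) :=
  {p : 'I_n.+1 * 'I_n.+1 * 'I_n.+1 |
    (0 < p.1.1)%N && (2 * p.1.1 + p.1.2 + 2 * p.2 == n)%N}.

Notation mod2V A := (dual (mod2 A)).
Notation tors2V A := (dual (tors2 A)).
Notation betaV A := (dual_map (beta A)).

(* The tensor factors below follow the order (k, l, m) and (i, j) of the
   multidegrees: the first factors are symmetric powers of the dual of A / 2,
   the last one is a symmetric power of the dual of the 2-torsion of A. *)
Definition bisummand n (A : zmodType) (p : bideg n) : lmodType 'F_2 :=
  tensor (sym (val p).1 (mod2V A)) (sym (val p).2 (tors2V A)).
Definition trisummand n (A : zmodType) (p : trideg n) : lmodType 'F_2 :=
  tensor (tensor (sym (val p).1.1 (mod2V A)) (sym (val p).1.2 (mod2V A)))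
         (sym (val p).2 (tors2V A)).

Definition bisum n (A : zmodType) := dsum (@bisummand n A).
Definition trisum n (A : zmodType) := dsum (@trisummand n A).
HB.instance Definition _ n A := GRing.Lmodule.on (bisum n A).
HB.instance Definition _ n A := GRing.Lmodule.on (trisum n A).

Section SumMap.
Variables (n : nat) (A B : zmodType) (h : {additive A -> B}).
Let f := dual_map (mod2_map h).
Let g := dual_map (tors2_map h).

Definition bisum_map : {linear bisum n B -> bisum n A} :=
  dsum_map (V := @bisummand n B) (W := @bisummand n A)
    (fun p => tensor_map (sym_map _ f) (sym_map _ g)).
Definition trisum_map : {linear trisum n B -> trisum n A} :=
  dsum_map (V := @trisummand n B) (W := @trisummand n A)
    (fun p => tensor_map (tensor_map (sym_map _ f) (sym_map _ f)) (sym_map _ g)).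
End SumMap.

Definition bi_elt n (A : zmodType) (p : bideg n)
    (u : sym (val p).1 (mod2V A)) (v : sym (val p).2 (tors2V A)) : bisum n A :=
  dinj (V := @bisummand n A) (i := p) (tens u v).

Definition deg20 : bideg 2 := exist _ (@Ordinal 3 2 isT, @Ordinal 3 0 isT) isT.
Definition deg01 : bideg 2 := exist _ (@Ordinal 3 0 isT, @Ordinal 3 1 isT) isT.
Definition deg30 : bideg 3 := exist _ (@Ordinal 4 3 isT, @Ordinal 4 0 isT) isT.
Definition deg11 : bideg 3 := exist _ (@Ordinal 4 1 isT, @Ordinal 4 1 isT) isT.

(* Main.v *)
(* Write V and W for the duals of A/2 and of the 2-torsion 2A of A. An element of
   V is a homomorphism A -> F_2, a 1-cocycle; an element w of W determines, by
   Ext(A, F_2) = Hom(2A, F_2), an abelian extension of A by F_2, whose factor set c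
   with c(a, a) = w(a) on 2A is a 2-cocycle. Cup products of these cocycles commute
   up to coboundaries, and x^2 is the class attached to b(x), b being the dual of
   2A -> A/2, so the graded algebra Sym(V) (x) Sym(W) / (x^2 = b(x)) maps to the
   cohomology of A; its degree n part is the cokernel of the statement. Bijectivity
   is proved by induction on a decomposition of A into cyclic groups: for A x C with
   C cyclic, Shapiro's lemma for A in A x C and the periodic resolution of C write
   every cocycle, uniquely up to coboundaries, as f0, f0 + e1 f1 or
   f0 + e1 f1 + e2 f2 (C of odd order, infinite, or of even order) with fi cocycles
   of A, e1 the generator of H^1(C), e2 the carry cocycle of C; the algebra splits in
   the same way. In degree 3, injectivity of V (x) V -> Sym^3(V) follows by
   evaluating the polarisation of cubic monomials at pairs of points of A/2. *)

Require Import Defs.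
From HB Require Import structures.
From mathcomp Require Import all_boot all_order all_algebra.
From mathcomp Require Import freeg boolp classical_sets functions.
From mathcomp Require Import zify.
From Stdlib Require Import Ring.

Set Implicit Arguments.
Unset Strict Implicit.
Unset Printing Implicit Defensive.

Import GRing.Theory Order.TTheory Num.Theory.
Local Open Scope ring_scope.

(** * Computing in the field with two elements *)

(** Cochains are functions on lists, so one function carries all degrees and no length enters a
    type; [homogeneous] and [trunc] isolate a degree. A cocycle of A x C is studied among cochains
    with values in the functions on C: Shapiro's lemma applies there, and the constant-valued
    cochains are those invariant under the shift by a generator t. The equation k(c + t) + k(c) =
    h(c) is always solvable on Z, but on a finite C only if h has sum 0; that sum is the origin of
    the third component f2. It is a cocycle of A x C, one period further down, so an even factor
    needs a second induction, on the degree in steps of two. The obstacle is that the factor set of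
    w is merely chosen and need not depend linearly or naturally on w. Injectivity of Ext(A, F_2) ->
    Hom(2A, F_2) repairs this: two abelian factor sets with equal diagonal on the 2-torsion differ
    by a coboundary, which yields linearity, x^2 = b(x) and naturality alike. The values of the
    comparison map on monomials do not refer to a decomposition of A into cyclic groups, hence
    naturality under all homomorphisms. *)

Definition F2T : Type := 'F_2.
Definition F2add (x y : F2T) : F2T := (x : 'F_2) + y.
Definition F2mul (x y : F2T) : F2T := (x : 'F_2) * y.
Definition F2id (x : F2T) : F2T := x.
Definition F2zero : F2T := (0 : 'F_2).
Definition F2one : F2T := (1 : 'F_2).
Definition F2bool (b : bool) : F2T := (b%:R : 'F_2).
(** The detour through [F2zero] moves an equation from ['F_2] to [F2T], the type at which the ring
    is declared. *)
Lemma F2_eqI (x y : F2T) : F2add x F2zero = F2add y F2zero -> x = y :> 'F_2.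
Proof. by rewrite /F2add !addr0. Qed.
Lemma F2addE (x y : 'F_2) : x + y = F2add x y. Proof. by []. Qed.
Lemma F20E : 0 = F2zero :> 'F_2. Proof. by []. Qed.
Lemma F21E : 1 = F2one :> 'F_2. Proof. by []. Qed.
Lemma F2mulE (x y : 'F_2) : x * y = F2mul x y. Proof. by []. Qed.
Lemma F2opp (x : 'F_2) : - x = x.
Proof. by case: x => [[|[]]] // i; apply: val_inj. Qed.
Lemma F2dbl (x : 'F_2) : x + x = 0.
Proof. by rewrite -{1}[x]F2opp addNr. Qed.
Lemma F2_ring_theory : ring_theory F2zero F2one F2add F2mul F2add F2id eq.
Proof.
split=> *; rewrite /F2add /F2mul /F2id /F2zero /F2one; rewrite ?(add0r, addrA, mul1r, mulrA, mulrDl, F2dbl) //.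
- exact: addrC.
- exact: mulrC.
Qed.
Lemma F2_morph : ring_morph F2zero F2one F2add F2mul F2add F2id eq
  false true xorb andb xorb id Bool.eqb F2bool.
Proof.
split=> //= [[] []|[] []|[] []|[] []] //=; exact: val_inj.
Qed.
Ltac F2cst t := match t with F2zero => constr:(false) | F2one => constr:(true) | _ => constr:(NotConstant) end.
Add Ring F2ring : F2_ring_theory (morphism F2_morph, constants [F2cst]).
(* [ring] compares atoms syntactically, while the sums and zeros inside them may
   carry different, convertible instances: [zadd] and [zzero] make them uniform. *)
Definition zadd (G : zmodType) (x y : G) : G := x + y.
Definition zzero (G : zmodType) : G := 0.
Lemma zaddE (G : zmodType) (x y : G) : x + y = zadd x y. Proof. by []. Qed.
Lemma zzeroE (G : zmodType) : 0 = zzero G. Proof. by []. Qed.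
Ltac F2 := rewrite ?F2opp ?F2addE ?F2mulE ?F20E ?F21E ?zaddE ?zzeroE;
  apply: F2_eqI; ring.

(** * Cochains on lists and the Kuenneth decomposition *)

Section Faces.
Variable G : zmodType.
Implicit Types (P F : seq G -> 'F_2) (g h : G) (s : seq G).

(* The sum of all faces of g :: s except the one that drops g. *)
Fixpoint inner_faces P g s : 'F_2 :=
  if s is h :: s' then P ((g + h) :: s') + inner_faces (fun l => P (g :: l)) h s'
  else P [::].

Lemma eq_inner_faces P Q g s : (forall l, size l = size s -> P l = Q l) ->
  inner_faces P g s = inner_faces Q g s.
Proof.
elim: s P Q g => [|h s IH] P Q g PQ /=; first exact: PQ.
by rewrite PQ // (IH _ (fun l => Q (g :: l))) // => l sl; apply: PQ; rewrite /= sl.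
Qed.

Lemma inner_facesD P Q g s :
  inner_faces (fun l => P l + Q l) g s = inner_faces P g s + inner_faces Q g s.
Proof. by elim: s P Q g => [|h s IH] P Q g //=; rewrite IH; F2. Qed.

Lemma inner_facesZ a P g s :
  inner_faces (fun l => a * P l) g s = a * inner_faces P g s.
Proof. by elim: s P g => [|h s IH] P g //=; rewrite IH; F2. Qed.

Lemma inner_faces0 g s : inner_faces (fun=> 0) g s = 0.
Proof. by elim: s g => [|h s IH] g //=; rewrite IH add0r. Qed.

Lemma inner_faces_sum I (r : seq I) (P : I -> seq G -> 'F_2) g s :
  inner_faces (fun l => \sum_(i <- r) P i l) g s =
  \sum_(i <- r) inner_faces (P i) g s.
Proof. by elim: s P g => [|h s IH] P g //=; rewrite IH big_split. Qed.

(** The heart of d d = 0: modulo 2 the double faces that leave the first entry [g] alone cancel. *)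
Lemma inner_faces2 P g h s :
  inner_faces (inner_faces P g) h s = inner_faces P (g + h) s.
Proof.
elim: s P g h => [|k s IH] P g h //=.
by rewrite inner_facesD IH (addrA g); F2.
Qed.

(** The cup product with a left factor of degree [p] and a right factor of all degrees at once; [P]
    is read only on lists of length [p]. *)
Fixpoint lcup p P F s : 'F_2 :=
  match p, s with
  | 0, _ => P [::] * F s
  | p'.+1, [::] => 0
  | p'.+1, g :: s' => lcup p' (fun l => P (g :: l)) F s'
  end.

Lemma eq_lcup p P F F' s : (forall l, F l = F' l) -> lcup p P F s = lcup p P F' s.
Proof. by move=> E; elim: p P s => [|p IH] P [|g s] //=; rewrite E. Qed.

Lemma lcupDl p P Q F s :
  lcup p (fun l => P l + Q l) F s = lcup p P F s + lcup p Q F s.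
Proof. by elim: p P Q s => [|p IH] P Q [|g s] //=; [F2|F2|rewrite addr0]. Qed.

Lemma lcupDr p P F H s :
  lcup p P (fun l => F l + H l) s = lcup p P F s + lcup p P H s.
Proof. by elim: p P s => [|p IH] P [|g s] //=; [F2|F2|rewrite addr0]. Qed.

Lemma lcupZr p P a F s : lcup p P (fun l => a * F l) s = a * lcup p P F s.
Proof. by elim: p P s => [|p IH] P [|g s] //=; [F2|F2|rewrite mulr0]. Qed.

Lemma lcup0r p P s : lcup p P (fun=> 0) s = 0.
Proof. by elim: p P s => [|p IH] P [|g s] //=; rewrite mulr0. Qed.

End Faces.

Section TwistedCochains.
Variables (G : zmodType) (X : zmodType) (q : {additive G -> X}).
Implicit Types (P : X -> seq G -> 'F_2) (F : seq G -> 'F_2) (s : seq G) (c : X).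

(* The coboundary of cochains with values in the functions X -> F_2, on which
   G acts by translations through q; all degrees are treated at once. *)
Definition dtw P c s : 'F_2 :=
  if s is g :: s' then P (c + q g) s' + inner_faces (P c) g s' else 0.

Definition delta F s : 'F_2 :=
  if s is g :: s' then F s' + inner_faces F g s' else 0.

Lemma dtw_const F c s : dtw (fun=> F) c s = delta F s. Proof. by []. Qed.

Lemma eq_dtw P Q c s : (forall c s, P c s = Q c s) -> dtw P c s = dtw Q c s.
Proof. by move=> E; case: s => // g s /=; rewrite E (eq_inner_faces _ (fun l _ => E c l)). Qed.

Lemma eq_delta F H s : (forall s, F s = H s) -> delta F s = delta H s.
Proof. by move=> E; case: s => // g s /=; rewrite E (eq_inner_faces _ (fun l _ => E l)). Qed.

Lemma dtwD P Q c s : dtw (fun c s => P c s + Q c s) c s = dtw P c s + dtw Q c s.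
Proof. by case: s => [|g s] /=; rewrite ?addr0 // inner_facesD; F2. Qed.

Lemma deltaD F H s : delta (fun s => F s + H s) s = delta F s + delta H s.
Proof. by case: s => [|g s] /=; rewrite ?addr0 // inner_facesD; F2. Qed.

Lemma deltaZ a F s : delta (fun s => a * F s) s = a * delta F s.
Proof. by case: s => [|g s] /=; rewrite ?mulr0 // inner_facesZ; F2. Qed.

Lemma delta0 s : delta (fun=> 0) s = 0.
Proof. by case: s => [|g s] //=; rewrite inner_faces0 addr0. Qed.

Lemma dtw_shift P t c s : dtw (fun c => P (c + t)) c s = dtw P (c + t) s.
Proof. by case: s => [|g s] //=; rewrite addrAC. Qed.

Lemma dtw_dtw P c s : dtw (dtw P) c s = 0.
Proof.
case: s => [|g [|h s]] //=; first by F2.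
rewrite inner_facesD inner_faces2 raddfD (addrA c); F2.
Qed.

(** Leibniz rule: the face of the left factor that drops its last entry and the first face of [F]
    give the same term and cancel modulo 2. Translations act on [P] alone because [F] is constant in
    [c]. *)
Lemma dtw_lcup p P F c s :
  dtw (fun c => lcup p (P c) F) c s =
  lcup p.+1 (dtw P c) F s + lcup p (P c) (delta F) s.
Proof.
have LE r Q g l : inner_faces (lcup r Q F) g l =
    lcup r (inner_faces Q g) F l + lcup r Q (delta F) (g :: l).
  elim: l r Q g => [|h l IH] [|r] Q g /=; first by F2.
  - by case: r => /=; rewrite ?mulr0 addr0.
  - by rewrite inner_facesZ; F2.
  - by rewrite IH lcupDl; F2.
case: s => [|g s] /=.
  by case: p => [|p] /=; rewrite ?mulr0 addr0.
by rewrite LE lcupDl addrA.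
Qed.

End TwistedCochains.

Lemma delta_lcup (G : zmodType) p (P F : seq G -> 'F_2) s :
  delta (lcup p P F) s = lcup p.+1 (delta P) F s + lcup p P (delta F) s.
Proof. exact: (dtw_lcup (\0 : {additive G -> G}) p (fun=> P) F 0 s). Qed.

Lemma delta_delta (G : zmodType) (F : seq G -> 'F_2) s : delta (delta F) s = 0.
Proof. exact: (dtw_dtw (\0 : {additive G -> G}) (fun=> F) 0 s). Qed.

Definition pullback (S T : Type) (f : S -> T) (F : seq T -> 'F_2) (s : seq S) :=
  F (map f s).

Lemma inner_faces_pullback (G H : zmodType) (f : {additive G -> H}) F g s :
  inner_faces (pullback f F) g s = inner_faces F (f g) (map f s).
Proof.
by elim: s F g => [|h s IH] F g //=; rewrite {1}/pullback /= raddfD -IH.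
Qed.

Lemma delta_pullback (G H : zmodType) (f : {additive G -> H}) F s :
  delta (pullback f F) s = delta F (map f s).
Proof. by case: s => [|g s] //=; rewrite inner_faces_pullback. Qed.

Lemma lcup_pullback (G H : zmodType) (f : G -> H) p P F s :
  lcup p (pullback f P) (pullback f F) s = pullback f (lcup p P F) s.
Proof. by elim: p P s => [|p IH] P [|g s] //=; rewrite -[RHS]IH. Qed.

Definition coc (G : zmodType) (F : seq G -> 'F_2) := forall s, delta F s = 0.
Definition cob (G : zmodType) (F : seq G -> 'F_2) :=
  exists k, forall s, F s = delta k s.

(** * Shapiro's lemma by an explicit prism homotopy *)

Section Shapiro.
Variables (G X : zmodType) (q : {additive G -> X}).
Variables (a : {additive G -> G}) (j : X -> G).
Hypotheses (qj : forall c, q (j c) = c) (qa : forall g, q (a g) = 0).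
Hypothesis ja : forall c g, j c + g = a g + j (c + q g).
Implicit Types (P : seq G -> 'F_2) (c : X) (g : G) (s : seq G).

(* Restriction to the kernel of q as a retraction of the action groupoid of G
   on X: the prism operator of the natural transformation with components j. *)
Fixpoint prism P c s : 'F_2 :=
  if s is g :: s' then P (j c :: s) + prism (fun l => P (a g :: l)) (c + q g) s'
  else P [:: j c].

Lemma eq_prism P Q c s : (forall g l, P (g :: l) = Q (g :: l)) ->
  prism P c s = prism Q c s.
Proof.
elim: s P Q c => [|g s IH] P Q c PQ /=; first exact: PQ.
by rewrite PQ (IH _ (fun l => Q (a g :: l))).
Qed.

Lemma prismD P Q c s : prism (fun l => P l + Q l) c s = prism P c s + prism Q c s.
Proof. by elim: s P Q c => [|g s IH] P Q c //=; rewrite IH; F2. Qed.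

Lemma prism0 c s : prism (fun=> 0) c s = 0.
Proof. by elim: s c => [|g s IH] c //=; rewrite IH addr0. Qed.

(** A natural transformation induces a homotopy, here between the identity and the restriction along
    [a]. The naturality square is [ja]: it matches the face that merges [j c] with the next entry
    [g] and the face that merges [a g] with the following [j]. *)
Lemma prism_homotopy P c g s :
  prism P (c + q g) s + inner_faces (prism P c) g s + prism (delta P) c (g :: s) =
  P (g :: s) + P (map a (g :: s)).
Proof.
elim: s P c g => [|h s IH] P c g; first by rewrite /= ja; F2.
(* [Q] is the coboundary of [P] at a list with first entry [a g], regrouped as a function of the
   remaining list, so that the induction hypothesis applies to its last summand. The summand with
   [behead] compensates the first face contained in that one. *)
pose Q l := P l + ((if l is k :: l' then P (a g + k :: l') else 0) +
  (P (a g :: behead l) + delta (fun l => P (a g :: l)) l)).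
have stepE k l : delta P (a g :: k :: l) = Q (k :: l) by rewrite /Q /=; F2.
have -> : prism (delta P) c (g :: h :: s) = delta P (j c :: g :: h :: s) +
    (prism P (c + q g) (h :: s) +
     (P (j c + g :: h :: s) + prism (fun l => P (a (g + h) :: l)) (c + q (g + h)) s
      + (P (a g :: h :: s) + prism (fun l => P (a g :: l)) (c + q g + q h) s
      + prism (delta (fun l => P (a g :: l))) (c + q g) (h :: s)))).
  rewrite [LHS]/=; congr (_ + _).
  rewrite -[LHS]/(prism (fun l => delta P (a g :: l)) (c + q g) (h :: s)).
  rewrite (@eq_prism (fun l => delta P (a g :: l)) Q) // /Q !prismD; congr (_ + (_ + (_ + _))).
  by rewrite /= ja !raddfD (addrA c).
have := IH (fun l => P (a g :: l)) (c + q g) h.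
set U := prism (delta _) _ _; move=> /(canRL (addKr _)) ->; rewrite F2opp.
rewrite /= inner_facesD !raddfD (addrA c); F2.
Qed.

(** [v 0] need not be a cocycle of [G]: its coboundary at [k :: l] is [v 0 l + v (q k) l]. Under
    [prism] this leaves [v 0 + v c], since the entry [j c] has image [c] and the entries [a g] have
    image 0; the prism homotopy does the rest. *)
Lemma shapiro (v : X -> seq G -> 'F_2) :
  (forall c s, dtw q v c s = 0) ->
  forall c s, v c s = v 0 (map a s) + dtw q (prism (v 0)) c s.
Proof.
move=> dv c [|g s].
  have /= := dv 0 [:: j c]; rewrite add0r qj addr0 => e.
  by rewrite -[RHS]addr0 -e; F2.
have dv0 k l : delta (v 0) (k :: l) =
    v 0 (behead (k :: l)) + v (q (head 0 (k :: l))) (behead (k :: l)).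
  have /= := dv 0 (k :: l); rewrite add0r => e.
  by rewrite -[LHS]addr0 -e; F2.
have e : prism (delta (v 0)) c (g :: s) = v 0 (g :: s) + v c (g :: s).
  rewrite (@eq_prism _ (fun l => v 0 (behead l) + v (q (head 0 l)) (behead l)) _ _ dv0) /= qj -[RHS]addr0; congr (_ + _).
  rewrite -[RHS](prism0 (c + q g) s); apply: eq_prism => k l.
  by rewrite qa; F2.
have := prism_homotopy (v 0) c g s.
rewrite e => /(canRL (addrK _)) /= ->; F2.
Qed.

End Shapiro.

(** * Cocycles of a product, through functions on the second factor *)

Section Kunneth.
Variables (A C : zmodType).
Let G : zmodType := (A * C)%type.

Definition inl0 (x : A) : G := (x, 0).
Lemma inl0_zmod : zmod_morphism inl0.
Proof. by move=> x y; rewrite /inl0 -[RHS]/(_, _) subr0. Qed.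
HB.instance Definition _ := GRing.isZmodMorphism.Build A G inl0 inl0_zmod.

Let q : {additive G -> C} := snd.
Let p : {additive G -> A} := fst.
Let a : {additive G -> G} := (inl0 \o p).

Lemma kunneth_shapiro (v : C -> seq G -> 'F_2) :
  (forall c s, dtw q v c s = 0) ->
  exists h, forall c s, v c s = v 0 (map inl0 (map p s)) + dtw q h c s.
Proof.
move=> dv; exists (prism q a (pair 0) (v 0)) => c s; rewrite -map_comp.
apply: (shapiro (a := a)) => // d [x y].
by rewrite -[LHS]/(0 + x, d + y) -[RHS]/(x + 0, 0 + (d + y)) !add0r addr0.
Qed.

Lemma pullback_proj (f : seq A -> 'F_2) s :
  pullback inl0 (pullback p f) s = f s.
Proof. by rewrite /pullback -map_comp map_id. Qed.

Lemma cob_proj (f : seq A -> 'F_2) : cob (pullback p f) -> cob f.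
Proof.
move=> [k fk]; exists (pullback inl0 k) => s.
by rewrite delta_pullback -fk -[LHS]pullback_proj.
Qed.

Lemma kunneth_restrict F : coc F ->
  exists g, forall c s, F s = pullback p (pullback inl0 F) s + dtw q g c s.
Proof.
by move=> cF; have [|g Fg] := kunneth_shapiro (v := fun=> F); last by exists g.
Qed.

Lemma coc_restrict F : coc F -> coc (pullback inl0 F).
Proof. by move=> cF s; rewrite delta_pullback. Qed.

Lemma coc_proj F : coc F -> coc (pullback p F).
Proof. by move=> cF s; rewrite delta_pullback. Qed.

Variables (t : C) (tau : {additive C -> 'F_2}).
Hypothesis tau_t : tau t = 1.
Hypothesis t_inv : forall f : C -> 'F_2, (forall c, f (c + t) = f c) ->
  forall c, f c = f 0.

Definition degree1 (s : seq G) : 'F_2 := tau (q (head 0 s)).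

(** A 0-cochain with values in the functions on [C]: its coboundary is [degree1], and the shift by
    [t] changes it by the constant 1. *)
Let eps (c : C) (s : seq G) : 'F_2 := tau c.

Lemma dtw_eps f c s : coc f ->
  dtw q (fun c => lcup 0 (eps c) f) c s = lcup 1 degree1 f s.
Proof.
move=> cf; rewrite dtw_lcup /= cf mulr0 addr0.
by case: s => //= g s; rewrite /eps /degree1 raddfD /=; F2.
Qed.

Lemma eps_shift f c s : lcup 0 (eps (c + t)) f s = lcup 0 (eps c) f s + f s.
Proof. by rewrite /= /eps raddfD tau_t; F2. Qed.

Lemma degree1_inl0 f s : pullback inl0 (lcup 1 degree1 f) s = 0.
Proof. by case: s => [|g s] //=; rewrite /pullback /= /degree1 /= raddf0 mul0r. Qed.

(** The connecting map for F_2 -> Fun(C) -> Fun(C), the second arrow being identity plus shift by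
    [t]. Shapiro makes [F] the coboundary of [g] up to [f0]; both cocycles are constant in [c], so
    the difference of [g] and its shift is again a cocycle, to which Shapiro applies. *)
Lemma kunneth_shift_surj F : coc F ->
  exists f0 f1 g h, [/\ coc f0, coc f1,
    forall c s, F s = pullback p f0 s + dtw q g c s
  & forall c s, g (c + t) s + g c s = pullback p f1 s + dtw q h c s].
Proof.
move=> cF; have [g Fg] := kunneth_restrict cF.
have dg c s : dtw q g c s = F s + pullback p (pullback inl0 F) s.
  by rewrite (Fg c); F2.
pose u c s := g (c + t) s + g c s.
have du c s : dtw q u c s = 0 by rewrite dtwD dtw_shift !dg; F2.
have [h uh] := kunneth_shapiro du.
exists (pullback inl0 F), (pullback inl0 (u 0)), g, h; split=> //.
  exact: coc_restrict.
move=> s; rewrite delta_pullback -[RHS](du 0 (map inl0 s)).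
by case: s => //= x s; rewrite addr0.
Qed.

(** By Shapiro [v] is constant in [c] up to the coboundary of [h]. The constant part is lost in the
    difference with the shift, which exhibits [f1] as a coboundary. The cocycle of the second
    conclusion serves the third component in the even case. *)
Lemma kunneth_shift_inj f1 v m : (forall c s, dtw q v c s = 0) ->
  (forall c s, v (c + t) s + v c s = pullback p f1 s + dtw q m c s) ->
  exists r h, (forall s, f1 s = delta r s) /\
    forall c s, dtw q (fun c s => pullback p r s + (h (c + t) s + h c s + m c s)) c s = 0.
Proof.
move=> dv vm; have [h vh] := kunneth_shapiro dv.
have f1E c s : pullback p f1 s = dtw q (fun c s => h (c + t) s + h c s + m c s) c s.
  rewrite !dtwD dtw_shift; have := vm c s.
  rewrite (vh (c + t)) (vh c) => e; rewrite -[LHS]addr0 -(F2dbl (dtw q m c s)) addrA -e.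
  by F2.
pose r := pullback inl0 (fun s => h (0 + t) s + h 0 s + m 0 s).
have rE s : f1 s = delta r s.
  rewrite delta_pullback -[LHS]pullback_proj {1}/pullback (f1E 0).
  by case: s => //= x s; rewrite addr0.
exists r, h; split=> // c s.
by rewrite dtwD dtw_const delta_pullback -rE -f1E F2dbl.
Qed.

Section Infinite.
Hypothesis antidiff : forall f : C -> 'F_2, exists k, forall c, k (c + t) + k c = f c.

Lemma kunneth_infinite_surj F : coc F -> exists f0 f1, [/\ coc f0, coc f1 &
  cob (fun s => F s + pullback p f0 s + lcup 1 degree1 (pullback p f1) s)].
Proof.
move=> cF; have [f0 [f1 [g [h [c0 c1 Fg gh]]]]] := kunneth_shift_surj cF.
exists f0, f1; split=> //.
have [k hk] := boolp.choice (fun s => antidiff (h^~ s)).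
(* The terms added to [g] make [w] invariant under the shift by [t], hence constant in [c], so that
   [w 0] is an ordinary cochain of the product. *)
pose w c s := g c s + lcup 0 (eps c) (pullback p f1) s + dtw q (fun c s => k s c) c s.
have w_inv s c : w c s = w 0 s.
  apply: (t_inv (f := w^~ s)) => d; rewrite /w eps_shift.
  rewrite -(dtw_shift q (fun c s => k s c) t).
  have -> : dtw q (fun c s => k s (c + t)) d s =
            dtw q (fun c s => k s c) d s + dtw q h d s.
    rewrite -dtwD; apply: eq_dtw => e l; rewrite -hk; F2.
  by have := gh d s => /(canRL (addrK _)) ->; F2.
exists (w 0) => s; rewrite -(dtw_const q (w 0) 0).
have -> : dtw q (fun=> w 0) 0 s = dtw q w 0 s.
  by apply: eq_dtw => c l; rewrite w_inv.
rewrite /w dtwD dtwD dtw_dtw dtw_eps; last exact: coc_proj.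
by rewrite (Fg 0); F2.
Qed.

Lemma kunneth_infinite_inj f0 f1 : coc f0 -> coc f1 ->
  cob (fun s => pullback p f0 s + lcup 1 degree1 (pullback p f1) s) ->
  cob f0 /\ cob f1.
Proof.
move=> c0 c1 [k fk].
have k0 s : f0 s = delta (pullback inl0 k) s.
  rewrite delta_pullback -fk -/(pullback inl0 (lcup _ _ _) s) degree1_inl0 addr0.
  by rewrite -[LHS]pullback_proj.
split; first by exists (pullback inl0 k).
(* [v] is a twisted cocycle because [degree1] is the coboundary of [eps], and the shift changes it
   by [f1] alone. *)
pose v c s := lcup 0 (eps c) (pullback p f1) s + (k s + pullback p (pullback inl0 k) s).
have [c s|c s|r [h [rE _]]] := @kunneth_shift_inj f1 v (fun _ _ => 0).
- rewrite dtwD dtw_eps; last exact: coc_proj.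
  by rewrite dtw_const deltaD -fk delta_pullback -k0 /pullback; F2.
- by rewrite /v eps_shift dtw_const delta0; F2.
- by exists r.
Qed.
End Infinite.

Section Finite.
Variable e : seq C.
Hypothesis e_shift : forall x, perm_eq [seq c + x | c <- e] e.

Lemma sum_shift (f : C -> 'F_2) x : \sum_(c <- e) f (c + x) = \sum_(c <- e) f c.
Proof. by rewrite -(big_map (+%R^~ x) xpredT) (perm_big _ (e_shift x)). Qed.

Lemma sum_dtw P s : \sum_(c <- e) dtw q P c s = delta (fun l => \sum_(c <- e) P c l) s.
Proof.
case: s => [|g s] /=; first by rewrite big1.
by rewrite big_split inner_faces_sum (sum_shift (P^~ s)).
Qed.

Lemma sum_const (x : 'F_2) : \sum_(c <- e) x = (size e)%:R * x.
Proof. by rewrite big_const_seq count_predT iter_addr_0 mulr_natl. Qed.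

(** Transfer: summation over the odd number of points of [C] makes [g] constant in [c] and keeps [F]
    and [f0], which are constant already. *)
Lemma kunneth_odd_surj F : (size e)%:R = 1 :> 'F_2 -> coc F ->
  exists2 f0, coc f0 & cob (fun s => F s + pullback p f0 s).
Proof.
move=> e1 cF; have [g Fg] := kunneth_restrict cF.
exists (pullback inl0 F); first exact: coc_restrict.
exists (fun l => \sum_(c <- e) g c l) => s; rewrite -sum_dtw.
have dg c : dtw q g c s = F s + pullback p (pullback inl0 F) s.
  by rewrite (Fg c); F2.
by rewrite (eq_bigr _ (fun c _ => dg c)) sum_const e1 mul1r.
Qed.

Hypothesis e_even : (size e)%:R = 0 :> 'F_2.
Hypothesis antidiff : forall f : C -> 'F_2, \sum_(c <- e) f c = 0 ->
  exists k, forall c, k (c + t) + k c = f c.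
Variables (kappa : C -> C -> 'F_2) (eps0 : C -> 'F_2).
Hypothesis kappa0 : kappa 0 0 = 0.
Hypothesis kappa_cocycle : forall x y z,
  kappa y z + kappa (x + y) z + kappa x (y + z) + kappa x y = 0.
Hypothesis eps0_sum : \sum_(c <- e) eps0 c = 1.
Hypothesis kappa_eps0 : forall c x,
  kappa (c + t) x + kappa c x = eps0 (c + x) + eps0 c.

Definition degree2 (s : seq G) : 'F_2 := kappa (q (nth 0 s 0)) (q (nth 0 s 1)).

(** Further steps of the periodic resolution: [degree2] is the coboundary of [eps1], the shift
    changes [eps1] by the coboundary of [eps0'], and [eps0'] has sum 1 over [C]. *)
Let eps1 (c : C) (s : seq G) : 'F_2 := kappa c (q (head 0 s)).
Let eps0' (c : C) (s : seq G) : 'F_2 := eps0 c.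

Lemma dtw_eps1 f c s : coc f ->
  dtw q (fun c => lcup 1 (eps1 c) f) c s = lcup 2 degree2 f s.
Proof.
move=> cf; rewrite dtw_lcup (eq_lcup _ _ _ cf) lcup0r addr0.
case: s => [|g [|h s]] //; rewrite [LHS]/= [RHS]/=; congr (_ * _).
rewrite /eps1 /degree2 /= -[LHS]addr0 -(kappa_cocycle c g.2 h.2); F2.
Qed.

Lemma eps1_shift f c s : coc f ->
  lcup 1 (eps1 (c + t)) f s =
  lcup 1 (eps1 c) f s + dtw q (fun c => lcup 0 (eps0' c) f) c s.
Proof.
move=> cf; rewrite dtw_lcup [lcup 0 _ _ s]/= cf mulr0 addr0.
case: s => [|g s] /=; first by rewrite addr0.
rewrite -mulrDl; congr (_ * _); rewrite /eps1 /eps0' /= -kappa_eps0; F2.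
Qed.

Lemma degree2_inl0 f s : pullback inl0 (lcup 2 degree2 f) s = 0.
Proof.
by case: s => [|g [|h s]] //=; rewrite /pullback /= /degree2 /= kappa0 mul0r.
Qed.

Lemma kunneth_even_surj F : coc F -> exists f0 f1 f2,
  [/\ coc f0, coc f1, coc f2 &
  cob (fun s => F s + pullback p f0 s + lcup 1 degree1 (pullback p f1) s
    + lcup 2 degree2 f2 s)].
Proof.
move=> cF; have [f0 [f1 [g [h [c0 c1 Fg gh]]]]] := kunneth_shift_surj cF.
(* The norm of [h], which obstructs the choice of an antidifference. It is a cocycle of the whole
   product: the shift of [g] drops out of the sum, and the even size kills the term with [f1]. *)
pose f2 l := \sum_(c <- e) h c l.
have c2 : coc f2.
  move=> s; rewrite /f2 -sum_dtw.
  have dh c : dtw q h c s = g (c + t) s + g c s + pullback p f1 s.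
    by rewrite gh; F2.
  rewrite (eq_bigr _ (fun c _ => dh c)) !big_split /= (sum_shift (g^~ s)).
  by rewrite F2dbl sum_const e_even mul0r addr0.
exists f0, f1, f2; split=> //.
(* The sums over [C] of [h] and of [eps0'] times [f2] are both [f2], so their sum has an
   antidifference. *)
have [|k hk] := boolp.choice (fun s => antidiff (f := fun c => h c s + lcup 0 (eps0' c) f2 s) _).
  by move=> s; rewrite big_split /= -mulr_suml eps0_sum mul1r F2dbl.
pose w c s := g c s + lcup 0 (eps c) (pullback p f1) s + lcup 1 (eps1 c) f2 s
  + dtw q (fun c s => k s c) c s.
have w_inv s c : w c s = w 0 s.
  apply: (t_inv (f := w^~ s)) => d; rewrite /w eps_shift eps1_shift //.
  rewrite -(dtw_shift q (fun c s => k s c) t).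
  have -> : dtw q (fun c s => k s (c + t)) d s = dtw q (fun c s => k s c) d s +
     (dtw q h d s + dtw q (fun c => lcup 0 (eps0' c) f2) d s).
    rewrite -!dtwD; apply: eq_dtw => b l; rewrite -hk; F2.
  by have := gh d s => /(canRL (addrK _)) ->; F2.
exists (w 0) => s; rewrite -(dtw_const q (w 0) 0).
have -> : dtw q (fun=> w 0) 0 s = dtw q w 0 s.
  by apply: eq_dtw => c l; rewrite w_inv.
rewrite /w !dtwD dtw_dtw dtw_eps ?dtw_eps1 //; last exact: coc_proj.
by rewrite (Fg 0); F2.
Qed.

Lemma kunneth_even_inj f0 f1 f2 : coc f0 -> coc f1 -> coc f2 ->
  cob (fun s => pullback p f0 s + lcup 1 degree1 (pullback p f1) s
    + lcup 2 degree2 f2 s) ->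
  [/\ cob f0, cob f1 & cob f2].
Proof.
move=> c0 c1 c2 [k fk].
have k0 s : f0 s = delta (pullback inl0 k) s.
  rewrite delta_pullback -fk -/(pullback inl0 (lcup 1 _ _) s) degree1_inl0 addr0.
  rewrite -/(pullback inl0 (lcup _ _ _) s) degree2_inl0 addr0.
  by rewrite -[LHS]pullback_proj.
pose v c s := lcup 0 (eps c) (pullback p f1) s + (lcup 1 (eps1 c) f2 s
  + (k s + pullback p (pullback inl0 k) s)).
have [c s|c s|r [h [rE hE]]] :=
    @kunneth_shift_inj f1 v (fun c => lcup 0 (eps0' c) f2).
- rewrite !dtwD dtw_eps ?dtw_eps1 //; last exact: coc_proj.
  by rewrite !dtw_const delta_pullback -fk -k0 /pullback; F2.
- by rewrite /v eps_shift eps1_shift //; F2.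
split; [by exists (pullback inl0 k) | by exists r |].
have [h2 h2E] := kunneth_shapiro hE.
(* Summation over [C] kills the difference of [h] and its shift and, the size being even, every term
   constant in [c]; what survives is [f2], since [eps0] has sum 1. *)
exists (fun l => \sum_(c <- e) h2 c l) => s; rewrite -sum_dtw.
pose S := map inl0 (map p s).
pose x := pullback p r S + (h (0 + t) S + h 0 S + lcup 0 (eps0' 0) f2 S).
have dh2 c : dtw q h2 c s = pullback p r s + (h (c + t) s + h c s + lcup 0 (eps0' c) f2 s) + x.
  by rewrite (h2E c) -/S -/x; F2.
rewrite (eq_bigr _ (fun c _ => dh2 c)) !big_split /= !sum_const e_even (sum_shift (h^~ s)).
by rewrite -mulr_suml eps0_sum !mul0r mul1r F2dbl !addr0 !add0r.
Qed.
End Finite.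
End Kunneth.

(** * Cyclic and finitely generated abelian groups *)

Section CyclicGroups.
Variable m : nat.
Implicit Types c x y z : 'I_m.+1.

(** The generator 1, written so as to cover the trivial group [m = 0], where it is 0. *)
Definition ord_step : 'I_m.+1 := inZp 1.

Lemma val_ordD x y : (x + y : 'I_m.+1) = (if m < x + y then x + y - m.+1 else x + y)%N :> nat.
Proof.
have := ltn_ord x; have := ltn_ord y; rewrite /= => ym xm.
have [xy|xy] := ltnP m (x + y); last by rewrite modn_small.
rewrite -{1}(subnK xy) modnDr modn_small //; lia.
Qed.

Lemma inZpS k : inZp k.+1 = inZp k + ord_step :> 'I_m.+1.
Proof. by apply: val_inj; rewrite /= modnDml modnDmr addn1. Qed.

Lemma inZp_0 : inZp 0 = 0 :> 'I_m.+1.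
Proof. exact: val_inj. Qed.

Lemma ord_step_ind (P : 'I_m.+1 -> Prop) :
  P 0 -> (forall c, P c -> P (c + ord_step)) -> forall c, P c.
Proof.
move=> P0 PS c; rewrite -[c]valZpK; elim: (c : nat) => [|k IH]; first by rewrite inZp_0.
by rewrite inZpS; apply: PS.
Qed.

Lemma ord_step_inv (f : 'I_m.+1 -> 'F_2) : (forall c, f (c + ord_step) = f c) ->
  forall c, f c = f 0.
Proof. by move=> fS; apply: ord_step_ind => // c fc; rewrite fS. Qed.

(** [k c] is the sum of [f] over the elements below [c]; the vanishing of the total sum closes the
    circle at the step from [m] to 0. *)
Lemma ord_antidiff (f : 'I_m.+1 -> 'F_2) : \sum_(c <- enum 'I_m.+1) f c = 0 ->
  exists k, k 0 = 0 /\ forall c, k (c + ord_step) + k c = f c.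
Proof.
rewrite big_enum /= => f0; pose S n := \sum_(0 <= y < n) f (inZp y).
have Sm : S m.+1 = 0.
  by rewrite -f0 /S big_mkord; apply: eq_bigr => i _; rewrite valZpK.
exists (fun c => S c); split; first by rewrite /S big_geq.
move=> c; rewrite -{1}[c]valZpK -inZpS.
have [cm|] := ltnP c m.
  have -> : S (inZp c.+1 : 'I_m.+1) = S c.+1 by rewrite /= modn_small.
  by rewrite {1}/S big_nat_recr //= valZpK -/(S c); F2.
move=> mc; have {mc}cm : c = m :> nat by have := ltn_ord c; lia.
have -> : S (inZp c.+1 : 'I_m.+1) = S m.+1.
  by rewrite Sm cm /= modnn /S big_geq.
have -> : S m.+1 = S c.+1 by rewrite cm.
by rewrite {1}/S big_nat_recr //= valZpK -/(S c); F2.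
Qed.

Lemma ord_enum_shift x : perm_eq [seq c + x | c <- enum 'I_m.+1] (enum 'I_m.+1).
Proof.
apply: uniq_perm; rewrite ?enum_uniq //.
  by rewrite map_inj_uniq ?enum_uniq //; exact: addIr.
move=> c; rewrite mem_enum; apply/mapP; exists (c - x); rewrite ?mem_enum //.
by rewrite subrK.
Qed.

Definition ord_parity c : 'F_2 := (c : nat)%:R.

Lemma F2_natr n : (n%:R : 'F_2) = (odd n)%:R.
Proof.
by elim: n => // n IH; rewrite mulrS IH /=; case: (odd n); apply: val_inj.
Qed.

Lemma F2_natr_eq k n : odd k = odd n -> k%:R = n%:R :> 'F_2.
Proof. by move=> kn; rewrite F2_natr kn -F2_natr. Qed.

Definition ord_carry x y : 'F_2 := (m < x + y)%N%:R.

(** Marks the point at which adding [ord_step] wraps around; it is the function [eps0] of the even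
    case. *)
Definition ord_last c : 'F_2 := (c == m :> nat)%:R.

Lemma ord_carry00 : ord_carry 0 0 = 0.
Proof. by []. Qed.

Lemma ord_carryC x y : ord_carry x y = ord_carry y x.
Proof. by rewrite /ord_carry addnC. Qed.

Lemma ord_carry_cocycle x y z :
  ord_carry y z + ord_carry (x + y) z + ord_carry x (y + z) + ord_carry x y = 0.
Proof.
rewrite /ord_carry -!natrD !val_ordD; have := ltn_ord x; have := ltn_ord y; have := ltn_ord z.
move=> zm ym xm.
apply: (@F2_natr_eq _ 0).
by case: (ltnP m (y + z)); case: (ltnP m (x + y)) => ? ?; lia.
Qed.

(** Passing from [c] to its successor changes the carry once if [c + x] is the last element and once
    if [c] itself wraps around. *)
Lemma ord_carry_last c x :
  ord_carry (c + ord_step) x + ord_carry c x = ord_last (c + x) + ord_last c.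
Proof.
rewrite /ord_carry /ord_last -!natrD; apply: F2_natr_eq.
rewrite -{1}[c]valZpK -inZpS val_ordD; have := ltn_ord c; have := ltn_ord x => xm cm.
have -> : (inZp c.+1 : 'I_m.+1) = (if c == m :> nat then 0 else c.+1)%N :> nat.
  have [->|cm'] := eqVneq (c : nat) m; first by rewrite /= modnn.
  by rewrite /= modn_small //; lia.
by case: (eqVneq (c : nat) m) => ?; case: (ltnP m (c + x)) => ?; lia.
Qed.

Lemma ord_last_sum : \sum_(c <- enum 'I_m.+1) ord_last c = 1.
Proof.
rewrite big_enum /= (bigD1 ord_max) //= big1 ?addr0 => [|c cm].
  by rewrite /ord_last eqxx.
by rewrite /ord_last; move: cm; rewrite -val_eqE /= => /negPf->.
Qed.

Lemma size_enum_F2 : (size (enum 'I_m.+1))%:R = (~~ odd m)%:R :> 'F_2.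
Proof. by rewrite size_enum_ord F2_natr. Qed.

Section Even.
Hypothesis m_odd : odd m.

Lemma ord_parity_zmod : zmod_morphism ord_parity.
Proof.
have D : {morph ord_parity : x y / x + y}.
  move=> x y; rewrite /ord_parity val_ordD -natrD; apply: F2_natr_eq.
  by case: ltnP => // xy; rewrite oddB //= m_odd addbF.
by move=> x y; have := D (x - y) y; rewrite subrK => ->; F2.
Qed.

Definition ord_parityA : {additive 'I_m.+1 -> 'F_2} :=
  HB.pack ord_parity (GRing.isZmodMorphism.Build _ _ ord_parity ord_parity_zmod).

Lemma ord_parity_step : ord_parity ord_step = 1.
Proof.
by rewrite /ord_parity /= modn_small //; case: (m) m_odd.
Qed.

Definition ord_half : 'I_m.+1 := inZp (m.+1)./2.

Lemma val_ord_half : ord_half = (m.+1)./2 :> nat.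
Proof. by rewrite /= modn_small //; move: m_odd; lia. Qed.

Lemma ord_half2 : ord_half *+ 2 = 0.
Proof.
apply: ord_inj; rewrite mulr2n val_ordD val_ord_half -[RHS]/0%N; move: m_odd; case: ltnP; lia.
Qed.

Lemma ord_tors c : c *+ 2 = 0 -> c = 0 \/ c = ord_half.
Proof.
move=> /(congr1 (@nat_of_ord m.+1)); rewrite mulr2n val_ordD => e.
have [c0|c0] := posnP c; [left | right]; apply: ord_inj => //.
by rewrite val_ord_half; move: e m_odd (ltn_ord c); rewrite /=; case: ltnP; lia.
Qed.

Lemma ord_carry_half : ord_carry ord_half ord_half = 1.
Proof. by rewrite /ord_carry val_ord_half; move: m_odd; case: ltnP => //; lia. Qed.
End Even.

Lemma ord_tors_odd c : ~~ odd m -> c *+ 2 = 0 -> c = 0.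
Proof.
move=> m_even /(congr1 (@nat_of_ord m.+1)); rewrite mulr2n val_ordD /= => e.
by apply: val_inj; move: e m_even (ltn_ord c); rewrite /=; case: ltnP; lia.
Qed.
End CyclicGroups.

Section Integers.

Lemma int_step_ind (P : int -> Prop) : P 0 -> (forall c, P c <-> P (c + 1)) ->
  forall c, P c.
Proof.
move=> P0 PS; elim/int_ind => // n Pn; first by rewrite -addn1 PoszD -PS.
by rewrite PS -addn1 PoszD opprD addrNK.
Qed.

Lemma int_step_inv (f : int -> 'F_2) : (forall c, f (c + 1) = f c) ->
  forall c, f c = f 0.
Proof. by move=> fS; apply: int_step_ind => // c; rewrite fS. Qed.

Lemma int_antidiff (f : int -> 'F_2) :
  exists k, k 0 = 0 /\ forall c, k (c + 1) + k c = f c.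
Proof.
have SE (g : nat -> 'F_2) n :
    \sum_(0 <= i < n.+1) g i = \sum_(0 <= i < n) g i + g n by rewrite big_nat_recr.
pose k c := match c with
  | Posz n => \sum_(0 <= i < n) f i%:Z
  | Negz n => \sum_(0 <= i < n.+1) f (Negz i) end.
exists k; split; first by rewrite /= big_geq.
move=> [n|n]; first by rewrite -PoszD addn1 /= SE addrAC F2dbl add0r.
case: n => [|n]; first by rewrite /= big_geq // big_nat1 add0r.
have -> : Negz n.+1 + 1 = Negz n by rewrite !NegzE; lia.
by rewrite /= [X in _ + X]SE addrA F2dbl add0r.
Qed.

Definition int_parity (c : int) : 'F_2 := c%:~R.
Lemma int_parity_zmod : zmod_morphism int_parity.
Proof. by move=> x y; rewrite /int_parity intrB. Qed.
Definition int_parityA : {additive int -> 'F_2} :=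
  HB.pack int_parity (GRing.isZmodMorphism.Build _ _ int_parity int_parity_zmod).

Lemma int_tors (c : int) : c *+ 2 = 0 -> c = 0.
Proof. lia. Qed.
End Integers.

(** * Splitting a finitely generated abelian group into cyclic factors *)

Section GeneratedSubgroup.
Variable A : zmodType.
Implicit Types (S : A -> Prop) (s t : seq A) (a b x : A).

Definition subgroup S := S 0 /\ forall a b, S a -> S b -> S (a - b).

Definition gen_subgroup s a :=
  forall S, subgroup S -> (forall x, x \in s -> S x) -> S a.

Lemma gen_subgroupP s : subgroup (gen_subgroup s).
Proof.
split=> [S [] //|a b sa sb S subS sS].
by case: (subS) => _; apply; [apply: sa | apply: sb].
Qed.

Lemma subgroupN S a : subgroup S -> S a -> S (- a).
Proof. by case=> S0 SB Sa; rewrite -sub0r; apply: SB. Qed.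

Lemma subgroupD S a b : subgroup S -> S a -> S b -> S (a + b).
Proof. by move=> subS Sa Sb; rewrite -[b]opprK; apply: subS.2 => //; apply: subgroupN. Qed.

Lemma subgroupMz S a (d : int) : subgroup S -> S a -> S (a *~ d).
Proof.
move=> subS Sa; have Sn n : S (a *+ n).
  by elim: n => [|n IH]; [rewrite mulr0n; case: subS | rewrite mulrS; apply: subgroupD].
by case: d => n; [apply: Sn | rewrite NegzE mulrNz; apply: subgroupN (Sn _)].
Qed.

Lemma mem_gen_subgroup s x : x \in s -> gen_subgroup s x.
Proof. by move=> xs S _; apply. Qed.

Lemma gen_subgroup_sub s t a : (forall x, x \in s -> gen_subgroup t x) ->
  gen_subgroup s a -> gen_subgroup t a.
Proof. by move=> st; apply; first exact: gen_subgroupP. Qed.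

Lemma gen_subgroup_cons x s a :
  gen_subgroup (x :: s) a -> exists d : int, gen_subgroup s (a - x *~ d).
Proof.
have subs := gen_subgroupP s.
move=> H; apply: (H (fun a => exists d : int, gen_subgroup s (a - x *~ d))); first split.
- by exists 0; rewrite mulr0z subr0; case: subs.
- move=> b c [d bd] [e ce]; exists (d - e).
  by have := subs.2 _ _ bd ce; rewrite mulrzBr !opprD addrACA.
- move=> y; rewrite inE => /predU1P[->|ys].
    by exists 1; rewrite mulr1z subrr; case: subs.
  by exists 0; rewrite mulr0z subr0; apply: mem_gen_subgroup.
Qed.

Definition in_gen s : {pred A} := fun a => `[< gen_subgroup s a >].
Lemma in_gen_zmod s : zmod_closed (in_gen s).
Proof.
have [s0 sB] := gen_subgroupP s.
split=> [|a b /asboolP sa /asboolP sb]; apply/asboolP => //; exact: sB.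
Qed.
HB.instance Definition _ s := GRing.isZmodClosed.Build A (in_gen s) (in_gen_zmod s).

Record gen_sub s := GenSub { gen_sub_val : A; gen_subP : gen_sub_val \in in_gen s }.
HB.instance Definition _ s := [isSub for @gen_sub_val s].
HB.instance Definition _ s := [Choice of gen_sub s by <:].
HB.instance Definition _ s := [SubChoice_isSubZmodule of gen_sub s by <:].

(** The number of generators is preserved, which drives the induction on it. *)
Lemma gen_sub_generated s :
  exists t : seq (gen_sub s), size t = size s /\
    forall (w : gen_sub s) (S : gen_sub s -> Prop),
      S 0 -> (forall y z, S y -> S z -> S (y - z)) -> (forall z, z \in t -> S z) -> S w.
Proof.
have lift u : (forall x, x \in u -> x \in in_gen s) ->
    exists t : seq (gen_sub s), map val t = u.
  elim: u => [|x u IH] us; first by exists [::].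
  have [|t <-] := IH; first by move=> y yu; apply: us; rewrite inE yu orbT.
  have xs : x \in in_gen s by apply: us; rewrite mem_head.
  by exists (GenSub xs :: t).
have [x xs|t ts] := lift s; first by apply/asboolP; apply: mem_gen_subgroup.
exists t; split=> [|b S S0 SB St]; first by have := congr1 size ts; rewrite size_map.
suff [b' /val_inj <-] : exists2 b', val b' = val b & S b' by [].
have /asboolP H := gen_subP b; apply: (H (fun a => exists2 b', val b' = a & S b')).
  split=> [|_ _ [c <- Sc] [d <- Sd]]; first by exists 0.
  by exists (c - d); rewrite ?raddfB //; apply: SB.
move=> x xs; have := xs; rewrite -[X in x \in X]ts => /mapP[y yt ->].
by exists y => //; apply: St.
Qed.
End GeneratedSubgroup.

Inductive cyc_built : zmodType -> Prop :=
| CycTrivial (A : zmodType) : (forall a : A, a = 0) -> cyc_built A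
| CycInt (A : zmodType) : cyc_built A -> cyc_built (A * int)%type
| CycOrd (A : zmodType) m : cyc_built A -> cyc_built (A * 'I_m.+1)%type
| CycIso (A B : zmodType) (f : {additive A -> B}) (g : {additive B -> A}) :
    cancel f g -> cancel g f -> cyc_built A -> cyc_built B.

Lemma additive_bij (A B : zmodType) (f : {additive A -> B}) :
  (forall a, f a = 0 -> a = 0) -> (forall b, exists a, f a = b) ->
  exists g : {additive B -> A}, cancel f g /\ cancel g f.
Proof.
move=> f0 /boolp.choice[g fg].
have injf : injective f.
  by move=> a b fab; apply/eqP; rewrite -subr_eq0; apply/eqP/f0; rewrite raddfB fab subrr.
have gB : zmod_morphism g by move=> x y; apply: injf; rewrite raddfB !fg.
pose gA : {additive B -> A} := HB.pack g (GRing.isZmodMorphism.Build B A g gB).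
by exists gA; split=> // a; apply: injf; rewrite /= fg.
Qed.

Lemma gen_sub_split (A C : zmodType) (s : seq A) (mu : {additive C -> A}) :
  (forall a, exists c, gen_subgroup s (a - mu c)) ->
  (forall c, gen_subgroup s (mu c) -> c = 0) ->
  exists (f : {additive (gen_sub s * C)%type -> A}) (g : {additive A -> (gen_sub s * C)%type}),
    cancel f g /\ cancel g f.
Proof.
move=> mu_gen mu_inj; pose f0 (z : (gen_sub s * C)%type) : A := val z.1 + mu z.2.
have f0B : zmod_morphism f0.
  by move=> y z; rewrite /f0 raddfB raddfB opprD addrACA.
pose f : {additive (gen_sub s * C)%type -> A} :=
  HB.pack f0 (GRing.isZmodMorphism.Build _ _ f0 f0B).
have [|a|g fg] := @additive_bij _ _ f; last by exists f, g.
  case=> b c; rewrite /= /f0 /= addrC => /eqP; rewrite addr_eq0 => /eqP e.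
  have c0 : c = 0.
    apply: mu_inj; rewrite e; apply: subgroupN (gen_subgroupP s) _.
    by apply/asboolP; apply: gen_subP.
  move: e; rewrite c0 raddf0 => /esym/eqP; rewrite oppr_eq0 => /eqP b0.
  by congr (_, _); apply: val_inj.
have [c /asboolP ac] := mu_gen a.
by exists (GenSub ac, c); rewrite /= /f0 /= subrK.
Qed.

Section SplitCyclic.
Variables (A : zmodType) (x : A).

Definition mulz (d : int) : A := x *~ d.
Lemma mulz_zmod : zmod_morphism mulz.
Proof. by move=> d e; rewrite /mulz mulrzBr. Qed.
HB.instance Definition _ := GRing.isZmodMorphism.Build int A mulz mulz_zmod.

Definition mul_ord m (c : 'I_m.+1) : A := x *+ c.
Lemma mul_ord_zmod m : x *+ m.+1 = 0 -> zmod_morphism (@mul_ord m).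
Proof.
move=> xm.
have D : {morph (@mul_ord m) : c d / c + d}.
  move=> c d; rewrite /mul_ord -mulrnDr val_ordD; case: ltnP => // cd.
  by rewrite -[in RHS](subnK cd) mulrnDr xm addr0.
by move=> c d; have := D (c - d) d; rewrite subrK => ->; rewrite addrK.
Qed.
End SplitCyclic.

(* A generating tuple x :: s and a relation N x in <s> with N > 0 minimal among
   all such tuples: then N divides the coefficients of the relation, and x can
   be corrected by elements of s to an element of order N. *)
Lemma minimal_relation (A : zmodType) (n N : nat) :
  (0 < N)%N ->
  (exists x (s : seq A), [/\ size s = n, forall a, gen_subgroup (x :: s) a
                 & gen_subgroup s (x *+ N)]) ->
  (forall k x (s : seq A), (0 < k < N)%N -> size s = n ->
     (forall a, gen_subgroup (x :: s) a) -> ~ gen_subgroup s (x *+ k)) ->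
  exists x (s : seq A), [/\ size s = n, forall a, gen_subgroup (x :: s) a,
    x *+ N = 0 & forall d : int, gen_subgroup s (x *~ d) -> (N %| d)%Z].
Proof.
move=> N0 [x [s [sn gens xN]]] Nmin.
have red (r : int) x' (s' : seq A) : 0 <= r < N%:Z -> size s' = n ->
    (forall a, gen_subgroup (x' :: s') a) ->
    gen_subgroup s' (x' *~ r) -> r = 0.
  move=> rN s'n gen' xr; case: r => // -[//|r] in rN xr *.
  by case: (Nmin r.+1 x' s').
suff [x' [gen' x'N]] : exists x', (forall a, gen_subgroup (x' :: s) a) /\ x' *+ N = 0.
  exists x', s; split=> // d xd; apply/dvdz_mod0P.
  have Nz : N%:Z != 0 by rewrite eqz_nat -lt0n.
  apply: (red _ x' s) => //; first by rewrite modz_ge0 //= ltz_pmod // ltz_nat.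
  have -> : x' *~ (d %% N)%Z = x' *~ d.
    rewrite [in RHS](divz_eq d N) [RHS]mulrzDr [_ * N%:Z]mulrC mulrzA.
    by rewrite -[x' *~ N]pmulrn x'N mul0rz add0r.
  by [].
suff H t u y : perm_eq s (u ++ t) -> (forall a, gen_subgroup (y :: s) a) ->
    gen_subgroup t (y *+ N) ->
    exists x', (forall a, gen_subgroup (x' :: s) a) /\ x' *+ N = 0.
  exact: (H s [::] x).
elim: t u y => [|z t IH] u y st gen yN.
  exists y; split=> //; apply: (yN (fun a => a = 0)) => //.
  by split=> // a b -> ->; rewrite subrr.
have [c zc] := gen_subgroup_cons yN.
pose y' := y - z *~ (c %/ N)%Z.
have zs : z \in s by rewrite (perm_mem st) mem_cat mem_head orbT.
have gen' a : gen_subgroup (y' :: s) a.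
  apply: gen_subgroup_sub (gen a) => w; rewrite inE => /predU1P[->|ws]; last first.
    by apply: mem_gen_subgroup; rewrite inE ws orbT.
  rewrite -[y](subrK (z *~ (c %/ N)%Z)).
  have sub := gen_subgroupP (y' :: s).
  apply: (subgroupD sub); first by apply: mem_gen_subgroup; apply: mem_head.
  by apply: (subgroupMz _ sub); apply: mem_gen_subgroup; rewrite inE zs orbT.
have y'N : y' *+ N = (y *+ N - z *~ c) + z *~ (c %% N)%Z.
  rewrite [X in _ - _ *~ X + _](divz_eq c N) mulrzDr opprD addrA addrNK /y' mulrnBl.
  by rewrite mulrzA -pmulrn.
have c0 : (c %% N)%Z = 0.
  apply: (red _ z (y' :: (u ++ t))).
  - by rewrite modz_ge0 ?eqz_nat -?lt0n //= ltz_pmod // ltz_nat.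
  - by rewrite -sn (perm_size st) /= !size_cat /= addnS.
  - move=> a; apply: gen_subgroup_sub (gen' a) => w.
    rewrite inE (perm_mem st) mem_cat inE => wmem; apply: mem_gen_subgroup.
    by rewrite !inE mem_cat; case/or4P: wmem => ->; rewrite ?orbT.
  have -> : z *~ (c %% N)%Z = y' *+ N - (y *+ N - z *~ c) by rewrite y'N addrC addKr.
  have sub := gen_subgroupP (y' :: u ++ t).
  apply: sub.2.
    by rewrite pmulrn; apply: (subgroupMz _ sub); apply: mem_gen_subgroup; apply: mem_head.
  apply: gen_subgroup_sub zc => w wt.
  by apply: mem_gen_subgroup; rewrite inE mem_cat wt !orbT.
apply: (IH (rcons u z) y') => //; first by rewrite cat_rcons.
by rewrite y'N c0 mulr0z addr0.
Qed.

(** Induction on the number of generators. If the first entry of some generating tuple is torsion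
    modulo the others, a minimal relation splits off a finite cyclic group; otherwise the first
    entry of [s] is free modulo the rest and splits off Z. *)
Lemma generated_cyc_built n (A : zmodType) (s : seq A) :
  size s = n -> (forall a, gen_subgroup s a) -> cyc_built A.
Proof.
elim: n A s => [|n IH] A s.
  case: s => // _ gen; apply: CycTrivial => a; apply: (gen a (fun a => a = 0)) => //.
  by split=> // b c -> ->; rewrite subrr.
have IHs (t : seq A) : size t = n -> cyc_built (gen_sub t : zmodType).
  have [u [ut gen]] := @gen_sub_generated A t.
  by move=> tn; apply: (IH _ u) => [|b S [S0 SB] uS]; [rewrite ut | apply: gen].
(* The multiple is [N.+1]: this excludes the trivial relation and presents the order as that of
   ['I_N.+1]. *)
pose rel N := `[< exists x (t : seq A), [/\ size t = n,
  forall a, gen_subgroup (x :: t) a & gen_subgroup t (x *+ N.+1)] >].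
move=> sn gen; have [exN|noN] := pselect (exists N, rel N).
  have [N /asboolP Nrel Nmin] := ex_minnP exN.
  have [//|k x t kN tn gent xk|x [t [tn gent xN Ndiv]]] := minimal_relation _ Nrel.
    have := Nmin k.-1; rewrite /rel prednK; last by case/andP: kN.
    by move=> /(_ (asboolT _)) H; have := H (ex_intro _ x (ex_intro _ t (And3 tn gent xk))); lia.
  pose mu : {additive 'I_N.+1 -> A} :=
    HB.pack (@mul_ord A x N) (GRing.isZmodMorphism.Build _ _ _ (mul_ord_zmod xN)).
  have [a|c /= cx|f [g [fg gf]]] := @gen_sub_split A _ t mu.
  - have [d ad] := gen_subgroup_cons (gent a).
    exists (inZp `|(d %% N.+1)%Z|); rewrite /= /mul_ord.
    have -> // : x *+ (inZp `|(d %% N.+1)%Z| : 'I_N.+1) = x *~ d.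
    have dN : (0 <= (d %% N.+1)%Z < N.+1)%R by rewrite modz_ge0 //= ltz_pmod.
    rewrite /= modn_small; last by lia.
    rewrite pmulrn gez0_abs; last by case/andP: dN.
    rewrite [in RHS](divz_eq d N.+1) [RHS]mulrzDr [_ * N.+1%:Z]mulrC mulrzA.
    by rewrite -[x *~ N.+1]pmulrn xN mul0rz add0r.
  - have := Ndiv c; rewrite -pmulrn => /(_ cx); rewrite dvdzE /= => Nc.
    apply: ord_inj; case: (posnP c) => // c0.
    by have := dvdn_leq c0 Nc; rewrite leqNgt ltn_ord.
  by apply: CycIso fg gf _; apply: CycOrd; apply: IHs.
case: s sn gen => // x s [sn] gen.
have [a|d /= dx|f [g [fg gf]]] := @gen_sub_split A _ s (mulz x).
- exact: gen_subgroup_cons (gen a).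
- have [//|d0] := eqVneq d 0; case: noN; exists `|d|.-1%N; apply/asboolP.
  exists x, s; split=> //; rewrite prednK ?absz_gt0 //.
  have sub := gen_subgroupP s.
  have [d1|d1] := lerP 0 d; first by rewrite pmulrn gez0_abs.
  by rewrite pmulrn ltz0_abs // mulrNz; apply: (subgroupN sub).
by apply: CycIso fg gf _; apply: CycInt; apply: IHs.
Qed.

Lemma fin_gen_cyc_built (A : zmodType) : fin_gen A -> cyc_built A.
Proof.
move=> [n [g gen]]; apply: (@generated_cyc_built _ _ [seq g i | i <- enum 'I_n]) => // a.
have [c ->] := gen a; have sub := gen_subgroupP [seq g i | i <- enum 'I_n].
elim/big_ind: _ => [|x y|i _]; [by case: sub | by move=> *; apply: (subgroupD sub) |].
by apply: (subgroupMz _ sub); apply: mem_gen_subgroup; apply: map_f; rewrite mem_enum.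
Qed.

(** * Abelian extensions by the field with two elements *)

Section AbelianCocycles.

(* The factor sets of abelian extensions of A by F_2. *)
Definition abelian_cocycle (A : zmodType) (c : A -> A -> 'F_2) :=
  [/\ forall x y, c x y = c y x, c 0 0 = 0 &
      forall x y z, c y z + c (x + y) z + c x (y + z) + c x y = 0].

Definition split_cocycle (A : zmodType) (c : A -> A -> 'F_2) :=
  exists k : A -> 'F_2, forall x y, c x y = k x + k y + k (x + y).

(* Injectivity of Ext(A, F_2) -> Hom(2A, F_2). *)
Definition ext_inj (A : zmodType) := forall c : A -> A -> 'F_2,
  abelian_cocycle c -> (forall a, a *+ 2 = 0 -> c a a = 0) -> split_cocycle c.

Definition ext_surj (A : zmodType) := forall w : dual (tors2 A : lmodType 'F_2),
  exists c : A -> A -> 'F_2, abelian_cocycle c /\ forall a : tors2 A, c (val a) (val a) = w a.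

Lemma abelian_cocycle0 (A : zmodType) (c : A -> A -> 'F_2) x : abelian_cocycle c -> c x 0 = 0.
Proof.
case=> cC c0 cc; have := cc x 0 0; rewrite !addr0 c0 => e.
by rewrite -e; F2.
Qed.

Lemma abelian_cocycleD (A : zmodType) (c d : A -> A -> 'F_2) :
  abelian_cocycle c -> abelian_cocycle d ->
  abelian_cocycle (fun x y => c x y + d x y).
Proof.
move=> [cC c0 cc] [dC d0 dd]; split=> [x y||x y z].
- by rewrite cC dC.
- by rewrite c0 d0 addr0.
- by rewrite -[RHS](addr0 0) -{1}(cc x y z) -(dd x y z); F2.
Qed.

Lemma abelian_cocycle_comp (A B : zmodType) (f : {additive A -> B}) c :
  abelian_cocycle c -> abelian_cocycle (fun x y => c (f x) (f y)).
Proof.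
by move=> [cC c0 cc]; split=> [x y||x y z]; rewrite ?raddf0 ?raddfD.
Qed.

Lemma abelian_cocycle_split (A : zmodType) (k : A -> 'F_2) : k 0 = 0 ->
  abelian_cocycle (fun x y => k x + k y + k (x + y)).
Proof.
move=> k0; split=> [x y||x y z].
- by rewrite [x + y]addrC; F2.
- by rewrite addr0 k0 !addr0.
- by rewrite [x + (y + z)]addrA; F2.
Qed.

Lemma split_at0 (A : zmodType) (c : A -> A -> 'F_2) : abelian_cocycle c -> split_cocycle c ->
  exists k : A -> 'F_2, k 0 = 0 /\ forall x y, c x y = k x + k y + k (x + y).
Proof.
move=> [_ c0 _] [k kc]; exists k; split=> //.
by have := kc 0 0; rewrite c0 addr0 => ->; F2.
Qed.

(** Two coboundaries are subtracted: [k1] makes the cocycle vanish on each factor, [k2] on mixed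
    pairs as well. The cocycle identity then spreads the zeros to all pairs. *)
Lemma ext_inj_prod (A C : zmodType) :
  ext_inj A -> ext_inj C -> ext_inj (A * C)%type.
Proof.
move=> extA extC c cc ctors.
pose G : zmodType := (A * C)%type.
pose iA (a : A) : G := (a, 0); pose iC (x : C) : G := (0, x).
have iAB : zmod_morphism iA by move=> x y; rewrite /iA -[RHS]/(_, _) subr0.
have iCB : zmod_morphism iC by move=> x y; rewrite /iC -[RHS]/(_, _) subr0.
pose jA : {additive A -> G} := HB.pack iA (GRing.isZmodMorphism.Build _ _ iA iAB).
pose jC : {additive C -> G} := HB.pack iC (GRing.isZmodMorphism.Build _ _ iC iCB).
have cA := abelian_cocycle_comp jA cc; have cC := abelian_cocycle_comp jC cc.
have [|kA [kA0 kAE]] := split_at0 cA.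
  by apply: extA => // a a2; apply: ctors; rewrite -raddfMn a2 raddf0.
have [|kC [kC0 kCE]] := split_at0 cC.
  by apply: extC => // a a2; apply: ctors; rewrite -raddfMn a2 raddf0.
have GE (g : G) : g = jA g.1 + jC g.2.
  by case: g => a x; rewrite -[RHS]/(a + 0, 0 + x) addr0 add0r.
pose k1 (g : G) := kA g.1 + kC g.2.
have k10 : k1 0 = 0 by rewrite /k1 kA0 kC0 addr0.
have cc1 := abelian_cocycleD cc (abelian_cocycle_split k10).
set c1 := fun x y => _ in cc1.
have c1A a b : c1 (jA a) (jA b) = 0.
  by rewrite /c1 kAE /k1 /= !addr0 kC0; F2.
have c1C a b : c1 (jC a) (jC b) = 0.
  by rewrite /c1 kCE /k1 /= !addr0 kA0; F2.
pose k2 (g : G) := c1 (jA g.1) (jC g.2).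
have k2A a : k2 (jA a) = 0 by rewrite /k2 -[jC _]/(jC 0) (raddf0 jC) (abelian_cocycle0 _ cc1).
have k2C a : k2 (jC a) = 0.
  by case: (cc1) => sym _ _; rewrite /k2 -[jA _]/(jA 0) (raddf0 jA) sym (abelian_cocycle0 _ cc1).
have k20 : k2 0 = 0 by rewrite -(raddf0 jA) k2A.
have cc2 := abelian_cocycleD cc1 (abelian_cocycle_split k20).
set c2 := fun x y => _ in cc2.
have c2A a b : c2 (jA a) (jA b) = 0.
  by rewrite /c2 c1A -raddfD !k2A !addr0.
have c2C a b : c2 (jC a) (jC b) = 0.
  by rewrite /c2 c1C -raddfD !k2C !addr0.
have c2AC a x : c2 (jA a) (jC x) = 0.
  rewrite /c2 k2A k2C !add0r; have -> : k2 (jA a + jC x) = c1 (jA a) (jC x).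
    by rewrite -[jA a + jC x]/(jA (a, x).1 + jC (a, x).2) -GE.
  by F2.
case: (cc2) => sym _ coc2.
have c2Cg x g : c2 (jC x) g = 0.
  rewrite (GE g) addrC; have := coc2 (jC x) (jC g.2) (jA g.1).
  by rewrite sym c2AC c2C -raddfD sym c2AC !add0r addr0.
have c2Ag a g : c2 (jA a) g = 0.
  rewrite (GE g); have := coc2 (jA a) (jA g.1) (jC g.2).
  by rewrite c2AC c2A -raddfD c2AC !add0r addr0.
have c20 g h : c2 g h = 0.
  rewrite (GE g); have := coc2 (jA g.1) (jC g.2) h.
  by rewrite c2Cg c2Ag c2AC !add0r !addr0.
exists (fun g => k1 g + k2 g) => x y.
by have := c20 x y; rewrite /c2 /c1 => e; rewrite -[LHS]addr0 -e; F2.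
Qed.

(* Subtracting the coboundary of k makes c vanish on all pairs (x, t), hence
   everywhere: t generates C by the first hypothesis. *)
Lemma cyclic_split (C : zmodType) (t : C) (c : C -> C -> 'F_2) (k : C -> 'F_2) :
  (forall f : C -> 'F_2, (forall x, f (x + t) = f x) -> forall x, f x = f 0) ->
  abelian_cocycle c -> k 0 = 0 ->
  (forall x, k (x + t) + k x = c x t + k t) -> split_cocycle c.
Proof.
move=> t_inv cc k0 kt; exists k => x y.
have cc1 := abelian_cocycleD cc (abelian_cocycle_split k0).
set d := fun x y => _ in cc1; case: (cc1) => dC _ dcoc.
have dt z : d z t = 0.
  rewrite /d; have := kt z => e.
  by rewrite -[c z t](addrK (k t)) -e; F2.
have : d x y = d x 0.
  apply: (t_inv (d x)) => z; have := dcoc x z t.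
  by rewrite !dt !add0r => /eqP; rewrite addr_eq0 F2opp => /eqP.
by rewrite (abelian_cocycle0 _ cc1) /d => e; rewrite -[LHS]addr0 -e; F2.
Qed.

Lemma ext_inj_int : ext_inj int.
Proof.
move=> c cc _; have [k [k0 kE]] := int_antidiff (c^~ 1).
apply: (cyclic_split int_step_inv cc k0) => x.
have := kE 0; case: (cc) => cC _ _; rewrite add0r k0 cC (abelian_cocycle0 _ cc) addr0 => ->.
by rewrite kE addr0.
Qed.

(** The sum of the [c x t] is the (m + 1)-st multiple of a lift of [t] in the extension, and [l] is
    the choice of another lift. In odd order [l] absorbs the sum. In even order the pairs [x],
    [x + h], with [h] of order two, telescope the sum to [c h h], which is 0 by hypothesis. *)
Lemma ext_inj_ord m : ext_inj ('I_m.+1).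
Proof.
move=> c cc ctors; case: (cc) => cC c0 coc_c; pose t := ord_step m.
have [l cl] : exists l, \sum_(x <- enum 'I_m.+1) (c x t + l) = 0.
  have [m_odd|m_even] := boolP (odd m); last first.
    exists (\sum_(x <- enum 'I_m.+1) c x t).
    by rewrite big_split /= sum_const size_enum_F2 m_even mul1r F2dbl.
  exists 0; pose h := ord_half m.
  have e x : c (x + h) t + c x t = c h x + c h (x + t).
    have := coc_c h x t; rewrite [h + x]addrC => e.
    by rewrite -[LHS]addr0 -e; F2.
  have tel n : \sum_(0 <= i < n) (c h (inZp i) + c h (inZp i + t)) = c h (inZp n).
    elim: n => [|n IH]; first by rewrite big_geq // inZp_0 (abelian_cocycle0 _ cc).
    by rewrite big_nat_recr // IH inZpS /=; F2.
  have mE : m.+1 = (val h + val h)%N.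
    by rewrite -[val h]/(nat_of_ord h) val_ord_half //; move: m_odd; lia.
  rewrite big_enum /=.
  transitivity (\sum_(0 <= i < m.+1) c (inZp i) t).
    by rewrite big_mkord; apply: eq_bigr => i _; rewrite valZpK addr0.
  have half (F : nat -> 'F_2) n :
      \sum_(0 <= i < n + n) F i = \sum_(0 <= i < n) (F i + F (i + n)%N).
    rewrite (big_cat_nat (n := n)) ?leq_addr //= big_split /=; congr (_ + _).
    by rewrite -{1}[n]add0n big_addn addnK.
  rewrite mE half -[RHS](ctors h (ord_half2 m_odd)) -[X in _ = c h X]valZpK -tel.
  apply: eq_bigr => i _; rewrite -e addrC; congr (c _ t + _).
  by apply: val_inj; rewrite /= modnDml.
have [k [k0 kE]] := ord_antidiff cl.
apply: (cyclic_split (@ord_step_inv m) cc k0) => x; rewrite kE.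
have := kE 0; rewrite add0r k0 cC (abelian_cocycle0 _ cc) add0r addr0 => ->.
by [].
Qed.

Lemma tors2_add0 (A : zmodType) (a : tors2 A) : (val a) *+ 2 = 0.
Proof. by apply/eqP; exact: (tors2_valP a). Qed.

Lemma dualD (V : lmodType 'F_2) (w : dual V) x y : w (x + y) = w x + w y.
Proof. by have /asboolP lw := dual_valP w; have := lw 1 x y; rewrite !scale1r. Qed.

Lemma dual0 (V : lmodType 'F_2) (w : dual V) : w 0 = 0.
Proof. by have := dualD w 0 0; rewrite addr0 F2dbl. Qed.

Lemma abelian_cocycle_zero (A : zmodType) : abelian_cocycle (fun _ _ : A => 0).
Proof. by split=> *; rewrite ?addr0. Qed.

Lemma ext_surj_tors0 (A : zmodType) : (forall a : A, a *+ 2 = 0 -> a = 0) -> ext_surj A.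
Proof.
move=> A2 w; exists (fun _ _ => 0); split=> [|a]; first exact: abelian_cocycle_zero.
by have -> : a = 0; [apply/val_inj/A2/tors2_add0 | rewrite dual0].
Qed.

Lemma ord_carry_abelian m : abelian_cocycle (@ord_carry m).
Proof. split; [exact: ord_carryC | exact: ord_carry00 | exact: ord_carry_cocycle]. Qed.

Lemma ext_surj_ord m : ext_surj 'I_m.+1.
Proof.
have [m_odd|m_even] := boolP (odd m); last first.
  by apply: ext_surj_tors0 => a; apply: ord_tors_odd.
move=> w; have h2 : ord_half m \in two_tors (A := 'I_m.+1) by apply/eqP/ord_half2.
exists (fun x y => w (Tors2 h2) * ord_carry x y).
have [cC c0 cc] := ord_carry_abelian m.
split; first split=> [x y||x y z].
- by rewrite cC.
- by rewrite c0 mulr0.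
- by rewrite -!mulrDr cc mulr0.
move=> a; case: (ord_tors m_odd (tors2_add0 a)) => e; rewrite e.
  by have -> : a = 0; [apply: val_inj | rewrite dual0 ord_carry00 mulr0].
have -> : a = Tors2 h2 by apply: val_inj.
by rewrite ord_carry_half // mulr1.
Qed.

Definition inr0 (A C : zmodType) (x : C) : (A * C)%type := (0, x).
Lemma inr0_zmod (A C : zmodType) : zmod_morphism (@inr0 A C).
Proof. by move=> x y; rewrite /inr0 -[RHS]/(_, _) subr0. Qed.
HB.instance Definition _ (A C : zmodType) :=
  GRing.isZmodMorphism.Build C (A * C)%type (@inr0 A C) (@inr0_zmod A C).

Lemma ext_surj_prod (A C : zmodType) :
  ext_surj A -> ext_surj C -> ext_surj (A * C)%type.
Proof.
move=> extA extC w.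
pose jA : {additive A -> (A * C)%type} := @inl0 A C.
pose jC : {additive C -> (A * C)%type} := @inr0 A C.
have [c [cc cw]] := extA (dual_map (tors2_map jA) w).
have [d [dc dw]] := extC (dual_map (tors2_map jC) w).
exists (fun x y => c x.1 y.1 + d x.2 y.2); split.
  by apply: abelian_cocycleD; [exact: (abelian_cocycle_comp fst cc)
    | exact: (abelian_cocycle_comp snd dc)].
move=> a; have := cw (tors2_map fst a); have := dw (tors2_map snd a).
rewrite /= => -> ->; rewrite -dualD; congr (dual_val w _); apply: val_inj.
by rewrite /=; case: (val a) => x y; rewrite -[LHS]/(x + 0, 0 + y) addr0 add0r.
Qed.

Lemma cyc_ext_surj (A : zmodType) : cyc_built A -> ext_surj A.
Proof.
elim=> {A} [A A0|A _ IH|A m _ IH|A B f g fg gf _ IH].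
- by apply: ext_surj_tors0.
- apply: ext_surj_prod => //; exact/ext_surj_tors0/int_tors.
- by apply: ext_surj_prod => //; exact: ext_surj_ord.
- move=> w; have [c [cc cw]] := IH (dual_map (tors2_map f) w).
  exists (fun x y => c (g x) (g y)); split; first exact: abelian_cocycle_comp.
  move=> b; have := cw (tors2_map g b); rewrite /= => ->; congr (dual_val w _).
  by apply: val_inj; rewrite /= gf.
Qed.

Lemma cyc_ext_inj (A : zmodType) : cyc_built A -> ext_inj A.
Proof.
elim=> {A} [A A0|A _ IH|A m _ IH|A B f g fg gf _ IH].
- move=> c [_ c0 _] _; exists (fun=> 0) => x y.
  by rewrite (A0 x) (A0 y) c0 !addr0.
- by apply: ext_inj_prod => //; exact: ext_inj_int.
- by apply: ext_inj_prod => //; exact: ext_inj_ord.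
- move=> c cc ctors; have [|a a2|k kE] := IH (fun x y => c (f x) (f y)).
  + exact: abelian_cocycle_comp.
  + by apply: ctors; rewrite -raddfMn a2 raddf0.
  + by exists (k \o g) => x y; rewrite /= raddfD -kE !gf.
Qed.
End AbelianCocycles.

(** * Cocycles and their cup products *)

Section ListCochains.
Variable A : zmodType.
Implicit Types (F : seq A -> 'F_2) (s : seq A).

Fixpoint seq_face i s : seq A :=
  match i, s with
  | _, [::] => [::]
  | 0, _ :: s' => s'
  | i'.+1, g :: s' =>
    if s' is h :: s'' then (if i' is 0 then (g + h) :: s'' else g :: seq_face i' s')
    else [::]
  end.

Lemma size_seq_face i s : size (seq_face i s) = (size s).-1.
Proof.
elim: s i => [|g [|h s] IH] [|[|i]] //.
by rewrite -[LHS]/(size (seq_face i.+1 (h :: s))).+1 IH.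
Qed.

Lemma nth_seq_face i s j : (i <= size s)%N -> (j.+1 < size s)%N ->
  nth 0 (seq_face i s) j =
  if (j.+1 < i)%N then nth 0 s j
  else if j.+1 == i then nth 0 s j + nth 0 s j.+1 else nth 0 s j.+1.
Proof.
elim: s i j => [|g [|h s] IH] [|[|i]] [|j] //= il jl.
by rewrite -/(seq_face i.+1 (h :: s)) IH.
Qed.

Lemma inner_facesE F g s :
  inner_faces F g s = \sum_(i < (size s).+1) F (seq_face i.+1 (g :: s)).
Proof.
elim: s F g => [|h s IH] F g /=; first by rewrite big_ord1.
by rewrite IH [RHS]big_ord_recl; congr (_ + _); apply: eq_bigr => i _.
Qed.

Lemma deltaE F s : (0 < size s)%N -> delta F s = \sum_(i < (size s).+1) F (seq_face i s).
Proof. by case: s => //= g s _; rewrite big_ord_recl inner_facesE. Qed.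

Definition of_list n F : cochain 'F_2 n A := fun a => F [seq a i | i <- enum 'I_n].
Arguments of_list n F _ : clear implicits.

Definition to_list n (f : cochain 'F_2 n A) : seq A -> 'F_2 :=
  fun s => if size s == n then f (fun i => nth 0 s i) else 0.

Lemma to_listK n f : of_list n (to_list f) = f.
Proof.
apply/funext => a; rewrite /of_list /to_list size_map size_enum_ord eqxx.
congr f; apply/funext => i.
by rewrite (nth_map i) ?size_enum_ord // nth_ord_enum.
Qed.

Lemma face_list n (i : 'I_n.+2) (a : 'I_n.+1 -> A) :
  [seq face i a j | j <- enum 'I_n] = seq_face i [seq a j | j <- enum 'I_n.+1].
Proof.
have sz m (b : 'I_m -> A) : size [seq b j | j <- enum 'I_m] = m.
  by rewrite size_map size_enum_ord.
have nthE m (b : 'I_m -> A) (j : 'I_m) : nth 0 [seq b j | j <- enum 'I_m] j = b j.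
  by rewrite (nth_map j) ?size_enum_ord // nth_ord_enum.
apply: (@eq_from_nth _ 0) => [|j]; first by rewrite size_seq_face !sz.
rewrite sz => jn; rewrite -[j in LHS]/(val (Ordinal jn)) nthE.
rewrite nth_seq_face ?sz //; last by rewrite -ltnS.
rewrite /face /= -(nthE _ a (widen_ord _ _)) -(nthE _ a (fintype.lift _ _)).
by rewrite /= /bump leq0n add1n.
Qed.

Lemma cobound_of_list n F : cobound (of_list n F) = of_list n.+1 (delta F).
Proof.
apply/funext => a; rewrite /cobound /of_list.
have sz : size [seq a i | i <- enum 'I_n.+1] = n.+1 by rewrite size_map size_enum_ord.
rewrite deltaE sz //.
apply: eq_bigr => i _; rewrite -face_list -[RHS]mul1r; congr (_ * _).
by rewrite (F2opp 1) expr1n.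
Qed.

Definition homogeneous (n : nat) F := forall s, size s != n -> F s = 0.

Lemma eq_of_list n F H : of_list n F = of_list n H <-> forall s, size s = n -> F s = H s.
Proof.
split=> [e s sn|e]; last first.
  by apply/funext => a; apply: e; rewrite size_map size_enum_ord.
have := congr1 (fun f => f (fun i : 'I_n => nth 0 s i)) e; rewrite /of_list.
suff -> : [seq nth 0 s (i : 'I_n) | i <- enum 'I_n] = s by [].
by rewrite -[RHS](mkseq_nth 0) sn /mkseq -val_enum_ord -map_comp.
Qed.

Lemma inner_faces_eq0 n F g s : homogeneous n F -> size s != n -> inner_faces F g s = 0.
Proof.
move=> Fn sn; rewrite (@eq_inner_faces _ _ (fun=> 0)) ?inner_faces0 // => l sl.
by rewrite Fn // sl.
Qed.

Lemma delta_homogeneous n F : homogeneous n F -> homogeneous n.+1 (delta F).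
Proof.
by move=> Fn [|g s] //= sn; rewrite Fn // (inner_faces_eq0 _ Fn) // addr0.
Qed.

Lemma eq_delta_size n F H s : (forall l, size l = n -> F l = H l) -> size s = n.+1 ->
  delta F s = delta H s.
Proof.
move=> FH; case: s => //= g s [sn]; rewrite FH //; congr (_ + _).
by apply: eq_inner_faces => l ls; rewrite FH // ls.
Qed.

Lemma lcup_homogeneous p P n F : homogeneous n F -> homogeneous (p + n) (lcup p P F).
Proof.
by elim: p P => [|p IH] P Fn [|g s] //= sn; rewrite ?IH // Fn ?mulr0.
Qed.

(** The default 0 makes [cls] total; it is meaningful when the degree [n] part of [F] is a
    cocycle. *)
Definition cls n F : coho 'F_2 A n := coho_class (insubd 0 (of_list n F)).

Lemma coc_is_cocycle n F : coc F -> of_list n F \in is_cocycle (A := A) (n := n).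
Proof.
move=> cF; rewrite unfold_in /is_cocycle cobound_of_list; apply/eqP/funext => a.
exact: cF.
Qed.

Lemma val_cls n F : coc F -> val (insubd (0 : cocycle 'F_2 A n) (of_list n F)) = of_list n F.
Proof. by move=> cF; rewrite val_insubd coc_is_cocycle. Qed.

Lemma coc_lin a F H : coc F -> coc H -> coc (fun s => a * F s + H s).
Proof. by move=> cF cH s; rewrite deltaD deltaZ cF cH mulr0 addr0. Qed.

Lemma cocD F H : coc F -> coc H -> coc (fun s => F s + H s).
Proof. by move=> cF cH s; rewrite deltaD cF cH addr0. Qed.

Lemma coc0 : coc (fun _ : seq A => 0).
Proof. by move=> s; rewrite delta0. Qed.

Lemma cob_coc F : cob F -> coc F.
Proof. by move=> [k Fk] s; rewrite (eq_delta _ Fk) delta_delta. Qed.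

Lemma cls_lin n a F H : coc F -> coc H ->
  cls n (fun s => a * F s + H s) = a *: cls n F + cls n H.
Proof.
move=> cF cH; rewrite /cls -linearP; congr coho_class; apply: val_inj.
rewrite val_cls; last exact: coc_lin.
rewrite [RHS]linearP; transitivity (a *: of_list n F + of_list n H) => //.
by congr (_ *: _ + _); exact/esym/val_cls.
Qed.

Lemma cls_eq n F H : (forall s, size s = n -> F s = H s) -> cls n F = cls n H.
Proof. by move=> FH; rewrite /cls; congr (coho_class (insubd _ _)); apply/eq_of_list. Qed.

(** [coho] divides by the span of the coboundaries, and these are closed under linear combinations.
    Degree 0, where 0 is the only coboundary, is treated apart. *)
Lemma coho_class_eq0 n (f : cocycle 'F_2 A n) :
  coho_class f = 0 <-> is_coboundary (cocycle_val f).
Proof.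
split=> [|bf]; last exact: lpi_rel.
rewrite -(linear0 (coho_class (n := n))) => /lpi_eq; rewrite subr0 => /span_ofP.
case=> m [c [g [gb ->]]]; elim/big_ind: _ => [|x y|i _].
- by case: n {f} g gb => // n *; exists 0; rewrite linear0.
- case: n {f} g gb x y => [|n] g gb x y /=; first by move=> -> ->; rewrite addr0.
  by move=> [k ->] [l ->]; exists (k + l); rewrite linearD.
- have := gb i; case: n {f} g gb => [|n] g gb /=; first by move=> ->; rewrite scaler0.
  by move=> [k ->]; exists (c i *: k); rewrite linearZ.
Qed.

Lemma cob_cls n F : cob F -> cls n F = 0.
Proof.
move=> bF; apply/coho_class_eq0; rewrite -[cocycle_val _]/(val _) val_cls; last exact: cob_coc.
case: bF => k Fk; case: n => [|n] /=; last first.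
  by exists (of_list n k); rewrite cobound_of_list; apply/eq_of_list.
by apply/(@eq_of_list 0 _ (fun=> 0)) => -[] // _; rewrite Fk.
Qed.

(** Homogeneity turns the vanishing of a class, a statement on lists of length [n], into one on all
    lists. *)
Lemma cls_eq0 n F : coc F -> homogeneous n F -> cls n F = 0 -> cob F.
Proof.
move=> cF Fn /coho_class_eq0; rewrite -[cocycle_val _]/(val _) val_cls //.
case: n Fn => [|n] Fn /=.
  move=> /(@eq_of_list 0 _ (fun=> 0)) e; exists (fun=> 0) => s; rewrite delta0.
  by have [/e|/Fn] := eqVneq (size s) 0%N.
move=> [g]; rewrite -[g]to_listK cobound_of_list => /eq_of_list e.
exists (to_list g) => s; have [/e//|sn] := eqVneq (size s) n.+1.
rewrite Fn // (@delta_homogeneous n) // => l ln.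
by rewrite /to_list (negPf ln).
Qed.

Lemma cls_surj n (z : coho 'F_2 A n) :
  exists F, [/\ coc F, homogeneous n F & z = cls n F].
Proof.
rewrite -[z]lreprK; case: (lrepr z) => f fZ.
have hf : homogeneous n (to_list f).
  by move=> s sn; rewrite /to_list (negPf sn).
have cf : coc (to_list f).
  move=> s; have [|/(delta_homogeneous hf)//] := eqVneq (size s) n.+1.
  move: s; apply/(@eq_of_list n.+1 _ (fun=> 0)).
  by rewrite -cobound_of_list to_listK; apply/eqP.
exists (to_list f); split=> //; congr (lpi _ _); apply: val_inj.
by rewrite val_cls // to_listK.
Qed.

End ListCochains.
Arguments of_list {A} n F _.
Arguments cls {A} n F.

Lemma pullback_homogeneous (A B : zmodType) (f : B -> A) n F :
  homogeneous n F -> homogeneous n (pullback f F).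
Proof. by move=> Fn s sn; rewrite /pullback Fn // size_map. Qed.

Lemma cls_map (A B : zmodType) (h : {additive A -> B}) n F : coc F ->
  coho_map 'F_2 h n (cls n F) = cls n (pullback h F).
Proof.
move=> cF; rewrite /cls coho_mapE; congr coho_class; apply: val_inj.
rewrite val_cls; last by move=> s; rewrite delta_pullback cF.
rewrite /= -[cocycle_val _]/(val _) val_cls //.
by apply/funext => a; rewrite /cochain_map /of_list /pullback -map_comp.
Qed.

(** * Cup products and their commutation up to coboundaries *)

Section CupOperators.
Variable A : zmodType.
Implicit Types (P Q F H : seq A -> 'F_2) (s : seq A).

Definition cohom F H := cob (fun s => F s + H s).

Lemma cohom_refl F : cohom F F.
Proof. by exists (fun=> 0) => s; rewrite F2dbl delta0. Qed.

Lemma cobD F H : cob F -> cob H -> cob (fun s => F s + H s).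
Proof.
by move=> [k Fk] [l Hl]; exists (fun s => k s + l s) => s; rewrite deltaD Fk Hl.
Qed.

Lemma eq_cob F H : (forall s, F s = H s) -> cob F -> cob H.
Proof. by move=> FH [k Fk]; exists k => s; rewrite -FH. Qed.

Lemma cohom_sym F H : cohom F H -> cohom H F.
Proof. by apply: eq_cob => s; rewrite addrC. Qed.

Lemma cohom_trans F H I : cohom F H -> cohom H I -> cohom F I.
Proof. by move=> FH HI; apply: eq_cob (cobD FH HI) => s; F2. Qed.

Lemma cohom_coc F H : cohom F H -> coc F -> coc H.
Proof.
move=> /cob_coc FH cF s; have := FH s.
by rewrite deltaD cF add0r.
Qed.

Lemma eq_lcup_size p P Q F s : (forall l, size l = p -> P l = Q l) ->
  lcup p P F s = lcup p Q F s.
Proof.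
elim: p P Q s => [|p IH] P Q [|g s] PQ //=; rewrite ?PQ //.
by apply: IH => l sl; apply: PQ; rewrite /= sl.
Qed.

Lemma lcup0l p F s : lcup p (fun=> 0) F s = 0.
Proof. by elim: p s => [|p IH] [|g s] //=; rewrite ?mul0r. Qed.

Lemma lcupZl a p P F s : lcup p (fun l => a * P l) F s = a * lcup p P F s.
Proof. by elim: p P s => [|p IH] P [|g s] //=; rewrite ?mulr0 ?mulrA. Qed.

Lemma lcup_lcup p P q Q F s : lcup p P (lcup q Q F) s =
  lcup (p + q) (fun l => P (take p l) * Q (drop p l)) F s.
Proof.
elim: p P s => [|p IH] P s; last by case: s => [|g s] //=.
by rewrite /= -lcupZl; apply: eq_lcup_size => l _; rewrite take0 drop0.
Qed.

(** Weaker than [coc]: [chain1] and [chain2] ignore all but the first entries, so only the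
    coboundary in their own degree is meaningful. *)
Definition pcoc p P := forall s, size s = p.+1 -> delta P s = 0.

Lemma coc_lcup p P F : pcoc p P -> coc F -> coc (lcup p P F).
Proof.
move=> cP cF s; rewrite delta_lcup (eq_lcup _ _ _ cF) lcup0r addr0.
by rewrite (eq_lcup_size _ _ cP) lcup0l.
Qed.

Lemma cob_lcup_boundary p P H F : coc F -> (forall s, size s = p.+1 -> P s = delta H s) ->
  cob (lcup p.+1 P F).
Proof.
move=> cF PH; exists (lcup p H F) => s.
rewrite delta_lcup (eq_lcup _ _ _ cF) lcup0r addr0.
exact: eq_lcup_size.
Qed.

Lemma cob_lcup p P F : pcoc p P -> cob F -> cob (lcup p P F).
Proof.
move=> cP [k Fk]; exists (lcup p P k) => s.
rewrite delta_lcup (eq_lcup_size _ _ cP) lcup0l add0r.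
exact: eq_lcup.
Qed.

Lemma cohom_lcup p P F H : pcoc p P -> cohom F H -> cohom (lcup p P F) (lcup p P H).
Proof.
by move=> cP FH; apply: eq_cob (cob_lcup cP FH) => s; rewrite lcupDr.
Qed.

(** [H] plays the part of the cup-1 product of [P] and [Q], whose coboundary measures the failure of
    commutativity. *)
Lemma cohom_lcup_comm n p q P Q H F : coc F -> (p + q = n.+1)%N ->
  (forall s, size s = n.+1 ->
     P (take p s) * Q (drop p s) + Q (take q s) * P (drop q s) = delta H s) ->
  cohom (lcup p P (lcup q Q F)) (lcup q Q (lcup p P F)).
Proof.
move=> cF pq PQ; apply: eq_cob (cob_lcup_boundary cF PQ) => s.
by rewrite lcupDl !lcup_lcup [in RHS](addnC q) pq.
Qed.

Definition linear1 (x : A -> 'F_2) := forall g h, x (g + h) = x g + x h.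
Definition chain1 (x : A -> 'F_2) s : 'F_2 := x (nth 0 s 0).
Definition chain2 (w : A -> A -> 'F_2) s : 'F_2 := w (nth 0 s 0) (nth 0 s 1).

Lemma pcoc1 x : linear1 x -> pcoc 1 (chain1 x).
Proof. by move=> lx [|g [|h []]] //= _; rewrite /chain1 /= lx; F2. Qed.

Lemma pcoc2 w : abelian_cocycle w -> pcoc 2 (chain2 w).
Proof.
move=> [_ _ cw] [|g [|h [|k []]]] //= _.
by rewrite /chain2 /= -[RHS](cw g h k); F2.
Qed.

Lemma cohom_comm11 x y F : linear1 x -> linear1 y -> coc F ->
  cohom (lcup 1 (chain1 x) (lcup 1 (chain1 y) F)) (lcup 1 (chain1 y) (lcup 1 (chain1 x) F)).
Proof.
move=> lx ly cF; apply: (@cohom_lcup_comm 1 _ _ _ _ (chain1 (fun g => x g * y g))) => //.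
by case=> [|g [|h []]] //= _; rewrite /chain1 /= lx ly; F2.
Qed.

Lemma cohom_comm21 w x F : abelian_cocycle w -> linear1 x -> coc F ->
  cohom (lcup 2 (chain2 w) (lcup 1 (chain1 x) F)) (lcup 1 (chain1 x) (lcup 2 (chain2 w) F)).
Proof.
move=> [_ _ cw] lx cF.
apply: (@cohom_lcup_comm 2 _ _ _ _ (chain2 (fun g h => w g h * (x g + x h)))) => //.
case=> [|g [|h [|k []]]] //= _; rewrite /chain1 /chain2 /= !lx.
have e : w (g + h) k = w h k + w g (h + k) + w g h.
  by rewrite -[LHS]addr0 -(cw g h k); F2.
by rewrite e; F2.
Qed.

Lemma cohom_comm22 v w F : abelian_cocycle v -> abelian_cocycle w -> coc F ->
  cohom (lcup 2 (chain2 v) (lcup 2 (chain2 w) F)) (lcup 2 (chain2 w) (lcup 2 (chain2 v) F)).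
Proof.
move=> [_ _ cv] [_ _ cw] cF.
(* The cup-1 product of two 2-cochains: [w] is inserted in the first or in the second argument of
   [v]. *)
pose H s := v (nth 0 s 0 + nth 0 s 1) (nth 0 s 2) * w (nth 0 s 0) (nth 0 s 1)
  + v (nth 0 s 0) (nth 0 s 1 + nth 0 s 2) * w (nth 0 s 1) (nth 0 s 2).
apply: (@cohom_lcup_comm 3 _ _ _ _ H) => //.
case=> [|g [|h [|k [|l []]]]] //= _; rewrite /chain2 /H /=.
have e4 (c : A -> A -> 'F_2) : (forall x y z, c y z + c (x + y) z + c x (y + z) + c x y = 0) ->
    [/\ forall x y z, c (x + y) z = c y z + c x (y + z) + c x y,
        forall x y z, c x y = c y z + c (x + y) z + c x (y + z) &
        forall x y z, c y z = c (x + y) z + c x (y + z) + c x y].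
  move=> cc; split=> x y z; rewrite -[LHS]addr0 -(cc x y z); F2.
have [w1 _ _] := e4 w cw; have [v1 v2 v3] := e4 v cv.
(* Each cocycle identity is solved for one value, so that substitution leaves a polynomial identity
   over F_2. *)
rewrite (w1 g h k) (w1 h k l) (v2 g h (k + l)) (v3 (g + h) k l).
have e : v (h + k) l = v (g + (h + k)) l + v g (h + k + l) + v g (h + k) by exact: v3.
by rewrite e -?addrA; F2.
Qed.

End CupOperators.

Section FoldOperators.
Variables (A : zmodType) (T : eqType) (op : T -> (seq A -> 'F_2) -> seq A -> 'F_2).
Hypothesis op_coc : forall x F, coc F -> coc (op x F).
Hypothesis op_cohom : forall x F H, cohom F H -> cohom (op x F) (op x H).
Hypothesis op_comm : forall x y F, coc F -> cohom (op x (op y F)) (op y (op x F)).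

Lemma foldr_coc t F : coc F -> coc (foldr op F t).
Proof. by move=> cF; elim: t => //= x t IH; apply: op_coc. Qed.

Lemma foldr_cohom t F H : cohom F H -> cohom (foldr op F t) (foldr op H t).
Proof. by move=> FH; elim: t => //= x t IH; apply: op_cohom. Qed.

(** The head of [s] is commuted past the entries that precede its occurrence in [t], one at a
    time. *)
Lemma foldr_perm s t F : coc F -> perm_eq s t -> cohom (foldr op F s) (foldr op F t).
Proof.
move=> cF; elim: s t => [|x s IH] t st.
  by move: st; rewrite perm_sym => /perm_nilP ->; apply: cohom_refl.
have xt : x \in t by rewrite -(perm_mem st) mem_head.
case/splitPr: xt st => t1 t2; rewrite -[x :: t2]cat1s perm_sym perm_catCA /= perm_cons perm_sym => st.
apply: cohom_trans (op_cohom x (IH _ st)) _ => /=; rewrite !foldr_cat /=.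
have: coc (foldr op F t2) by apply: foldr_coc.
elim: t1 {st} (foldr op F t2) => [|y t1 IH1] F2 cF2 /=; first exact: cohom_refl.
apply: cohom_trans (op_comm _ _ (foldr_coc _ cF2)) _.
by apply: op_cohom; apply: IH1.
Qed.
End FoldOperators.

Section Monomials.
Variable A : zmodType.
Implicit Types (x y : mod2V A) (w v : tors2V A) (F : seq A -> 'F_2).

(** The default 0 gives an abelian cocycle for every [A]; that the diagonal is [w] holds once
    surjectivity of Ext(A, F_2) -> Hom(2A, F_2) is known. The choice need not be additive in [w]. *)
Definition wcoc w : A -> A -> 'F_2 :=
  if pselect (exists c : A -> A -> 'F_2, abelian_cocycle c /\ forall a : tors2 A,
    c (val a) (val a) = w a) is left e then projT1 (cid e) else fun _ _ => 0.

Lemma wcoc_abelian w : abelian_cocycle (wcoc w).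
Proof.
rewrite /wcoc; case: pselect => [e|_]; last exact: abelian_cocycle_zero.
by case: cid => c [].
Qed.

Definition xchar x (a : A) : 'F_2 := x (mod2_pi a).

Lemma xchar_linear x : linear1 (xchar x).
Proof. by move=> g h; rewrite /xchar raddfD dualD. Qed.

Definition xop x := lcup 1 (chain1 (xchar x)).
Definition wop w := lcup 2 (chain2 (wcoc w)).
Definition unit_cochain (s : seq A) : 'F_2 := (nilp s)%:R.
Definition wmono (u : seq (tors2V A)) := foldr wop unit_cochain u.
Definition mono t u := foldr xop (wmono u) t.

Lemma coc_unit : coc unit_cochain.
Proof.
case=> // g s; rewrite /= /unit_cochain; case: s => [|h s]; first by rewrite /=; F2.
by rewrite /= inner_faces0 !addr0.
Qed.

Lemma xop_coc x F : coc F -> coc (xop x F).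
Proof. exact/coc_lcup/pcoc1/xchar_linear. Qed.
Lemma wop_coc w F : coc F -> coc (wop w F).
Proof. exact/coc_lcup/pcoc2/wcoc_abelian. Qed.
Lemma xop_cohom x F H : cohom F H -> cohom (xop x F) (xop x H).
Proof. exact/cohom_lcup/pcoc1/xchar_linear. Qed.
Lemma wop_cohom w F H : cohom F H -> cohom (wop w F) (wop w H).
Proof. exact/cohom_lcup/pcoc2/wcoc_abelian. Qed.
Lemma xop_comm x y F : coc F -> cohom (xop x (xop y F)) (xop y (xop x F)).
Proof. exact/cohom_comm11/xchar_linear/xchar_linear. Qed.
Lemma wop_comm w v F : coc F -> cohom (wop w (wop v F)) (wop v (wop w F)).
Proof. exact/cohom_comm22/wcoc_abelian/wcoc_abelian. Qed.
Lemma wop_xop_comm w x F : coc F -> cohom (wop w (xop x F)) (xop x (wop w F)).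
Proof. exact/cohom_comm21/xchar_linear/wcoc_abelian. Qed.

Lemma wmono_coc u : coc (wmono u).
Proof. exact: (foldr_coc wop_coc _ coc_unit). Qed.
Lemma mono_coc t u : coc (mono t u).
Proof. exact: (foldr_coc xop_coc _ (wmono_coc u)). Qed.

Lemma mono_homogeneous t u : homogeneous (size t + 2 * size u) (mono t u).
Proof.
elim: t => [|x t IH]; last exact: (lcup_homogeneous (p := 1)).
elim: u => [|w u IH]; first by case.
rewrite /= add0n mulnS -[(2 * _)%N]add0n; exact: (lcup_homogeneous (p := 2)).
Qed.

Lemma xop_lin c x y F s : xop (c *: x + y) F s = c * xop x F s + xop y F s.
Proof.
rewrite /xop -lcupZl -lcupDl; apply: eq_lcup_size => l _.
by rewrite /chain1 /xchar.
Qed.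

Lemma mono_perm_l s t u : perm_eq s t -> cohom (mono s u) (mono t u).
Proof. exact: (foldr_perm xop_coc xop_cohom xop_comm (wmono_coc u)). Qed.

Lemma mono_perm_r t u u' : perm_eq u u' -> cohom (mono t u) (mono t u').
Proof.
move=> uv; apply: (foldr_cohom xop_cohom).
exact: (foldr_perm wop_coc wop_cohom wop_comm coc_unit).
Qed.

Lemma mono_wop t w u : cohom (wop w (mono t u)) (mono t (w :: u)).
Proof.
elim: t => [|x t IH] /=; first exact: cohom_refl.
apply: cohom_trans (wop_xop_comm _ _ (mono_coc t u)) _.
exact: xop_cohom.
Qed.

Hypothesis cycA : cyc_built A.

Lemma wcoc_diag w (a : tors2 A) : wcoc w (val a) (val a) = w a.
Proof.
rewrite /wcoc; case: pselect => [e|]; first by case: cid => c [].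
by case; apply: (cyc_ext_surj cycA).
Qed.

(** The sum of the two factor sets has zero diagonal on the 2-torsion, so it splits by injectivity
    of Ext(A, F_2) -> Hom(2A, F_2), and the splitting function provides the bounding cochain. *)
Lemma wop_uniq c w F : abelian_cocycle c ->
  (forall a : tors2 A, c (val a) (val a) = w a) -> coc F ->
  cohom (lcup 2 (chain2 c) F) (wop w F).
Proof.
move=> cc cw cF.
have [|a a2|k kE] := cyc_ext_inj cycA (c := fun g h => c g h + wcoc w g h).
- exact: abelian_cocycleD (wcoc_abelian w).
- have ta : a \in two_tors (A := A) by apply/eqP.
  by have := wcoc_diag w (Tors2 ta); rewrite -cw /= => ->; rewrite F2dbl.
apply: eq_cob (cob_lcup_boundary (P := fun s => chain2 c s + chain2 (wcoc w) s)
  (H := chain1 k) cF _) => [s|]; first by rewrite lcupDl.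
by case=> [|g [|h []]] //= _; rewrite /chain2 /chain1 /= kE; F2.
Qed.

Lemma wop_lin c w v F : coc F ->
  cohom (wop (c *: w + v) F) (fun s => c * wop w F s + wop v F s).
Proof.
move=> cF; apply: cohom_sym.
apply: cohom_trans (wop_uniq (c := fun g h => c * wcoc w g h + wcoc v g h) _ _ cF).
- apply: eq_cob (cohom_refl (fun s => c * wop w F s + wop v F s)) => s; congr (_ + _).
  rewrite /wop -lcupZl -lcupDl; exact: eq_lcup_size.
- apply: abelian_cocycleD (wcoc_abelian v).
  case: (wcoc_abelian w) => cC c0 cc; split=> [x y||x y z].
  + by rewrite cC.
  + by rewrite c0 mulr0.
  + by rewrite -!mulrDr cc mulr0.
- by move=> a; rewrite !wcoc_diag.
Qed.

(** The cup square of [x] is the factor set x(g) x(h), whose value at (a, a) is x(a)^2 = x(a). *)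
Lemma xop_xop x F : coc F -> cohom (xop x (xop x F)) (wop (betaV A x) F).
Proof.
move=> cF; have lx := xchar_linear x.
have cc : abelian_cocycle (fun g h => xchar x g * xchar x h).
  split=> [g h||g h k]; first by rewrite mulrC.
    by have := lx 0 0; rewrite addr0 => ->; F2.
  by rewrite !lx; F2.
apply: cohom_trans (wop_uniq cc _ cF).
  apply: eq_cob (cohom_refl (xop x (xop x F))) => s; congr (_ + _).
  by rewrite /xop lcup_lcup; apply: eq_lcup_size => -[|g [|h []]].
move=> a; rewrite /= /beta_fun -/(xchar x _); case: (xchar x _) => [[|[]]] // i; exact: val_inj.
Qed.

Lemma foldr_xop_lin t c F H s :
  foldr xop (fun s => c * F s + H s) t s = c * foldr xop F t s + foldr xop H t s.
Proof.
elim: t s => //= x t IH s; rewrite /xop (eq_lcup _ _ _ IH) lcupDr lcupZr.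
by [].
Qed.

Lemma mono_lin_r t c w v u : cohom (mono t (c *: w + v :: u))
  (fun s => c * mono t (w :: u) s + mono t (v :: u) s).
Proof.
apply: cohom_trans (foldr_cohom xop_cohom t (wop_lin c w v (wmono_coc u))) _.
by apply: eq_cob (cohom_refl (mono t (c *: w + v :: u))) => s; rewrite -?foldr_xop_lin F2dbl F2dbl.
Qed.

Lemma mono_sq x t u : cohom (mono (x :: x :: t) u) (mono t (betaV A x :: u)).
Proof.
apply: cohom_trans (mono_wop t _ u) => /=; exact/xop_xop/mono_coc.
Qed.

End Monomials.

Lemma pullback_lcup1 (A B : zmodType) (h : {additive A -> B}) x F s :
  pullback h (xop x F) s = xop (dual_map (mod2_map h) x) (pullback h F) s.
Proof.
rewrite -lcup_pullback; apply: eq_lcup_size => -[|g []] // _.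
by rewrite /pullback /chain1 /xchar /= mod2_mapE.
Qed.

(** The pullback of the factor set chosen for [w] need not be the one chosen for the pulled back
    form, but both have the same diagonal, so [wop_uniq] compares them. *)
Lemma mono_pullback (A B : zmodType) (h : {additive A -> B}) t u : cyc_built A -> cyc_built B ->
  cohom (pullback h (mono t u))
    (mono (map (dual_map (mod2_map h)) t) (map (dual_map (tors2_map h)) u)).
Proof.
move=> cycA cycB; elim: t => [|x t IH] /=; last first.
  apply: cohom_trans (xop_cohom _ IH).
  by apply: eq_cob (cohom_refl (pullback h (xop x (mono t u)))) => s; rewrite {2}pullback_lcup1.
elim: u => [|w u IH] /=.
  by apply: eq_cob (cohom_refl (pullback h (unit_cochain (A := B)))) => -[].
apply: cohom_trans (wop_cohom _ IH).
have cF : coc (pullback h (wmono u)) by move=> s; rewrite delta_pullback; apply: wmono_coc.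
apply: cohom_trans (wop_uniq cycA (abelian_cocycle_comp h (wcoc_abelian w)) _ cF); last first.
  by move=> a; exact: (wcoc_diag cycB w (tors2_map h a)).
apply: eq_cob (cohom_refl (pullback h (wop w (wmono u)))) => s; congr (_ + _).
rewrite -lcup_pullback; apply: eq_lcup_size => -[|g [|k []]] //.
Qed.

(** * The algebra Sym(V) (x) Sym(W) / (x^2 = b(x)) and its realisation *)

Section FreeQuotient.
Variables (K : fieldType) (X : choiceType) (P : {freeg X / K} -> Prop).

Lemma freeg_ind (Q : {freeg X / K} -> Prop) : Q 0 ->
  (forall c x y, Q x -> Q y -> Q (c *: x + y)) -> (forall x, Q << x >>) -> forall z, Q z.
Proof.
move=> Q0 QD Qx z; rewrite -(freeg_sumE z); elim/big_ind: _ => [//|x y|x _].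
  by move=> Qx' Qy; rewrite -[x]scale1r; apply: QD.
have -> : << coeff x z *g x >> = coeff x z *: << x >> + 0 :> {freeg X / K}.
  by rewrite addr0; apply/eqP/freeg_eqP => y; rewrite coeffZ !coeffU mul1r.
exact: QD.
Qed.

Lemma lquot_free_ind (Q : lquot P -> Prop) : Q 0 ->
  (forall c x y, Q x -> Q y -> Q (c *: x + y)) -> (forall x, Q (lpi P << x >>)) ->
  forall z, Q z.
Proof.
move=> Q0 QD Qx z; rewrite -[z]lreprK; elim/freeg_ind: (lrepr z) => [|c x y Px Py|x //].
  by rewrite linear0.
by rewrite linearP; apply: QD.
Qed.
End FreeQuotient.

Section CohomologyAlgebra.
Variables (n : nat) (A : zmodType).
Local Notation V := (mod2V A).
Local Notation W := (tors2V A).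

(** The relations touch only the heads of the lists; [AlgPerml] and [AlgPermr] carry them to every
    position. *)
Inductive alg_rel : {freeg (seq V * seq W)%type / 'F_2} -> Prop :=
| AlgLinl c x y t u :
    alg_rel (<< (c *: x + y :: t, u) >> - c *: << (x :: t, u) >> - << (y :: t, u) >>)
| AlgLinr c v w t u :
    alg_rel (<< (t, c *: v + w :: u) >> - c *: << (t, v :: u) >> - << (t, w :: u) >>)
| AlgPerml t t' u : perm_eq t t' -> alg_rel (<< (t, u) >> - << (t', u) >>)
| AlgPermr t u u' : perm_eq u u' -> alg_rel (<< (t, u) >> - << (t, u') >>)
| AlgSq x t u : alg_rel (<< (x :: x :: t, u) >> - << (t, betaV A x :: u) >>)
| AlgDeg t u : (size t + 2 * size u <> n)%N -> alg_rel << (t, u) >>.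

(* The degree n part of Sym(V) (x) Sym(W) / (x^2 = b(x)); the class of (t, u)
   is the product of the elements of t and u, and 0 in the wrong degree. *)
Definition alg := lquot alg_rel.
HB.instance Definition _ := GRing.Lmodule.on alg.

Definition gen (t : seq V) (u : seq W) : alg := lpi alg_rel << (t, u) >>.

Record alg_compat (M : lmodType 'F_2) (q : seq V -> seq W -> M) : Prop := AlgCompat {
  compat_linl : forall c x y t u, q (c *: x + y :: t) u = c *: q (x :: t) u + q (y :: t) u;
  compat_linr : forall c v w t u, q t (c *: v + w :: u) = c *: q t (v :: u) + q t (w :: u);
  compat_perml : forall t t' u, perm_eq t t' -> q t u = q t' u;
  compat_permr : forall t u u', perm_eq u u' -> q t u = q t u';
  compat_sq : forall x t u, q (x :: x :: t) u = q t (betaV A x :: u);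
  compat_deg : forall t u, (size t + 2 * size u <> n)%N -> q t u = 0 }.

Lemma gen_compat : alg_compat gen.
Proof.
split=> [c x y t u|c v w t u|t t' u tt'|t u u' uu'|x t u|t u /AlgDeg/lpi_rel //].
- have := lpi_rel (AlgLinl c x y t u); rewrite !linearB linearZ /=.
  by move=> /subr0_eq/(canRL (subrK _)) e; rewrite [RHS]addrC; exact: e.
- have := lpi_rel (AlgLinr c v w t u); rewrite !linearB linearZ /=.
  by move=> /subr0_eq/(canRL (subrK _)) e; rewrite [RHS]addrC; exact: e.
- by have := lpi_rel (AlgPerml u tt'); rewrite linearB => /subr0_eq.
- by have := lpi_rel (AlgPermr t uu'); rewrite linearB => /subr0_eq.
- by have := lpi_rel (AlgSq x t u); rewrite linearB => /subr0_eq.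
Qed.

Section Lift.
Variables (M : lmodType 'F_2) (q : seq V -> seq W -> M).
Hypothesis Hq : alg_compat q.

Lemma alg_lift_rel x : alg_rel x -> free_lift (fun p => q p.1 p.2) x = 0.
Proof.
case=> [c y z t u|c v w t u|t t' u tt'|t u u' uu'|y t u|t u tu].
- by rewrite !linearB linearZ !free_liftE /= (compat_linl Hq) addrBB.
- by rewrite !linearB linearZ !free_liftE /= (compat_linr Hq) addrBB.
- by rewrite linearB !free_liftE /= (compat_perml Hq _ tt') subrr.
- by rewrite linearB !free_liftE /= (compat_permr Hq _ uu') subrr.
- by rewrite linearB !free_liftE /= (compat_sq Hq) subrr.
- by rewrite free_liftE /= (compat_deg Hq).
Qed.

Definition alg_lift : {linear alg -> M} := lquot_lift alg_lift_rel.

Lemma alg_liftE t u : alg_lift (gen t u) = q t u.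
Proof. exact: etrans (lquot_liftE alg_lift_rel _) (free_liftE _ _). Qed.
End Lift.

Lemma alg_ind (Q : alg -> Prop) : Q 0 ->
  (forall c x y, Q x -> Q y -> Q (c *: x + y)) -> (forall t u, Q (gen t u)) ->
  forall z, Q z.
Proof. by move=> Q0 QD Qg; apply: lquot_free_ind => // -[t u]; apply: Qg. Qed.

End CohomologyAlgebra.

Lemma perm_swap2 (T : eqType) (x y : T) s : perm_eq (x :: y :: s) (y :: x :: s).
Proof. by apply/permP => a /=; rewrite addnCA. Qed.

Section AlgebraOperations.
Variables (A : zmodType).
Local Notation V := (mod2V A).
Local Notation W := (tors2V A).

Lemma mulx_compat n (x : V) : alg_compat n (fun t u => gen n.+1 (x :: t) u).
Proof.
have H := gen_compat n.+1 A.
have swap y t u : gen n.+1 (x :: y :: t) u = gen n.+1 (y :: x :: t) u.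
  exact/(compat_perml H)/perm_swap2.
split=> [c y z t u|c v w t u|t t' u tt'|t u u' uu'|y t u|t u tu].
- by rewrite swap (compat_linl H) !(swap _ t).
- exact: (compat_linr H).
- by apply: (compat_perml H); rewrite perm_cons.
- exact: (compat_permr H).
- rewrite swap -(compat_sq H); apply: (compat_perml H).
  by rewrite perm_cons perm_swap2.
- by apply: (compat_deg H) => /= e; apply: tu; move: e; rewrite addSn => -[].
Qed.

Lemma mulw_compat n (w : W) : alg_compat n (fun t u => gen n.+2 t (w :: u)).
Proof.
have H := gen_compat n.+2 A.
have swap t v u : gen n.+2 t (w :: v :: u) = gen n.+2 t (v :: w :: u).
  exact/(compat_permr H)/perm_swap2.
split=> [c y z t u|c v v' t u|t t' u tt'|t u u' uu'|y t u|t u tu].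
- exact: (compat_linl H).
- by rewrite swap (compat_linr H) !(swap t).
- exact: (compat_perml H).
- by apply: (compat_permr H); rewrite perm_cons.
- by rewrite swap -(compat_sq H).
- by apply: (compat_deg H) => /= e; apply: tu; move: e; rewrite mulnS; lia.
Qed.

Definition mulx n x (r : alg n A) : alg n.+1 A := alg_lift (mulx_compat n x) r.
Definition mulw n w (r : alg n A) : alg n.+2 A := alg_lift (mulw_compat n w) r.
Arguments mulx n x r : clear implicits.
Arguments mulw n w r : clear implicits.

Lemma mulxE n x t u : mulx n x (gen n t u) = gen n.+1 (x :: t) u.
Proof. exact: alg_liftE. Qed.
Lemma mulwE n w t u : mulw n w (gen n t u) = gen n.+2 t (w :: u).
Proof. exact: alg_liftE. Qed.

Lemma mulxr0 n x : mulx n x 0 = 0.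
Proof. exact: linear0. Qed.
Lemma mulxD n x r s : mulx n x (r + s) = mulx n x r + mulx n x s.
Proof. exact: linearD. Qed.
Lemma mulxZ n x c r : mulx n x (c *: r) = c *: mulx n x r.
Proof. exact: linearZ. Qed.
Lemma mulwr0 n w : mulw n w 0 = 0.
Proof. exact: linear0. Qed.
Lemma mulwD n w r s : mulw n w (r + s) = mulw n w r + mulw n w s.
Proof. exact: linearD. Qed.
Lemma mulwZ n w c r : mulw n w (c *: r) = c *: mulw n w r.
Proof. exact: linearZ. Qed.

Lemma mulx_lin n c x y r : mulx n (c *: x + y) r = c *: mulx n x r + mulx n y r.
Proof.
elim/alg_ind: r => [|d r s Hr Hs|t u]; first by rewrite !mulxr0 scaler0 addr0.
  rewrite !mulxD !mulxZ.
  by rewrite Hr Hs !scalerDr addrACA !scalerA mulrC.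
by rewrite !mulxE (compat_linl (gen_compat _ _)).
Qed.

Lemma mulw_lin n c v w r : mulw n (c *: v + w) r = c *: mulw n v r + mulw n w r.
Proof.
elim/alg_ind: r => [|d r s Hr Hs|t u]; first by rewrite !mulwr0 scaler0 addr0.
  rewrite !mulwD !mulwZ.
  by rewrite Hr Hs !scalerDr addrACA !scalerA mulrC.
by rewrite !mulwE (compat_linr (gen_compat _ _)).
Qed.

Lemma mulx_mulx n x y r : mulx n.+1 x (mulx n y r) = mulx n.+1 y (mulx n x r).
Proof.
elim/alg_ind: r => [|d r s Hr Hs|t u]; first by rewrite !(mulxr0, mulwr0).
  by rewrite !(mulxD, mulwD, mulxZ, mulwZ) Hr Hs.
by rewrite !mulxE; apply: (compat_perml (gen_compat _ _)); rewrite perm_swap2.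
Qed.

Lemma mulw_mulw n v w r : mulw n.+2 v (mulw n w r) = mulw n.+2 w (mulw n v r).
Proof.
elim/alg_ind: r => [|d r s Hr Hs|t u]; first by rewrite !(mulxr0, mulwr0).
  by rewrite !(mulxD, mulwD, mulxZ, mulwZ) Hr Hs.
by rewrite !mulwE; apply: (compat_permr (gen_compat _ _)); rewrite perm_swap2.
Qed.

Lemma mulx_mulw n x w r : mulx n.+2 x (mulw n w r) = mulw n.+1 w (mulx n x r).
Proof.
elim/alg_ind: r => [|d r s Hr Hs|t u]; first by rewrite !(mulxr0, mulwr0).
  by rewrite !(mulxD, mulwD, mulxZ, mulwZ) Hr Hs.
by rewrite !(mulxE, mulwE).
Qed.

Lemma mulx_sq n x r : mulx n.+1 x (mulx n x r) = mulw n (betaV A x) r.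
Proof.
elim/alg_ind: r => [|d r s Hr Hs|t u]; first by rewrite !(mulxr0, mulwr0).
  by rewrite !(mulxD, mulwD, mulxZ, mulwZ) Hr Hs.
by rewrite !(mulxE, mulwE) (compat_sq (gen_compat _ _)).
Qed.
End AlgebraOperations.
Arguments mulx {A} n x r.
Arguments mulw {A} n w r.

Lemma beta_natural (A B : zmodType) (h : {additive A -> B}) x :
  betaV A (dual_map (mod2_map h) x) = dual_map (tors2_map h) (betaV B x).
Proof. by apply: val_inj; apply/funext => a; rewrite /= /beta_fun mod2_mapE. Qed.

Section AlgebraPullback.
Variables (A B : zmodType) (h : {additive A -> B}).

Definition pull_gen n t u :=
  gen n (map (dual_map (mod2_map h)) t) (map (dual_map (tors2_map h)) u).

Lemma pull_compat n : alg_compat n (pull_gen n).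
Proof.
have H := gen_compat n A.
split=> [c y z t u|c v v' t u|t t' u tt'|t u u' uu'|y t u|t u tu]; rewrite /pull_gen.
- by rewrite !map_cons linearP (compat_linl H).
- by rewrite !map_cons linearP (compat_linr H).
- by apply: (compat_perml H); rewrite perm_map.
- by apply: (compat_permr H); rewrite perm_map.
- by rewrite !map_cons (compat_sq H) beta_natural.
- by apply: (compat_deg H); rewrite !size_map.
Qed.

Definition pull n (r : alg n B) : alg n A := alg_lift (pull_compat n) r.
Arguments pull n r : clear implicits.

Lemma pullE n t u : pull n (gen n t u) = pull_gen n t u.
Proof. exact: alg_liftE. Qed.

Lemma pullr0 n : pull n 0 = 0.
Proof. exact: linear0. Qed.
Lemma pullD n r s : pull n (r + s) = pull n r + pull n s.
Proof. exact: linearD. Qed.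
Lemma pullZ n c r : pull n (c *: r) = c *: pull n r.
Proof. exact: linearZ. Qed.

Lemma pull_mulx n x r : pull n.+1 (mulx n x r) = mulx n (dual_map (mod2_map h) x) (pull n r).
Proof.
elim/alg_ind: r => [|d r s Hr Hs|t u]; first by rewrite !(mulxr0, mulwr0, pullr0).
  by rewrite !(mulxD, mulwD, mulxZ, mulwZ, pullD, pullZ) Hr Hs.
by rewrite mulxE !pullE mulxE.
Qed.

Lemma pull_mulw n w r : pull n.+2 (mulw n w r) = mulw n (dual_map (tors2_map h) w) (pull n r).
Proof.
elim/alg_ind: r => [|d r s Hr Hs|t u]; first by rewrite !(mulxr0, mulwr0, pullr0).
  by rewrite !(mulxD, mulwD, mulxZ, mulwZ, pullD, pullZ) Hr Hs.
by rewrite mulwE !pullE mulwE.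
Qed.
End AlgebraPullback.
Arguments pull {A B} h n r.

(** * The realization map and representing cocycles *)

Section Realization.
Variables (A : zmodType) (cycA : cyc_built A).

Lemma cls_cohom n (F H : seq A -> 'F_2) : coc F -> cohom F H -> cls n F = cls n H.
Proof.
move=> cF FH; have cH := cohom_coc FH cF.
have := cob_cls n FH; rewrite -(@cls_eq _ n (fun s => 1 * F s + H s)); last first.
  by move=> s _; rewrite mul1r.
rewrite cls_lin // scale1r => /eqP; rewrite addr_eq0 => /eqP ->.
by rewrite -scaleN1r (F2opp 1) scale1r.
Qed.

Lemma realize_compat n : alg_compat n (fun t u => cls n (mono (A := A) t u)).
Proof.
have c := @mono_coc A.
split=> [a x y t u|a v w t u|t t' u tt'|t u u' uu'|x t u|t u tu].
- by rewrite -cls_lin //; apply: cls_eq => s _; exact: xop_lin.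
- rewrite -cls_lin //; apply: cls_cohom => //; exact: mono_lin_r.
- by apply: cls_cohom => //; apply: mono_perm_l.
- by apply: cls_cohom => //; apply: mono_perm_r.
- by apply: cls_cohom => //; apply: mono_sq.
- rewrite -(cob_cls n (F := fun=> 0)); last by exists (fun=> 0) => s; rewrite delta0.
  apply: cls_eq => s sn; have := @mono_homogeneous A t u s; apply.
  by apply/eqP; rewrite sn => /esym.
Qed.

Definition realize n : {linear alg n A -> coho 'F_2 A n} := alg_lift (realize_compat n).

Lemma realizeE n t u : realize n (gen n t u) = cls n (mono t u).
Proof. exact: alg_liftE. Qed.

(** [xop] and [wop] act on cocycles rather than on classes, so an element of the algebra is followed
    through cocycles in its class. *)
Definition represents n (r : alg n A) F :=
  [/\ coc F, homogeneous n F & realize n r = cls n F].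

Lemma represents_lin n c r s F H : represents r F -> represents s H ->
  represents (n := n) (c *: r + s) (fun l => c * F l + H l).
Proof.
move=> [cF hF rF] [cH hH sH]; split; first exact: coc_lin.
  by move=> l ln; rewrite hF // hH // mulr0 addr0.
by rewrite linearP rF sH cls_lin.
Qed.

Lemma represents_cohom n (r : alg n A) F H : represents r F -> homogeneous n H -> cohom F H ->
  represents r H.
Proof.
move=> [cF hF rF] hH FH; split=> //; first exact: cohom_coc cF.
by rewrite rF; apply: cls_cohom.
Qed.

Lemma represents_uniq n (r : alg n A) F H : represents r F -> represents r H -> cohom F H.
Proof.
move=> [cF hF rF] [cH hH rH]; apply: (@cls_eq0 _ n).
- exact: cocD.
- by move=> s sn; rewrite hF // hH // addr0.
- rewrite -(@cls_eq _ n (fun s => 1 * F s + H s)); last by move=> s _; rewrite mul1r.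
  rewrite cls_lin // scale1r -rF -rH -[realize n r]scale1r -scalerDl.
  by rewrite F2dbl scale0r.
Qed.

Lemma represents_gen n t u : (size t + 2 * size u = n)%N -> represents (gen n t u) (mono t u).
Proof.
by move=> <-; split; [exact: mono_coc | exact: mono_homogeneous | rewrite realizeE].
Qed.

(** One representative compatible with all multiplications is built along [alg_ind]; uniqueness up
    to coboundaries will extend the compatibility to every representative. *)
Lemma represents_std n (r : alg n A) : exists F, [/\ represents r F,
  forall x, represents (mulx n x r) (xop x F) & forall w, represents (mulw n w r) (wop w F)].
Proof.
have z m : represents (0 : alg m A) (fun=> 0).
  split=> //; first exact: coc0.
  by rewrite linear0 cob_cls //; exists (fun=> 0) => s; rewrite delta0.
have xop0 m x : represents (0 : alg m A) (xop x (fun=> 0)).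
  apply: represents_cohom (z _) _ _; first by move=> s _; rewrite /xop lcup0r.
  by apply: eq_cob (cohom_refl (fun=> 0)) => s; rewrite /xop lcup0r.
have wop0 m w : represents (0 : alg m A) (wop w (fun=> 0)).
  apply: represents_cohom (z _) _ _; first by move=> s _; rewrite /wop lcup0r.
  by apply: eq_cob (cohom_refl (fun=> 0)) => s; rewrite /wop lcup0r.
elim/alg_ind: r => [|c r s [F [rF xF wF]] [H [sH xH wH]]|t u].
- by exists (fun=> 0); split=> // [x|w]; rewrite ?mulxr0 ?mulwr0; [apply: xop0 | apply: wop0].
- have ext m (q : alg m A) I J : represents q I -> (forall s, J s = I s) -> represents q J.
    move=> [cI hI qI] JI; split=> [l|l lm|]; first by rewrite (eq_delta _ JI).
      by rewrite JI hI.
    by rewrite qI; apply: cls_eq.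
  exists (fun l => c * F l + H l); split; first exact: represents_lin.
    move=> x; rewrite mulxD mulxZ; apply: ext (represents_lin c (xF x) (xH x)) _ => l.
    by rewrite /xop lcupDr lcupZr.
  move=> w; rewrite mulwD mulwZ; apply: ext (represents_lin c (wF w) (wH w)) _ => l.
  by rewrite /wop lcupDr lcupZr.
- have [tu|tu] := eqVneq (size t + 2 * size u)%N n; last first.
    have wrong m (t' : seq (mod2V A)) (u' : seq (tors2V A)) : (size t' + 2 * size u' != m)%N -> gen m t' u' = 0.
      by move=> /eqP; apply: (compat_deg (gen_compat m A)).
    exists (fun=> 0); rewrite wrong //; split=> // [x|w].
      by rewrite mulxr0; apply: xop0.
    by rewrite mulwr0; apply: wop0.
  exists (mono t u); split; first exact: represents_gen.
    by move=> x; rewrite mulxE; apply: (@represents_gen _ (x :: t)); rewrite /= addSn tu.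
  move=> w; rewrite mulwE; have tu' : (size t + 2 * size (w :: u) = n.+2)%N.
    by rewrite /= mulnS -tu; lia.
  apply: represents_cohom (represents_gen tu') _ _.
    by rewrite -tu; apply: (lcup_homogeneous (p := 2)); apply: mono_homogeneous.
  exact/cohom_sym/mono_wop.
Qed.

Lemma represents_mulx n (r : alg n A) F x : represents r F -> represents (mulx n x r) (xop x F).
Proof.
move=> rF; have [H [rH xH _]] := represents_std r; apply: represents_cohom (xH x) _ _.
  by case: rF => _ hF _; apply: (lcup_homogeneous (p := 1)).
exact/xop_cohom/(represents_uniq rH rF).
Qed.

Lemma represents_mulw n (r : alg n A) F w : represents r F -> represents (mulw n w r) (wop w F).
Proof.
move=> rF; have [H [rH _ wH]] := represents_std r; apply: represents_cohom (wH w) _ _.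
  by case: rF => _ hF _; apply: (lcup_homogeneous (p := 2)).
exact/wop_cohom/(represents_uniq rH rF).
Qed.

End Realization.

Section Truncation.
Variable A : zmodType.
Implicit Types F : seq A -> 'F_2.

(** The decompositions for products return cocycles with parts in all degrees; this cuts out the
    part that matters. *)
Definition trunc (n : nat) F (s : seq A) : 'F_2 := if size s == n then F s else 0.

Lemma trunc_homogeneous n F : homogeneous n (trunc n F).
Proof. by move=> s /negPf sn; rewrite /trunc sn. Qed.

Lemma delta_trunc n F s : delta (trunc n F) s = trunc n.+1 (delta F) s.
Proof.
have [sn|sn] := eqVneq (size s) n.+1; last first.
  by rewrite (delta_homogeneous (@trunc_homogeneous n F)) // /trunc (negPf sn).
rewrite /trunc sn eqxx; apply: eq_delta_size sn => l ln; by rewrite ln eqxx.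
Qed.

Lemma coc_trunc n F : coc F -> coc (trunc n F).
Proof. by move=> cF s; rewrite delta_trunc /trunc cF if_same. Qed.

Lemma cob_trunc n E F : cob E -> homogeneous n F ->
  (forall s, size s = n -> F s = E s) -> cob F.
Proof.
move=> [k Ek] hF FE; case: n hF FE => [|n] hF FE.
  exists (fun=> 0) => s; rewrite delta0; have [s0|/hF//] := eqVneq (size s) 0%N.
  by rewrite FE //; case: s s0 => // _; rewrite Ek.
exists (trunc n k) => s; rewrite delta_trunc /trunc; have [sn|/hF//] := eqVneq (size s) n.+1.
by rewrite FE.
Qed.

End Truncation.

(** Generators of the wrong size are 0; all others arise from the unit by [mulx] and [mulw], with
    the degree counting along. *)
Lemma alg_build (A : zmodType) (Q : forall n, alg n A -> Prop) :
  (forall n, Q n 0) -> (forall n c r s, Q n r -> Q n s -> Q n (c *: r + s)) ->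
  Q 0%N (gen 0 [::] [::]) ->
  (forall n x r, Q n r -> Q n.+1 (mulx n x r)) ->
  (forall n w r, Q n r -> Q n.+2 (mulw n w r)) -> forall n r, Q n r.
Proof.
move=> Q0 QD Q1 Qx Qw n; elim/alg_ind => // [c x y|t u]; first exact: QD.
have deg m (t' : seq (mod2V A)) (u' : seq (tors2V A)) :
    (size t' + 2 * size u' != m)%N -> gen m t' u' = 0.
  by move=> /eqP; apply: (compat_deg (gen_compat m A)).
elim: t n => [|x t IH] n.
  elim: u n => [|w u IH] n; first by case: n => [|n] //; rewrite deg.
  case: n => [|[|n]]; first by rewrite deg.
    by rewrite deg //=; lia.
  by rewrite -mulwE; apply: Qw.
case: n => [|n]; first by rewrite deg.
by rewrite -mulxE; apply: Qx.
Qed.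

Section Pulling.
Variables (A B : zmodType) (cycA : cyc_built A) (cycB : cyc_built B).
Variable h : {additive A -> B}.

Lemma realize_pull n r :
  realize cycA n (pull h n r) = coho_map 'F_2 h n (realize cycB n r).
Proof.
elim/alg_ind: r => [|c r s Hr Hs|t u]; first by rewrite pullr0 !linear0.
  by rewrite pullD pullZ !linearP Hr Hs.
rewrite pullE !realizeE cls_map; last exact: mono_coc.
apply/esym/cls_cohom; last exact: mono_pullback.
by move=> s; rewrite delta_pullback mono_coc.
Qed.

Lemma represents_pull n r F :
  represents cycB r F -> represents cycA (pull h n r) (pullback h F).
Proof.
move=> [cF hF rF]; split; [|exact: pullback_homogeneous|].
  by move=> s; rewrite delta_pullback cF.
by rewrite realize_pull rF cls_map.
Qed.
End Pulling.

Lemma pull_cancel (A B : zmodType) (f : {additive A -> B}) (g : {additive B -> A}) n r :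
  cancel g f -> pull g n (pull f n r) = r.
Proof.
move=> gf; elim/alg_ind: r => [|c r s Hr Hs|t u]; first by rewrite !pullr0.
  by rewrite !(pullD, pullZ) Hr Hs.
rewrite !pullE /pull_gen -!map_comp; congr gen; rewrite -[RHS]map_id; apply: eq_map => x.
  apply: val_inj; apply/funext => a; rewrite -[a]mod2_reprK /= !mod2_mapE.
  by rewrite /= gf.
by apply: val_inj; apply/funext => a; congr (dual_val x _); apply: val_inj; rewrite /= gf.
Qed.

Definition realize_inj (A : zmodType) n := forall (cycA : cyc_built A) (r : alg n A) F,
  represents cycA r F -> cob F -> r = 0.
Definition realize_surj (A : zmodType) n := forall (cycA : cyc_built A) (F : seq A -> 'F_2),
  coc F -> homogeneous n F -> exists r : alg n A, represents cycA r F.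

Lemma eq_represents (A : zmodType) (cycA : cyc_built A) n (r : alg n A) F H :
  (forall s, F s = H s) -> represents cycA r F -> represents cycA r H.
Proof.
move=> FH rF; apply: represents_cohom (rF) _ _; first by case: rF => _ hF _ s sn; rewrite -FH hF.
by apply: eq_cob (cohom_refl F) => s; rewrite [in RHS]FH -FH.
Qed.

Lemma represents0 (A : zmodType) (cycA : cyc_built A) n : represents cycA (0 : alg n A) (fun=> 0).
Proof.
split=> //; first exact: coc0.
by rewrite linear0 cob_cls //; exists (fun=> 0) => s; rewrite delta0.
Qed.

Lemma represents_homogeneous (A : zmodType) (cycA : cyc_built A) n (r : alg n A) F :
  represents cycA r F -> homogeneous n F.
Proof. by case. Qed.

Lemma represents_cob (A : zmodType) (cycA : cyc_built A) n (r : alg n A) F H :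
  represents cycA r F -> represents cycA r H -> cob F -> cob H.
Proof.
move=> rF rH bF; apply: eq_cob (cobD (represents_uniq rF rH) bF) => s; F2.
Qed.

Section Degree0.
Variable A : zmodType.

Lemma alg0P (r : alg 0 A) : exists c, r = c *: gen 0 [::] [::].
Proof.
elim/alg_ind: r => [|c _ _ [a ->] [b ->]|[|x t] [|w u]].
- by exists 0; rewrite scale0r.
- by exists (c * a + b); rewrite scalerDl scalerA.
- by exists 1; rewrite scale1r.
- by exists 0; rewrite scale0r; apply: (compat_deg (gen_compat 0 A)).
- by exists 0; rewrite scale0r; apply: (compat_deg (gen_compat 0 A)).
- by exists 0; rewrite scale0r; apply: (compat_deg (gen_compat 0 A)).
Qed.

Lemma represents_scale_unit (cycA : cyc_built A) c :
  represents cycA (c *: gen 0 [::] [::]) (fun s => c * unit_cochain s).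
Proof.
have := represents_lin c (represents_gen cycA (t := [::]) (u := [::]) erefl)
  (represents0 cycA 0).
by rewrite addr0; apply: eq_represents => s; rewrite addr0.
Qed.

Lemma realize_inj0 : realize_inj A 0.
Proof.
move=> cycA r F rF bF; have [c rc] := alg0P r; move: rF; rewrite rc => rF.
have [k /(_ [::])] := represents_cob rF (represents_scale_unit cycA c) bF.
by rewrite /unit_cochain /= mulr1 => ->; rewrite scale0r.
Qed.

Lemma realize_surj0 : realize_surj A 0.
Proof.
move=> cycA F cF hF; exists (F [::] *: gen 0 [::] [::]).
apply: eq_represents (represents_scale_unit cycA _) => -[|g s].
  by rewrite /unit_cochain mulr1.
by rewrite /unit_cochain /= mulr0 hF.
Qed.
End Degree0.

(** [f] after [g] is the identity, so [B] is a retract of [A]: pulling back along [f] and then along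
    [g] is the identity on the algebra and on cochains, and both properties descend. *)
Lemma realize_iso (A B : zmodType) (f : {additive A -> B}) (g : {additive B -> A}) n :
  cyc_built A -> cancel g f -> realize_inj A n /\ realize_surj A n ->
  realize_inj B n /\ realize_surj B n.
Proof.
move=> cycA gf [injA surjA]; split=> cycB.
  move=> r F rF [k Fk]; rewrite -(pull_cancel r gf).
  rewrite (injA cycA (pull f n r) (pullback f F)) ?pullr0 //; first exact: represents_pull.
  by exists (pullback f k) => s; rewrite delta_pullback -Fk.
move=> F cF hF; have [||r rF] := surjA cycA (pullback f F).
- by move=> s; rewrite delta_pullback cF.
- exact: pullback_homogeneous.
exists (pull g n r); apply: eq_represents (represents_pull cycB g rF) => s.
by rewrite /pullback -map_comp (eq_map (g := id)) ?map_id.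
Qed.

Lemma realize_trivial (A : zmodType) n : (forall a : A, a = 0) ->
  realize_inj A n /\ realize_surj A n.
Proof.
move=> A0; case: n => [|n]; first by split; [exact: realize_inj0 | exact: realize_surj0].
pose Q m (r : alg m A) := if m is 0 then True else r = 0.
have alg_0 m (r : alg m A) : Q m r.
  have x0 (x : mod2V A) : x = 0.
    apply: val_inj; apply/funext => a.
    have -> : a = 0 by rewrite -[a]mod2_reprK (A0 (mod2_repr a)) raddf0.
    exact: dual0.
  have w0 (w : tors2V A) : w = 0.
    apply: val_inj; apply/funext => a.
    have -> : a = 0 by apply/val_inj/A0.
    exact: dual0.
  apply: (alg_build (Q := Q)) => {m r} [[]|[|m] c r s|//|m x r _|m w r _] //.
  - by move=> -> ->; rewrite scaler0 addr0.
  - have := mulx_lin 1 0 0 r; rewrite (x0 x) !scale1r addr0 -[X in X = _]addr0.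
    by move=> /addrI <-.
  - have := mulw_lin 1 0 0 r; rewrite (w0 w) !scale1r addr0 -[X in X = _]addr0.
    by move=> /addrI <-.
split=> cycA; first by move=> r *; exact: (alg_0 n.+1).
move=> F cF hF; exists 0; apply: (represents_cohom (represents0 cycA _) hF).
(* A contraction: the cocycle identity at [[:: 0, g & s]] says that the inner faces of this cochain
   sum to 0, which leaves [F (0 :: s)]. *)
exists (fun l => F (0 :: l)) => -[|g s].
  by rewrite add0r hF.
have := cF [:: 0, g & s]; rewrite /= (A0 g) addr0 add0r => e.
by rewrite /= -[LHS]addr0 -e; F2.
Qed.

Section DualOfMod2.
Variables (C : zmodType) (f : {additive C -> 'F_2}).

Definition mod2_form_fun (z : mod2 C) : ('F_2)^o := f (mod2_repr z).

Lemma mod2_formE a : mod2_form_fun (mod2_pi a) = f a.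
Proof.
have /mod2_pi_eq[c e] := mod2_reprK (mod2_pi a).
by apply/eqP; rewrite -subr_eq0 -raddfB e raddfMn mulr2n F2dbl.
Qed.

Lemma mod2_form_linear : mod2_form_fun \in linform (V := mod2 C).
Proof.
apply/asboolP; apply: (@zmod_F2linear (mod2 C) ('F_2)^o
  (HB.pack mod2_form_fun (GRing.isZmodMorphism.Build _ _ mod2_form_fun _))) => y z.
by rewrite -[y]mod2_reprK -[z]mod2_reprK -raddfB !mod2_formE raddfB.
Qed.

Definition mod2_form : mod2V C := Dual mod2_form_linear.
End DualOfMod2.

(** * Splitting the algebra of a product with a cyclic factor *)

Section Product.
Variables (A C : zmodType).
Let G : zmodType := (A * C)%type.
Let i : {additive A -> G} := @inl0 A C.
Let j : {additive C -> G} := @inr0 A C.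
Let p : {additive G -> A} := fst.
Let q : {additive G -> C} := snd.

Lemma prod_split (g : G) : g = i (p g) + j (q g).
Proof. by case: g => a c; rewrite -[RHS]/(a + 0, 0 + c) addr0 add0r. Qed.

Lemma mod2V_split (x : mod2V G) :
  x = dual_map (mod2_map p) (dual_map (mod2_map i) x)
    + dual_map (mod2_map q) (dual_map (mod2_map j) x).
Proof.
apply: val_inj; apply/funext => a; rewrite -[a]mod2_reprK.
transitivity (x (mod2_map i (mod2_map p (mod2_pi (mod2_repr a)))) +
  x (mod2_map j (mod2_map q (mod2_pi (mod2_repr a))))) => //.
rewrite -dualD /= !mod2_mapE -raddfD; congr (dual_val x (mod2_pi _)).
exact: prod_split.
Qed.

Lemma tors2V_split (w : tors2V G) :
  w = dual_map (tors2_map p) (dual_map (tors2_map i) w)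
    + dual_map (tors2_map q) (dual_map (tors2_map j) w).
Proof.
apply: val_inj; apply/funext => a.
transitivity (w (tors2_map i (tors2_map p a)) + w (tors2_map j (tors2_map q a))) => //.
rewrite -dualD; congr (dual_val w _); apply: val_inj; exact: prod_split.
Qed.

Section Odd.
Hypothesis C1 : forall x : mod2V C, x = 0.
Hypothesis C2 : forall w : tors2V C, w = 0.

Lemma alg_split_odd n (r : alg n G) : exists r0, r = pull p n r0.
Proof.
pose Q n (r : alg n G) := exists r0, r = pull p n r0.
apply: (alg_build (Q := Q)) => {n r} [n|n c _ _ [r ->] [s ->]||n x _ [r ->]|n w _ [r ->]].
- by exists 0; rewrite pullr0.
- by exists (c *: r + s); rewrite pullD pullZ.
- by exists (gen 0 [::] [::]); rewrite pullE.
- exists (mulx n (dual_map (mod2_map i) x) r).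
  by rewrite pull_mulx [in LHS](mod2V_split x) (C1 (dual_map _ x)) linear0 addr0.
- exists (mulw n (dual_map (tors2_map i) w) r).
  by rewrite pull_mulw [in LHS](tors2V_split w) (C2 (dual_map _ w)) linear0 addr0.
Qed.
End Odd.

Variable tau : mod2V C.
Hypothesis C1 : forall x : mod2V C, exists c, x = c *: tau.
Let tauG : mod2V G := dual_map (mod2_map q) tau.

Lemma mulx_split x : exists c, forall n r, mulx n x (A := G) r =
  mulx n (dual_map (mod2_map p) (dual_map (mod2_map i) x)) r + c *: mulx n tauG r.
Proof.
have [c cE] := C1 (dual_map (mod2_map j) x); exists c => n r.
by rewrite {1}(mod2V_split x) cE linearZ addrC mulx_lin addrC.
Qed.

Section Infinite.
Hypothesis C2 : forall w : tors2V C, w = 0.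

Lemma mulw_split0 n w r :
  mulw n w (A := G) r = mulw n (dual_map (tors2_map p) (dual_map (tors2_map i) w)) r.
Proof.
by rewrite {1}(tors2V_split w) (C2 (dual_map _ w)) linear0 addr0.
Qed.

Lemma mulw0 n (B : zmodType) (r : alg n B) : mulw n 0 r = 0.
Proof.
have := mulw_lin 1 0 0 r; rewrite !scale1r addr0 -[X in X = _]addr0.
by move=> /addrI <-.
Qed.

(** These elements, together with the pullbacks in degree 0, are stable under all multiplications:
    the square of [tauG] is b(tau), a form on the 2-torsion that vanishes on [A] and, by [C2], on
    [C]. *)
Lemma alg_split_int n (r : alg n.+1 G) :
  exists r0 r1, r = pull p n.+1 r0 + mulx n tauG (pull p n r1).
Proof.
pose Q m : alg m G -> Prop := match m with
  | 0 => fun r => exists r0, r = pull p 0 r0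
  | m.+1 => fun r => exists r0 r1, r = pull p m.+1 r0 + mulx m tauG (pull p m r1) end.
suff: Q n.+1 r by [].
have tau2 m (s : alg m G) : mulx m.+1 tauG (mulx m tauG s) = 0.
  rewrite mulx_sq -/tauG mulw_split0.
  have -> : dual_map (tors2_map i) (betaV G tauG) = 0.
    apply: val_inj; apply/funext => a; rewrite /= /beta_fun /=.
    by rewrite mod2_mapE raddf0 dual0.
  by rewrite linear0 mulw0.
apply: (alg_build (Q := Q)) => {n r}.
- by case=> [|n]; [exists 0 | exists 0, 0]; rewrite ?(pullr0, mulxr0) ?addr0.
- case=> [|n] c r s; first by move=> [r0 ->] [s0 ->]; exists (c *: r0 + s0); rewrite pullD pullZ.
  move=> [r0 [r1 ->]] [s0 [s1 ->]]; exists (c *: r0 + s0), (c *: r1 + s1).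
  by rewrite !(mulxD, pullD, mulxZ, pullZ) scalerDr addrACA.
- by exists (gen 0 [::] [::]); rewrite pullE.
- move=> n x r Hr; have [c ->] := mulx_split x.
  set y := dual_map (mod2_map i) x; case: n r Hr => [|n] r.
    by move=> [r0 ->]; exists (mulx 0 y r0), (c *: r0); rewrite pull_mulx pullZ mulxZ.
  move=> [r0 [r1 ->]]; exists (mulx n.+1 y r0), (mulx n y r1 + c *: r0).
  rewrite !(mulxD, pullD, mulxZ, pullZ, pull_mulx) tau2 addr0 -!addrA.
  by rewrite (mulx_mulx _ tauG).
- move=> n w r Hr; rewrite mulw_split0; set v := dual_map (tors2_map i) w.
  case: n r Hr => [|n] r.
    by move=> [r0 ->]; exists (mulw 0 v r0), 0; rewrite pull_mulw pullr0 mulxr0 addr0.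
  move=> [r0 [r1 ->]]; exists (mulw n.+1 v r0), (mulw n v r1).
  by rewrite !pull_mulw mulwD mulx_mulw.
Qed.
End Infinite.

Section Even.
Variable omega : tors2V C.
Hypothesis C2 : forall w : tors2V C, exists c, w = c *: omega.
Let omegaG : tors2V G := dual_map (tors2_map q) omega.

Lemma mulw_split w : exists c, forall n r, mulw n w (A := G) r =
  mulw n (dual_map (tors2_map p) (dual_map (tors2_map i) w)) r + c *: mulw n omegaG r.
Proof.
have [c cE] := C2 (dual_map (tors2_map j) w); exists c => n r.
by rewrite {1}(tors2V_split w) cE linearZ addrC mulw_lin addrC.
Qed.

Definition split_even n : alg n G -> Prop :=
  match n with
  | 0 => fun r => exists r0, r = pull p 0 r0
  | 1 => fun r => exists r0 r1, r = pull p 1 r0 + mulx 0 tauG (pull p 0 r1)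
  | m.+2 => fun r => exists r0 r1 r2,
      r = pull p m.+2 r0 + mulx m.+1 tauG (pull p m.+1 r1) + mulw m omegaG r2
  end.

(** The square of [tauG] is a multiple of [omegaG], as b(tau) vanishes on [A]. Since [r2] ranges
    over the algebra of the whole product, any multiple of [omegaG] is absorbed there without being
    split again. *)
Lemma alg_split_even n (r : alg n G) : split_even r.
Proof.
have [d tau2] : exists d, forall m (s : alg m G),
    mulx m.+1 tauG (mulx m tauG s) = d *: mulw m omegaG s.
  have [d dE] := mulw_split (betaV G tauG); exists d => m s.
  rewrite mulx_sq dE.
  have -> : dual_map (tors2_map i) (betaV G tauG) = 0.
    apply: val_inj; apply/funext => a; rewrite /= /beta_fun /=.
    by rewrite mod2_mapE raddf0 dual0.
  by rewrite linear0 mulw0 add0r.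
apply: (alg_build (Q := split_even)) => {n r}.
- by case=> [|[|n]]; [exists 0 | exists 0, 0 | exists 0, 0, 0]; rewrite ?(pullr0, mulxr0, mulwr0) ?addr0.
- case=> [|[|n]] c r s.
  + by move=> [r0 ->] [s0 ->]; exists (c *: r0 + s0); rewrite pullD pullZ.
  + move=> [r0 [r1 ->]] [s0 [s1 ->]]; exists (c *: r0 + s0), (c *: r1 + s1).
    by rewrite !(mulxD, pullD, mulxZ, pullZ) scalerDr addrACA.
  + move=> [r0 [r1 [r2 ->]]] [s0 [s1 [s2 ->]]].
    exists (c *: r0 + s0), (c *: r1 + s1), (c *: r2 + s2).
    rewrite !(mulxD, pullD, mulxZ, pullZ, mulwD, mulwZ) !scalerDr.
    by rewrite addrACA; congr (_ + _); rewrite addrACA.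
- by exists (gen 0 [::] [::]); rewrite pullE.
- move=> n x r Hr; have [c xE] := mulx_split x.
  set y := dual_map (mod2_map i) x; case: n r Hr => [|[|n]] r.
  + by move=> [r0 ->]; rewrite xE; exists (mulx 0 y r0), (c *: r0); rewrite pull_mulx pullZ mulxZ.
  + move=> [r0 [r1 rE]]; rewrite xE.
    exists (mulx 1 y r0), (mulx 0 y r1 + c *: r0), (c *: (d *: pull p 0 r1)).
    rewrite rE !(mulxD, pullD, mulxZ, pullZ, pull_mulx, mulwD, mulwZ) tau2 scalerDr -!addrA.
    by rewrite (mulx_mulx _ tauG).
  + move=> [r0 [r1 [r2 rE]]].
    exists (mulx n.+2 y r0), (mulx n.+1 y r1 + c *: r0).
    exists (c *: (d *: pull p n.+1 r1) + mulx n x r2).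
    rewrite rE [LHS]mulxD mulx_mulw xE -/y.
    rewrite !(mulxD, pullD, mulxZ, pullZ, pull_mulx, mulwD, mulwZ) tau2 scalerDr.
    by rewrite (mulx_mulx _ tauG) !addrA.
- move=> n w r Hr; have [c ->] := mulw_split w; set v := dual_map (tors2_map i) w.
  case: n r Hr => [|[|n]] r.
  + move=> [r0 ->]; exists (mulw 0 v r0), 0, (c *: pull p 0 r0).
    by rewrite !(pull_mulw, mulwZ) pullr0 mulxr0 addr0.
  + move=> [r0 [r1 rE]]; exists (mulw 1 v r0), (mulw 0 v r1), (c *: r).
    by rewrite [in X in X + _]rE !(pull_mulw, mulwZ, mulwD) mulx_mulw.
  + move=> [r0 [r1 [r2 rE]]]; exists (mulw n.+2 v r0), (mulw n.+1 v r1).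
    exists (mulw n (dual_map (tors2_map p) v) r2 + c *: r).
    rewrite [in X in X + _]rE !(pull_mulw, mulwZ, mulwD) mulx_mulw.
    by rewrite (mulw_mulw omegaG) addrA.
Qed.
End Even.
End Product.

(** * Bijectivity of the realization for products with cyclic groups *)

Lemma mod2V_eq (C : zmodType) (x y : mod2V C) : (forall a, xchar x a = xchar y a) -> x = y.
Proof.
by move=> xy; apply: val_inj; apply/funext => a; rewrite -[a]mod2_reprK; apply: xy.
Qed.

Lemma xcharD (C : zmodType) (x : mod2V C) a b : xchar x (a + b) = xchar x a + xchar x b.
Proof. exact: xchar_linear. Qed.

Lemma xchar0 (C : zmodType) (x : mod2V C) : xchar x 0 = 0.
Proof. by rewrite /xchar raddf0 dual0. Qed.

Lemma xcharZ (C : zmodType) c (x : mod2V C) a : xchar (c *: x) a = c * xchar x a.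
Proof. by []. Qed.

Lemma xchar_form (C : zmodType) (f : {additive C -> 'F_2}) a : xchar (mod2_form f) a = f a.
Proof. exact: mod2_formE. Qed.

Lemma xcharMn (C : zmodType) (x : mod2V C) a n : xchar x (a *+ n) = n%:R * xchar x a.
Proof.
elim: n => [|n IH]; first by rewrite mulr0n xchar0 mul0r.
by rewrite mulrS xcharD IH -{1}[xchar x a]mul1r -mulrDl -mulrS.
Qed.

Lemma xop_cochain (A C : zmodType) (f : {additive C -> 'F_2}) F s :
  xop (A := (A * C)%type) (dual_map (mod2_map snd) (mod2_form f)) F s = lcup 1 (degree1 f) F s.
Proof.
apply: eq_lcup_size => -[|g []] // _.
by rewrite /chain1 /degree1 /xchar /= mod2_mapE mod2_formE.
Qed.

Section ProductRealization.
Variables (A C : zmodType) (cycA : cyc_built A).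
Let G : zmodType := (A * C)%type.
Let p : {additive G -> A} := fst.
Variables (f : {additive C -> 'F_2}) (cycG : cyc_built G).
Let tauG : mod2V G := dual_map (mod2_map snd) (mod2_form f).

Lemma represents_product n (r0 : alg n.+1 A) (r1 : alg n A) F0 F1 :
  represents cycA r0 F0 -> represents cycA r1 F1 ->
  represents cycG (pull p n.+1 r0 + mulx n tauG (pull p n r1))
    (fun s => pullback p F0 s + lcup 1 (degree1 f) (pullback p F1) s).
Proof.
move=> rF0 rF1.
have := represents_lin 1 (represents_pull cycG p rF0)
  (represents_mulx tauG (represents_pull cycG p rF1)).
by rewrite scale1r; apply: eq_represents => s; rewrite mul1r xop_cochain.
Qed.
End ProductRealization.

Lemma realize_odd (A C : zmodType) (e : seq C) n : cyc_built A ->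
  (forall x, perm_eq [seq c + x | c <- e] e) -> (size e)%:R = 1 :> 'F_2 ->
  (forall x : mod2V C, x = 0) -> (forall w : tors2V C, w = 0) ->
  realize_inj A n /\ realize_surj A n ->
  realize_inj (A * C)%type n /\ realize_surj (A * C)%type n.
Proof.
move=> cycA e_shift e1 C1 C2 [injA surjA]; split=> cycG.
  move=> r F rF bF; have [r0 rE] := alg_split_odd C1 C2 r.
  have [F0 [rF0 _ _]] := represents_std cycA r0; move: rF; rewrite rE => rF.
  have := represents_cob rF (represents_pull cycG fst rF0) bF.
  by move=> /cob_proj /(injA _ _ _ rF0) ->; rewrite pullr0.
move=> F cF hF; have [F0 cF0 FF0] := kunneth_odd_surj e_shift e1 cF.
have [r0 rF0] := surjA cycA (trunc n F0) (coc_trunc n cF0) (@trunc_homogeneous _ n F0).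
exists (pull fst n r0); apply: (represents_cohom (represents_pull cycG fst rF0) hF).
apply/cohom_sym/(cob_trunc FF0 (n := n)).
  by move=> s sn; rewrite hF // /pullback trunc_homogeneous ?size_map ?addr0.
by move=> s sn; rewrite /pullback /trunc size_map sn eqxx.
Qed.

Lemma int_mod2V (x : mod2V int) : exists c, x = c *: mod2_form int_parityA.
Proof.
exists (xchar x 1); apply: mod2V_eq => a.
rewrite xcharZ xchar_form.
elim/int_step_ind: a => [|a]; first by rewrite xchar0 raddf0 mulr0.
have p1 : int_parityA 1 = 1 by rewrite /= /int_parity mulr1z.
rewrite xcharD raddfD p1 mulrDr mulr1.
by split=> [->//|/addIr].
Qed.

Lemma int_tors2V (w : tors2V int) : w = 0.
Proof.
apply: val_inj; apply/funext => a; have -> : a = 0 by apply/val_inj/int_tors/tors2_add0.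
exact: dual0.
Qed.

(** The algebra splits as [r0 + tau r1] and the cocycles as [f0 + e1 f1], so the components are
    compared on [A], in the same degree and in the one below. *)
Lemma realize_int (A : zmodType) : cyc_built A ->
  (forall n, realize_inj A n /\ realize_surj A n) ->
  forall n, realize_inj (A * int)%type n /\ realize_surj (A * int)%type n.
Proof.
move=> cycA IH [|n]; first by split; [exact: realize_inj0 | exact: realize_surj0].
have par1 : int_parityA 1 = 1 by rewrite /= /int_parity mulr1z.
split=> cycG.
  move=> r F rF bF; have [r0 [r1 rE]] := alg_split_int int_mod2V int_tors2V r.
  have [F0 [rF0 _ _]] := represents_std cycA r0.
  have [F1 [rF1 _ _]] := represents_std cycA r1; move: rF; rewrite rE => rF.
  have := represents_cob rF (represents_product int_parityA cycG rF0 rF1) bF.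
  have [c0 _ _] := rF0; have [c1 _ _] := rF1.
  move=> /(kunneth_infinite_inj par1 c0 c1)[b0 b1].
  by rewrite ((IH n.+1).1 _ _ _ rF0 b0) ((IH n).1 _ _ _ rF1 b1) !pullr0 mulxr0 addr0.
move=> F cF hF.
have antidiff (g : int -> 'F_2) : exists k, forall c, k (c + 1) + k c = g c.
  by have [k [_ kE]] := int_antidiff g; exists k.
have [F0 [F1 [c0 c1 FE]]] := kunneth_infinite_surj par1 int_step_inv antidiff cF.
have [r0 rF0] := (IH n.+1).2 cycA _ (coc_trunc n.+1 c0) (@trunc_homogeneous _ n.+1 F0).
have [r1 rF1] := (IH n).2 cycA _ (coc_trunc n c1) (@trunc_homogeneous _ n F1).
have rF := represents_product int_parityA cycG rF0 rF1.
eexists; apply: (represents_cohom rF hF).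
apply/cohom_sym/(cob_trunc FE (n := n.+1)).
  move=> s sn; rewrite hF // /pullback trunc_homogeneous ?size_map //.
  rewrite (@lcup_homogeneous _ 1 _ n) ?addr0 //.
  by apply: pullback_homogeneous; apply: trunc_homogeneous.
move=> s sn; rewrite addrA /pullback {1}/trunc size_map sn eqxx; congr (_ + _).
case: s sn => // g s [sn]; by rewrite /= /trunc size_map sn eqxx.
Qed.

Section OrdinalDuals.
Variable m : nat.

(** The parity is that of [m], so the order m + 1 is odd: multiplying [x a] by it gives [x a] on the
    one hand and x(0) = 0 on the other. *)
Lemma ord_mod2V_even (x : mod2V 'I_m.+1) : ~~ odd m -> x = 0.
Proof.
move=> m_even; apply: mod2V_eq => a.
have am : a *+ m.+1 = 0.
  apply: (@ord_step_ind m (fun a => a *+ m.+1 = 0)) a => [|a IH]; first by rewrite mul0rn.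
  rewrite mulrnDl IH add0r; have stepE k : ord_step m *+ k = inZp k.
    by elim: k => [|k IHk]; [rewrite mulr0n inZp_0 | rewrite mulrSr IHk inZpS].
  by rewrite stepE; apply: ord_inj; rewrite /= modnn.
have := xcharMn x a m.+1; rewrite am xchar0 F2_natr /= m_even mul1r => <-.
by rewrite /xchar.
Qed.

Lemma ord_tors2V_even (w : tors2V 'I_m.+1) : ~~ odd m -> w = 0.
Proof.
move=> m_even; apply: val_inj; apply/funext => a.
have -> : a = 0 by apply/val_inj/(ord_tors_odd m_even)/tors2_add0.
exact: dual0.
Qed.

Hypothesis m_odd : odd m.

Lemma ord_mod2V (x : mod2V 'I_m.+1) : exists c, x = c *: mod2_form (ord_parityA m_odd).
Proof.
exists (xchar x (ord_step m)); apply: mod2V_eq => a.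
rewrite xcharZ xchar_form.
apply: (@ord_step_ind m (fun a => xchar x a = _ * _ a)) a => [|a IH].
  by rewrite xchar0 raddf0 mulr0.
by rewrite xcharD raddfD (ord_parity_step m_odd : ord_parityA m_odd _ = 1) mulrDr mulr1 -IH.
Qed.

Lemma ord_half_tors : ord_half m \in two_tors (A := 'I_m.+1).
Proof. by apply/eqP/ord_half2. Qed.

Definition ord_carry_form_fun (a : tors2 'I_m.+1) : ('F_2)^o := ord_carry (val a) (val a).

Lemma tors2_ordP (a : tors2 'I_m.+1) : a = 0 \/ a = Tors2 ord_half_tors.
Proof. by case: (ord_tors m_odd (tors2_add0 a)) => e; [left | right]; apply: val_inj. Qed.

Lemma ord_carry_form_linear : ord_carry_form_fun \in linform (V := tors2 'I_m.+1).
Proof.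
have o0 : ord_carry_form_fun 0 = 0 by exact: ord_carry00.
have oh : ord_carry_form_fun (Tors2 ord_half_tors) = 1 by exact: ord_carry_half.
have oD : {morph ord_carry_form_fun : a b / a + b}.
  move=> a b; case: (tors2_ordP a) => ->; first by rewrite add0r o0 add0r.
  case: (tors2_ordP b) => ->; first by rewrite addr0 o0 addr0.
  by rewrite oh -mulr2n tors2_2 o0 (F2dbl 1).
apply/asboolP; apply: (@zmod_F2linear (tors2 'I_m.+1) ('F_2)^o
  (HB.pack ord_carry_form_fun (GRing.isZmodMorphism.Build _ _ ord_carry_form_fun _))) => a b.
have := oD (a - b) b; rewrite subrK => ->.
by rewrite addrK.
Qed.

Definition ord_carry_form : tors2V 'I_m.+1 := Dual ord_carry_form_linear.

Lemma ord_tors2V (w : tors2V 'I_m.+1) : exists c, w = c *: ord_carry_form.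
Proof.
exists (w (Tors2 ord_half_tors)); apply: val_inj; apply/funext => a.
rewrite -[LHS]/(w a) -[RHS]/(w (Tors2 ord_half_tors) * ord_carry (val a) (val a)).
case: (tors2_ordP a) => ->; first by rewrite dual0 ord_carry00 mulr0.
by rewrite /= ord_carry_half // mulr1.
Qed.
End OrdinalDuals.

Section EvenOrder.
Variables (A : zmodType) (m : nat).
Hypotheses (cycA : cyc_built A) (m_odd : odd m).
Let G : zmodType := (A * 'I_m.+1)%type.
Let p : {additive G -> A} := fst.
Let f := ord_parityA m_odd.
Let tauG : mod2V G := dual_map (mod2_map snd) (mod2_form f).
Let omegaG : tors2V G := dual_map (tors2_map snd) (ord_carry_form m_odd).

(** The carry cocycle, pulled back to the product, is an abelian factor set with diagonal
    [omegaG]. *)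
Lemma wop_carry (cycG : cyc_built G) F : coc F ->
  cohom (lcup 2 (degree2 (@ord_carry m)) F) (wop omegaG F).
Proof.
move=> cF; apply: (wop_uniq cycG (c := fun g h => ord_carry g.2 h.2)) => //.
exact: (abelian_cocycle_comp snd (ord_carry_abelian m)).
Qed.

Lemma represents_even (cycG : cyc_built G) n (r0 : alg n.+2 A) (r1 : alg n.+1 A) (r2 : alg n G)
    F0 F1 F2 :
  represents cycA r0 F0 -> represents cycA r1 F1 -> represents cycG r2 F2 ->
  represents cycG (pull p n.+2 r0 + mulx n.+1 tauG (pull p n.+1 r1) + mulw n omegaG r2)
    (fun s => pullback p F0 s + lcup 1 (degree1 f) (pullback p F1) s
      + lcup 2 (degree2 (@ord_carry m)) F2 s).
Proof.
move=> rF0 rF1 rF2.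
have := represents_lin 1 (represents_product f cycG rF0 rF1) (represents_mulw omegaG rF2).
rewrite scale1r => rF; apply: represents_cohom rF _ _.
  move=> s sn; rewrite (represents_homogeneous (represents_product f cycG rF0 rF1)) //.
  by rewrite (@lcup_homogeneous _ 2 _ n) ?addr0 //; exact: (represents_homogeneous rF2).
have [c2 _ _] := rF2; apply: eq_cob (cohom_sym (wop_carry cycG c2)) => s.
by F2.
Qed.

Let kappa0 := @ord_carry00 m.
Let antidiff (g : 'I_m.+1 -> 'F_2) : \sum_(c <- enum 'I_m.+1) g c = 0 ->
  exists k, forall c, k (c + ord_step m) + k c = g c.
Proof. by move=> /ord_antidiff[k [_ kE]]; exists k. Qed.
Let e_even : (size (enum 'I_m.+1))%:R = 0 :> 'F_2.
Proof. by rewrite size_enum_F2 m_odd. Qed.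

Let even_inj := @kunneth_even_inj A _ (ord_step m) f (ord_parity_step m_odd)
  (enum 'I_m.+1) (@ord_enum_shift m) e_even (@ord_carry m) (@ord_last m) kappa0
  (@ord_carry_cocycle m) (@ord_last_sum m) (@ord_carry_last m).
Let even_surj := @kunneth_even_surj A _ (ord_step m) f (ord_parity_step m_odd)
  (@ord_step_inv m) (enum 'I_m.+1) (@ord_enum_shift m) e_even antidiff (@ord_carry m) (@ord_last m)
  (@ord_carry_cocycle m) (@ord_last_sum m) (@ord_carry_last m).

(** Lists of length 1 are too short for [lcup 2], so the third component is taken to be 0 for
    injectivity and dropped for surjectivity. *)
Lemma realize_even1 : (forall n, realize_inj A n /\ realize_surj A n) ->
  realize_inj G 1 /\ realize_surj G 1.
Proof.
move=> IH; split=> cycG.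
  move=> r F rF bF.
  have [r0 [r1 rE]] := alg_split_even (ord_mod2V m_odd) (ord_tors2V m_odd) r.
  have [F0 [rF0 _ _]] := represents_std cycA r0.
  have [F1 [rF1 _ _]] := represents_std cycA r1; move: rF; rewrite rE => rF.
  have b := represents_cob rF (represents_product f cycG rF0 rF1) bF.
  have [c0 _ _] := rF0; have [c1 _ _] := rF1.
  have [|b0 b1 _] := even_inj c0 c1 (@coc0 G).
    by apply: eq_cob b => s; rewrite lcup0r addr0.
  by rewrite ((IH 1%N).1 _ _ _ rF0 b0) ((IH 0%N).1 _ _ _ rF1 b1) !pullr0 mulxr0 addr0.
move=> F cF hF; have [F0 [F1 [F2 [c0 c1 c2 FE]]]] := even_surj cF.
have [r0 rF0] := (IH 1%N).2 cycA _ (coc_trunc 1 c0) (@trunc_homogeneous _ 1 F0).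
have [r1 rF1] := (IH 0%N).2 cycA _ (coc_trunc 0 c1) (@trunc_homogeneous _ 0 F1).
have rF := represents_product f cycG rF0 rF1.
eexists; apply: (represents_cohom rF hF).
apply/cohom_sym/(cob_trunc FE (n := 1)).
  by move=> s sn; rewrite hF // (represents_homogeneous rF) // addr0.
move=> [|g []] // _; rewrite [lcup 2 _ _ _]/= addr0 addrA; congr (_ + _).
Qed.

(** The third component is a cocycle of [G] itself in degree [n]; hence the hypothesis on [G] two
    degrees lower, next to that on [A] in all degrees. *)
Lemma realize_even2 n : (forall n, realize_inj A n /\ realize_surj A n) ->
  realize_inj G n /\ realize_surj G n -> realize_inj G n.+2 /\ realize_surj G n.+2.
Proof.
move=> IH IHG; split=> cycG.
  move=> r F rF bF.
  have [r0 [r1 [r2 rE]]] := alg_split_even (ord_mod2V m_odd) (ord_tors2V m_odd) r.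
  have [F0 [rF0 _ _]] := represents_std cycA r0.
  have [F1 [rF1 _ _]] := represents_std cycA r1.
  have [F2 [rF2 _ _]] := represents_std cycG r2; move: rF; rewrite rE => rF.
  have b := represents_cob rF (represents_even rF0 rF1 rF2) bF.
  have [c0 _ _] := rF0; have [c1 _ _] := rF1; have [c2 _ _] := rF2.
  have [b0 b1 b2] := even_inj c0 c1 c2 b.
  rewrite ((IH n.+2).1 _ _ _ rF0 b0) ((IH n.+1).1 _ _ _ rF1 b1) (IHG.1 _ _ _ rF2 b2).
  by rewrite !pullr0 mulxr0 mulwr0 !addr0.
move=> F cF hF; have [F0 [F1 [F2 [c0 c1 c2 FE]]]] := even_surj cF.
have [r0 rF0] := (IH n.+2).2 cycA _ (coc_trunc n.+2 c0) (@trunc_homogeneous _ n.+2 F0).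
have [r1 rF1] := (IH n.+1).2 cycA _ (coc_trunc n.+1 c1) (@trunc_homogeneous _ n.+1 F1).
have [r2 rF2] := IHG.2 cycG _ (coc_trunc n c2) (@trunc_homogeneous _ n F2).
have rF := represents_even rF0 rF1 rF2.
eexists; apply: (represents_cohom rF hF).
apply/cohom_sym/(cob_trunc FE (n := n.+2)).
  by move=> s sn; rewrite hF // (represents_homogeneous rF) // addr0.
move=> s sn; rewrite !addrA; congr (_ + _ + _ + _).
- by rewrite /pullback /trunc size_map sn eqxx.
- by case: s sn => // g s [sn]; rewrite /= /pullback /trunc size_map sn eqxx.
- by case: s sn => // g [|h s] // [sn]; rewrite /= /trunc sn eqxx.
Qed.

Lemma realize_even : (forall n, realize_inj A n /\ realize_surj A n) ->
  forall n, realize_inj G n /\ realize_surj G n.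
Proof.
move=> IH n; suff [] : (realize_inj G n /\ realize_surj G n) /\
  (realize_inj G n.+1 /\ realize_surj G n.+1) by [].
elim: n => [|n [IHn IHn1]]; last by split=> //; exact: realize_even2.
split; last exact: realize_even1.
by split; [exact: realize_inj0 | exact: realize_surj0].
Qed.
End EvenOrder.

Lemma realize_bij (A : zmodType) : cyc_built A ->
  forall n, realize_inj A n /\ realize_surj A n.
Proof.
elim=> {A} [A A0 n|A cycA IH|A m cycA IH|A B f g fg gf cycA IH n].
- exact: realize_trivial.
- exact: realize_int.
- have [m_odd|m_even] := boolP (odd m); first exact: realize_even.
  move=> n; apply: (realize_odd cycA (@ord_enum_shift m)) => //.
  + by rewrite size_enum_F2 m_even.
  + by move=> x; apply: ord_mod2V_even.
  + by move=> w; apply: ord_tors2V_even.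
- exact: realize_iso gf (IH n).
Qed.

(** * Symmetric powers, tensor products and direct sums *)

Section SymmetricLift.
Variables (K : fieldType) (V M : lmodType K).
Implicit Types (q : seq V -> M) (t : seq V).

(** Linearity in the first entry is enough, since symmetry brings every other entry to the front. *)
Record sym_multilinear q : Prop := SymMultilinear {
  sym_lin : forall c x y t, q (c *: x + y :: t) = c *: q (x :: t) + q (y :: t);
  sym_perm : forall s t, perm_eq s t -> q s = q t }.

Definition sym_lift_free k q : {linear {freeg (k.-tuple V) / K} -> M} :=
  free_lift (fun t : k.-tuple V => q t).

Definition sym_lift k q (z : sym k V) : M := sym_lift_free k q (lrepr z).

Variable q : seq V -> M.
Hypothesis Hq : sym_multilinear q.

Lemma sym_lift_rel k x : @sym_rel K k V x -> sym_lift_free k q x = 0.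
Proof.
case=> [i c r s t ti tj|s t st]; last first.
  by rewrite linearB !free_liftE (sym_perm Hq st) subrr.
rewrite !linearB linearZ !free_liftE /=.
have front (u : k.-tuple V) : perm_eq u (tnth u i :: [seq tnth u j | j <- enum 'I_k & j != i]).
  rewrite -{1}(map_tnth_enum u) -map_cons perm_map //.
  rewrite perm_sym; apply: uniq_perm; rewrite ?enum_uniq //.
    by rewrite /= mem_filter eqxx filter_uniq ?enum_uniq.
  by move=> j; rewrite inE mem_filter mem_enum andbT; case: eqVneq.
rewrite !(sym_perm Hq (front _)).
have -> : [seq tnth r j | j <- enum 'I_k & j != i] = [seq tnth t j | j <- enum 'I_k & j != i].
  by apply/eq_in_map => j; rewrite mem_filter => /andP[/tj[]].
have -> : [seq tnth s j | j <- enum 'I_k & j != i] = [seq tnth t j | j <- enum 'I_k & j != i].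
  by apply/eq_in_map => j; rewrite mem_filter => /andP[/tj[]].
by rewrite ti (sym_lin Hq) addrBB.
Qed.

Lemma sym_liftE k (t : k.-tuple V) : sym_lift q (smon t) = q t.
Proof. exact: etrans (lquot_liftE (@sym_lift_rel k) _) (free_liftE _ _). Qed.

Lemma sym_lift_linear k : linear (sym_lift (k := k) q).
Proof. exact: (lquot_lift_linear (@sym_lift_rel k)). Qed.

Lemma sym_lift0 k : sym_lift q (0 : sym k V) = 0.
Proof.
have := sym_lift_linear 1 (0 : sym k V) 0; rewrite !scale1r addr0 -[X in X = _]addr0.
by move=> /addrI <-.
Qed.
End SymmetricLift.

Section SeqMonomials.
Variables (K : fieldType) (V : lmodType K).

(* The product of the elements of t if there are k of them, and 0 otherwise. *)
Definition smonq k (t : seq V) : sym k V :=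
  if insub t is Some t' then smon (t' : k.-tuple V) else 0.

Lemma smonqE k (t : k.-tuple V) : smonq k t = smon t.
Proof. by rewrite /smonq valK. Qed.

Lemma smonq_size k t : size t != k -> smonq k t = 0.
Proof. by move=> tk; rewrite /smonq insubN. Qed.

Lemma smonq_multilinear k : sym_multilinear (smonq k).
Proof.
split=> [c x y t|s t st].
  have [tk|tk] := eqVneq (size t).+1 k; last by rewrite !smonq_size // scaler0 addr0.
  have sz z : size (z :: t) == k by rewrite /= tk.
  rewrite -[c *: x + y :: t]/(val (Tuple (sz (c *: x + y)))) -[x :: t]/(val (Tuple (sz x))).
  rewrite -[y :: t]/(val (Tuple (sz y))) !smonqE.
  have k0 : (0 < k)%N by rewrite -tk.
  apply: (smon_lin (i := Ordinal k0)); first by rewrite !(tnth_nth 0).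
  move=> [[|j] jk] // _; by rewrite !(tnth_nth 0).
have [tk|tk] := eqVneq (size t) k; last first.
  by rewrite !smonq_size // (perm_size st).
have sk : size s == k by rewrite (perm_size st) tk.
move/eqP in tk; rewrite -[s]/(val (Tuple sk)) -[t]/(val (Tuple tk)) !smonqE.
exact: smon_perm.
Qed.
End SeqMonomials.

Section TensorLift.
Variables (K : fieldType) (U V M : lmodType K) (b : U -> V -> M).
Hypothesis b_l : forall v, linear (b^~ v).
Hypothesis b_r : forall u, linear (b u).

Lemma tensor_lift_rel x : @tensor_rel K U V x ->
  free_lift (fun p : U * V => b p.1 p.2) x = 0.
Proof.
case=> [c u1 u2 v|c u v1 v2]; rewrite !linearB linearZ !free_liftE /=.
  by rewrite b_l addrBB.
by rewrite b_r addrBB.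
Qed.

Definition tensor_lift : {linear tensor U V -> M} := lquot_lift tensor_lift_rel.

Lemma tensor_liftE u v : tensor_lift (tens u v) = b u v.
Proof. exact: etrans (lquot_liftE tensor_lift_rel _) (free_liftE _ _). Qed.
End TensorLift.

Section Generation.
Variable K : fieldType.

Definition lin_closed (M : lmodType K) (Q : M -> Prop) :=
  Q 0 /\ forall c x y, Q x -> Q y -> Q (c *: x + y).

Lemma lin_closed_eq (M N : lmodType K) (f g : M -> N) : linear f -> linear g ->
  lin_closed (fun y => f y = g y).
Proof.
move=> lf lg; split=> [|c x y Hx Hy]; last by rewrite lf lg Hx Hy.
have z h : linear h -> h (0 : M) = 0 :> N.
  move=> lh; have := lh 1 0 0; rewrite !scale1r addr0 -[X in X = _]addr0.
  by move=> /addrI <-.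
by rewrite !z.
Qed.

Lemma sym_ind k (V : lmodType K) (Q : sym k V -> Prop) : lin_closed Q ->
  (forall t : k.-tuple V, Q (smon t)) -> forall z, Q z.
Proof. by move=> [Q0 QD] Qt; apply: lquot_free_ind. Qed.

Lemma tensor_ind (U V : lmodType K) (Q : tensor U V -> Prop) : lin_closed Q ->
  (forall u v, Q (tens u v)) -> forall z, Q z.
Proof. by move=> [Q0 QD] Qt; apply: lquot_free_ind => // -[u v]; apply: Qt. Qed.

Lemma tens0l (U V : lmodType K) (v : V) : tens (0 : U) v = 0.
Proof.
have := tens_linl v 1 (0 : U) 0; rewrite !scale1r addr0 -[X in X = _]addr0.
by move=> /addrI <-.
Qed.

Lemma tens0r (U V : lmodType K) (u : U) : tens u (0 : V) = 0.
Proof.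
have := tens_linr u 1 (0 : V) 0; rewrite !scale1r addr0 -[X in X = _]addr0.
by move=> /addrI <-.
Qed.

Lemma tens_lin_closed_l (U V : lmodType K) (Q : tensor U V -> Prop) v :
  lin_closed Q -> lin_closed (fun u => Q (tens u v)).
Proof.
by case=> Q0 QD; split; [rewrite tens0l | move=> c x y Hx Hy; rewrite tens_linl; apply: QD].
Qed.

Lemma tens_lin_closed_r (U V : lmodType K) (Q : tensor U V -> Prop) u :
  lin_closed Q -> lin_closed (fun v => Q (tens u v)).
Proof.
by case=> Q0 QD; split; [rewrite tens0r | move=> c x y Hx Hy; rewrite tens_linr; apply: QD].
Qed.

Lemma tensor_sym_ind k l (U V : lmodType K) (Q : tensor (sym k U) (sym l V) -> Prop) :
  lin_closed Q -> (forall (t : k.-tuple U) (s : l.-tuple V), Q (tens (smon t) (smon s))) ->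
  forall z, Q z.
Proof.
move=> QL Qt; apply: tensor_ind => // a b.
apply: (sym_ind (tens_lin_closed_l b QL)) => t.
exact: (sym_ind (tens_lin_closed_r (smon t) QL)).
Qed.

Lemma tensor_tri_ind k l m (U V W : lmodType K)
    (Q : tensor (tensor (sym k U) (sym l V)) (sym m W) -> Prop) :
  lin_closed Q ->
  (forall (t : k.-tuple U) (s : l.-tuple V) (u : m.-tuple W),
     Q (tens (tens (smon t) (smon s)) (smon u))) ->
  forall z, Q z.
Proof.
move=> QL Qt; apply: tensor_ind => // a b.
apply: (tensor_sym_ind (tens_lin_closed_l b QL)) => t s.
exact: (sym_ind (tens_lin_closed_r (tens (smon t) (smon s)) QL)).
Qed.
Lemma lin_closed_comp (M N P Q : lmodType K) (f : {linear M -> N}) (g : {linear N -> Q})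
    (f' : {linear M -> P}) (g' : {linear P -> Q}) :
  lin_closed (fun x => g (f x) = g' (f' x)).
Proof.
by split=> [|c x y Hx Hy]; rewrite ?linear0 // !linearP Hx Hy.
Qed.

Lemma lin_closed_ker (M N P : lmodType K) (f : {linear M -> N}) (g : {linear N -> P}) :
  lin_closed (fun x => g (f x) = 0).
Proof.
by split=> [|c x y Hx Hy]; rewrite ?linear0 // !linearP Hx Hy scaler0 addr0.
Qed.
End Generation.

Section TensorSymLift.
Variables (K : fieldType) (U V M : lmodType K) (q : seq U -> seq V -> M).
Hypothesis q_l : forall s, sym_multilinear (q^~ s).
Hypothesis q_r : forall t, sym_multilinear (q t).

Definition bisym (k l : nat) (a : sym k U) (b : sym l V) : M :=
  sym_lift (fun s => sym_lift (q^~ s) a) b.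

Lemma bisym_multilinear k (a : sym k U) : sym_multilinear (fun s => sym_lift (q^~ s) a).
Proof.
split=> [c x y t|s t st].
  elim/sym_ind: a => [|t']; last by rewrite !sym_liftE // (sym_lin (q_r _)).
  split=> [|d a b Ha Hb]; first by rewrite !sym_lift0 // scaler0 addr0.
  rewrite !(sym_lift_linear (q_l _)) Ha Hb !scalerDr addrACA; congr (_ + _ + _).
  by rewrite !scalerA mulrC.
elim/sym_ind: a => [|t']; last by rewrite !sym_liftE // (sym_perm (q_r _) st).
split=> [|d a b Ha Hb]; first by rewrite !sym_lift0.
by rewrite !(sym_lift_linear (q_l _)) Ha Hb.
Qed.

Lemma bisym_linr k l (a : sym k U) : linear (bisym (l := l) a).
Proof. exact: (sym_lift_linear (bisym_multilinear a)). Qed.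

Lemma bisym_linl k l (b : sym l V) : linear (fun a : sym k U => bisym a b).
Proof.
move=> c x y; elim/sym_ind: b => [|s].
  split=> [|d b b' Hb Hb']; first by rewrite /bisym !sym_lift0 ?scaler0 ?addr0 //; apply: bisym_multilinear.
  rewrite !bisym_linr Hb Hb' !scalerDr addrACA; congr (_ + _ + _).
  by rewrite !scalerA mulrC.
by rewrite /bisym !sym_liftE //; [exact: (sym_lift_linear (q_l _)) | exact: bisym_multilinear..].
Qed.

Definition tensor_sym_lift k l : {linear tensor (sym k U) (sym l V) -> M} :=
  tensor_lift (@bisym_linl k l) (@bisym_linr k l).

Lemma tensor_sym_liftE k l (t : k.-tuple U) (s : l.-tuple V) :
  tensor_sym_lift k l (tens (smon t) (smon s)) = q t s.
Proof.
by rewrite tensor_liftE /bisym !sym_liftE //; apply: bisym_multilinear.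
Qed.

Lemma tensor_sym_lift_smonq k l t s :
  tensor_sym_lift k l (tens (smonq k t) (smonq l s)) =
  if (size t == k) && (size s == l) then q t s else 0.
Proof.
have [tk|tk] := boolP (size t == k); last by rewrite smonq_size // tens0l linear0.
have [sl|sl] := boolP (size s == l); last by rewrite (smonq_size sl) tens0r linear0.
by rewrite -[t in LHS]/(val (Tuple tk)) -[s in LHS]/(val (Tuple sl)) !smonqE tensor_sym_liftE.
Qed.
End TensorSymLift.

Section TriSymLift.
Variables (K : fieldType) (U V W M : lmodType K) (q : seq U -> seq V -> seq W -> M).
Hypothesis q1 : forall s u, sym_multilinear (fun t => q t s u).
Hypothesis q2 : forall t u, sym_multilinear (fun s => q t s u).
Hypothesis q3 : forall t s, sym_multilinear (q t s).

(** Currying: the last variable is absorbed into the target, so that the lift in two variables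
    applies. *)
Let M' : lmodType K := (seq W -> M)%type.
Let q' t s : M' := q t s.
Lemma tri_sym_linl s : sym_multilinear (q'^~ s).
Proof.
split=> [c x y t|t t' tt']; apply/funext => u; first exact: (sym_lin (q1 s u)).
exact: (sym_perm (q1 s u)).
Qed.
Lemma tri_sym_linr t : sym_multilinear (q' t).
Proof.
split=> [c x y s|s s' ss']; apply/funext => u; first exact: (sym_lin (q2 t u)).
exact: (sym_perm (q2 t u)).
Qed.

Variables k l m : nat.
Let L := tensor_sym_lift tri_sym_linl tri_sym_linr k l.

Lemma tri_sym_multilinear z : sym_multilinear (L z).
Proof.
have E c x y u : L (c *: x + y) u = c *: L x u + L y u by rewrite linearP.
split=> [c x y u|u u' uu'].
  elim/tensor_sym_ind: z => [|t s]; last by rewrite /L !tensor_sym_liftE; apply: (sym_lin (q3 t s)).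
  split=> [|d z z' Hz Hz']; first by rewrite linear0 -[LHS]/0 -[RHS]/(c *: 0 + 0) scaler0 addr0.
  rewrite !E Hz Hz' !scalerDr addrACA; congr (_ + _ + _).
  by rewrite !scalerA mulrC.
elim/tensor_sym_ind: z => [|t s]; last by rewrite /L !tensor_sym_liftE; apply: (sym_perm (q3 t s)).
split=> [|d z z' Hz Hz']; first by rewrite linear0.
by rewrite !E Hz Hz'.
Qed.

Let b (z : tensor (sym k U) (sym l V)) (a : sym m W) : M := sym_lift (L z) a.

Lemma tri_sym_lift_linr z : linear (b z).
Proof. exact: (sym_lift_linear (tri_sym_multilinear z)). Qed.

Lemma tri_sym_lift_linl a : linear (b^~ a).
Proof.
move=> c x y; elim/sym_ind: a => [|u].
  split=> [|d a a' Ha Ha']; first by rewrite /b !sym_lift0 ?scaler0 ?addr0 //; apply: tri_sym_multilinear.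
  rewrite !tri_sym_lift_linr Ha Ha' !scalerDr addrACA; congr (_ + _ + _).
  by rewrite !scalerA mulrC.
by rewrite /b !sym_liftE; [rewrite linearP | exact: tri_sym_multilinear..].
Qed.

Definition tri_sym_lift :
  {linear tensor (tensor (sym k U) (sym l V)) (sym m W) -> M} := tensor_lift tri_sym_lift_linl tri_sym_lift_linr.

Lemma tri_sym_liftE (t : k.-tuple U) (s : l.-tuple V) (u : m.-tuple W) :
  tri_sym_lift (tens (tens (smon t) (smon s)) (smon u)) = q t s u.
Proof.
rewrite tensor_liftE /b sym_liftE; last exact: tri_sym_multilinear.
by rewrite /L tensor_sym_liftE.
Qed.

Lemma tri_sym_lift_smonq t s u :
  tri_sym_lift (tens (tens (smonq k t) (smonq l s)) (smonq m u)) =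
  if [&& size t == k, size s == l & size u == m] then q t s u else 0.
Proof.
have [tk|tk] := boolP (size t == k); last by rewrite smonq_size // !tens0l linear0.
have [sl|sl] := boolP (size s == l).
  have [um|um] := boolP (size u == m).
    by rewrite -[t in LHS]/(val (Tuple tk)) -[s in LHS]/(val (Tuple sl))
      -[u in LHS]/(val (Tuple um)) !smonqE tri_sym_liftE.
  by rewrite (smonq_size um) tens0r linear0.
by rewrite (smonq_size sl) tens0r tens0l linear0.
Qed.
End TriSymLift.

Lemma sym_map_smonq (K : fieldType) (V W : lmodType K) (f : {linear V -> W}) k t :
  sym_map k f (smonq k t) = smonq k (map f t).
Proof.
have [tk|tk] := eqVneq (size t) k; last first.
  by rewrite !smonq_size ?size_map // linear0.
move/eqP in tk; rewrite -[t]/(val (Tuple tk)) smonqE sym_mapE.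
by rewrite -[map f _]/(val (map_tuple f (Tuple tk))) smonqE.
Qed.

Section DirectSums.
Variables (K : fieldType) (I : finType) (V : I -> lmodType K).

Lemma dinj_same i (v : V i) : dinj v i = v.
Proof. by rewrite /dinj; case: eqP => // e; rewrite (eq_irrelevance e erefl). Qed.

Lemma dinj_other i j (v : V i) : i != j -> dinj v j = 0.
Proof. by rewrite /dinj; case: eqP. Qed.

Lemma dinj_linear i : linear (@dinj K I V i).
Proof.
move=> c x y; apply: functional_extensionality_dep => j.
have E (f g : dsum V) : (c *: f + g) j = c *: f j + g j by [].
rewrite E; have [<-|ij] := eqVneq i j; first by rewrite !dinj_same.
by rewrite !dinj_other // scaler0 addr0.
Qed.

Lemma dinj0 i : dinj (0 : V i) = 0.
Proof.
have := dinj_linear 1 (0 : V i) 0; rewrite !scale1r addr0 -[X in X = _]addr0.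
by move=> /addrI <-.
Qed.

Lemma dsum_eval (J : Type) (r : seq J) (F : J -> dsum V) i :
  (\sum_(k <- r) F k) i = \sum_(k <- r) F k i.
Proof. by elim/big_rec2: _ => // k x y _ <-. Qed.

Lemma dsum_ind (Q : dsum V -> Prop) : lin_closed Q ->
  (forall i v, Q (dinj (i := i) v)) -> forall x, Q x.
Proof.
move=> [Q0 QD] Qv x; have -> : x = \sum_i dinj (x i).
  apply: functional_extensionality_dep => j; rewrite dsum_eval (bigD1 j) //= dinj_same.
  by rewrite big1 ?addr0 // => i ij; rewrite dinj_other.
elim/big_ind: _ => // y z Qy Qz; rewrite -[y]scale1r; exact: QD.
Qed.

Lemma dinj_lin_closed (Q : dsum V -> Prop) i : lin_closed Q ->
  lin_closed (fun v : V i => Q (dinj v)).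
Proof.
by case=> Q0 QD; split=> [|c x y Hx Hy]; [rewrite dinj0 | rewrite dinj_linear; apply: QD].
Qed.

Section Lift.
Variables (M : lmodType K) (f : forall i, {linear V i -> M}).
Definition dsum_lift_fun (x : dsum V) : M := \sum_i f i (x i).
Lemma dsum_lift_linear : linear dsum_lift_fun.
Proof.
move=> c x y; rewrite /dsum_lift_fun scaler_sumr -big_split; apply: eq_bigr => i _.
exact: linearP.
Qed.
Definition dsum_lift : {linear dsum V -> M} :=
  HB.pack dsum_lift_fun (GRing.isLinear.Build K (dsum V) M _ dsum_lift_fun dsum_lift_linear).
End Lift.
End DirectSums.

Section Monomials.
Variables (n : nat) (A : zmodType).
Local Notation V := (mod2V A).
Local Notation W := (tors2V A).
Implicit Types (t s : seq V) (u : seq W).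

(** All bidegrees at once: the lengths of [t] and [u] select at most one nonzero component, which
    keeps lengths out of the types. *)
Definition bmon t u : bisum n A := fun p => tens (smonq (val p).1 t) (smonq (val p).2 u).
Definition tmon t s u : trisum n A := fun p =>
  tens (tens (smonq (val p).1.1 t) (smonq (val p).1.2 s)) (smonq (val p).2 u).

Lemma bi_eltE (p : bideg n) (t : (val p).1.-tuple V) (u : (val p).2.-tuple W) :
  bi_elt (smon t) (smon u) = bmon t u.
Proof.
apply: functional_extensionality_dep => p'; rewrite /bi_elt.
have [<-|pp'] := eqVneq p p'; first by rewrite dinj_same /bmon !smonqE.
rewrite dinj_other // /bmon.
have [e1|e1] := eqVneq (val p).1 (val p').1; last first.
  by rewrite (smonq_size (t := t)) ?tens0l // size_tuple.
have [e2|e2] := eqVneq (val p).2 (val p').2; last first.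
  by rewrite (smonq_size (t := u)) ?tens0r // size_tuple.
case/negP: pp'; apply/eqP/val_inj; move: e1 e2.
by case: (val p) (val p') => a b [c d] /= -> ->.
Qed.

Lemma bmon_mult_l u : sym_multilinear (bmon^~ u).
Proof.
split=> [c x y t|t t' tt']; apply: functional_extensionality_dep => p.
  by rewrite /bmon (sym_lin (smonq_multilinear V _)) tens_linl.
by rewrite /bmon (sym_perm (smonq_multilinear V _) tt').
Qed.

Lemma bmon_mult_r t : sym_multilinear (bmon t).
Proof.
split=> [c x y u|u u' uu']; apply: functional_extensionality_dep => p.
  by rewrite /bmon (sym_lin (smonq_multilinear W _)) tens_linr.
by rewrite /bmon (sym_perm (smonq_multilinear W _) uu').
Qed.

Lemma bmon_deg t u : (size t + 2 * size u <> n)%N -> bmon t u = 0.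
Proof.
move=> tu; apply: functional_extensionality_dep => p; rewrite /bmon.
have [ta|ta] := eqVneq (size t) (val p).1; last by rewrite (smonq_size ta) tens0l.
have [ub|ub] := eqVneq (size u) (val p).2; last by rewrite (smonq_size ub) tens0r.
by case: tu; rewrite ta ub; apply/eqP/(valP p).
Qed.

Lemma bisum_ind (Q : bisum n A -> Prop) : lin_closed Q -> (forall t u, Q (bmon t u)) ->
  forall y, Q y.
Proof.
move=> QL Qb; apply: dsum_ind => // p.
apply: tensor_sym_ind (dinj_lin_closed p QL) _ => t u.
by have := Qb t u; rewrite -bi_eltE.
Qed.

Lemma sum_bidegree (M : lmodType 'F_2) t u (z : M) :
  ((size t + 2 * size u <> n)%N -> z = 0) ->
  \sum_(p : bideg n) (if (size t == (val p).1) && (size u == (val p).2) then z else 0) = z.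
Proof.
move=> z0; have [tu|tu] := eqVneq (size t + 2 * size u)%N n; last first.
  by rewrite z0 ?big1 // => [p _|]; [rewrite if_same | exact/eqP].
have tn : (size t < n.+1)%N by lia.
have un : (size u < n.+1)%N by lia.
have tun : ((Ordinal tn, Ordinal un).1 + 2 * (Ordinal tn, Ordinal un).2 == n)%N by apply/eqP.
rewrite (bigD1 (exist _ (Ordinal tn, Ordinal un) tun : bideg n)) //= !eqxx /=.
rewrite big1 ?addr0 // => p pp0; case: ifP => // /andP[/eqP e1 /eqP e2].
case/negP: pp0; apply/eqP/val_inj; move: e1 e2 => /=.
by case: (sval p) => a b /= e1 e2; apply: (congr2 pair); apply: val_inj.
Qed.

Definition bisum_alg : {linear bisum n A -> alg n A} :=
  dsum_lift (V := @bisummand n A) (fun p => tensor_sym_lift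
    (fun u => SymMultilinear (fun c x y t => compat_linl (gen_compat n A) c x y t u)
                (fun t t' tt' => compat_perml (gen_compat n A) u tt'))
    (fun t => SymMultilinear (fun c v w u => compat_linr (gen_compat n A) c v w t u)
                (fun u u' uu' => compat_permr (gen_compat n A) t uu'))
    (val p).1 (val p).2).

Lemma bisum_algE t u : bisum_alg (bmon t u) = gen n t u.
Proof.
rewrite -[RHS](@sum_bidegree _ t u); last exact: (compat_deg (gen_compat n A)).
by apply: eq_bigr => p _; apply: tensor_sym_lift_smonq.
Qed.
End Monomials.
Arguments bmon n {A} t u _.
Arguments tmon n {A} t s u _.

(** * The cokernel presentation *)

Section TriMonomials.
Variables (n : nat) (A : zmodType).
Local Notation V := (mod2V A).
Local Notation W := (tors2V A).
Implicit Types (t s : seq V) (u : seq W).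

Lemma tri_dinjE (p : trideg n) (t : (val p).1.1.-tuple V) (s : (val p).1.2.-tuple V)
    (u : (val p).2.-tuple W) :
  dinj (V := @trisummand n A) (i := p) (tens (tens (smon t) (smon s)) (smon u)) = tmon n t s u.
Proof.
apply: functional_extensionality_dep => p'.
have [<-|pp'] := eqVneq p p'; first by rewrite dinj_same /tmon !smonqE.
rewrite dinj_other // /tmon.
have [e1|e1] := eqVneq (val p).1.1 (val p').1.1; last first.
  by rewrite (smonq_size (t := t)) ?tens0l // size_tuple.
have [e2|e2] := eqVneq (val p).1.2 (val p').1.2; last first.
  by rewrite (smonq_size (t := s)) ?tens0r ?tens0l // size_tuple.
have [e3|e3] := eqVneq (val p).2 (val p').2; last first.
  by rewrite (smonq_size (t := u)) ?tens0r // size_tuple.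
case/negP: pp'; apply/eqP/val_inj; move: e1 e2 e3.
by case: (val p) (val p') => [[a b] c] [[a' b'] c'] /= -> -> ->.
Qed.

Lemma trisum_ind (Q : trisum n A -> Prop) : lin_closed Q ->
  (forall t s u, (0 < size t)%N -> (2 * size t + size s + 2 * size u = n)%N ->
     Q (tmon n t s u)) -> forall y, Q y.
Proof.
move=> QL Qb; apply: dsum_ind => // p.
apply: tensor_tri_ind (dinj_lin_closed p QL) _ => t s u.
rewrite tri_dinjE; have /andP[p0 /eqP pn] := valP p.
by apply: Qb; rewrite !size_tuple.
Qed.

Lemma sum_tridegree (M : lmodType 'F_2) t s u (z : M) : (0 < size t)%N ->
  ((2 * size t + size s + 2 * size u <> n)%N -> z = 0) ->
  \sum_(p : trideg n) (if [&& size t == (val p).1.1, size s == (val p).1.2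
    & size u == (val p).2] then z else 0) = z.
Proof.
move=> t0 z0; have [tu|tu] := eqVneq (2 * size t + size s + 2 * size u)%N n; last first.
  by rewrite z0 ?big1 // => [p _|]; [rewrite if_same | exact/eqP].
have tn : (size t < n.+1)%N by lia.
have sn : (size s < n.+1)%N by lia.
have un : (size u < n.+1)%N by lia.
have tun : let p := (Ordinal tn, Ordinal sn, Ordinal un) in
    ((0 < p.1.1) && (2 * p.1.1 + p.1.2 + 2 * p.2 == n))%N.
  by rewrite /= t0; apply/eqP.
rewrite (bigD1 (exist _ (Ordinal tn, Ordinal sn, Ordinal un) tun : trideg n)) //= !eqxx /=.
rewrite big1 ?addr0 // => p pp0; case: ifP => // /and3P[/eqP e1 /eqP e2 /eqP e3].
case/negP: pp0; apply/eqP/val_inj; move: e1 e2 e3 => /=.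
case: (sval p) => [[a b] c] /= e1 e2 e3.
by apply: (congr2 pair); [apply: (congr2 pair)|]; apply: val_inj.
Qed.

Definition relation_elt t s u : bisum n A :=
  bmon n (t ++ t ++ s) u + bmon n s (map (betaV A) t ++ u).

Lemma F2_sq (c : 'F_2) : c * c = c.
Proof. by case: c => [[|[|]]] // i; apply: val_inj. Qed.

Lemma lmodF2_dbl (M : lmodType 'F_2) (x : M) : x + x = 0.
Proof. by rewrite -[x]scale1r -scalerDl F2dbl scale0r. Qed.

Lemma lmodF2_cross (M : lmodType 'F_2) (a b c d e : M) :
  a + b + (b + c) + (d + e) = a + d + (c + e).
Proof. by rewrite (addrA (a + b)) -(addrA a b b) lmodF2_dbl addr0 addrACA. Qed.

(** Squaring is linear over F_2: the mixed terms xy and yx cancel, and c^2 = c. *)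
Lemma relation_mult1 s u : sym_multilinear (fun t => relation_elt t s u).
Proof.
have front x y t u' : bmon n ((x :: t) ++ (y :: t) ++ s) u' = bmon n (x :: y :: t ++ t ++ s) u'.
  apply: (sym_perm (bmon_mult_l n _)); rewrite /= perm_cons perm_sym.
  by rewrite -[y :: _]cat1s -[y :: t ++ s]cat1s perm_catCA.
have swap x y r u' : bmon n (x :: y :: r) u' = bmon n (y :: x :: r) u'.
  exact/(sym_perm (bmon_mult_l n _))/perm_swap2.
split=> [c x y t|t t' tt'].
  have blin := sym_lin (bmon_mult_l n u).
  rewrite /relation_elt !front !map_cons linearP !cat_cons (sym_lin (bmon_mult_r n _)) !blin.
  rewrite !(swap _ (c *: x + y)) !blin !scalerDr !scalerA F2_sq (swap y x).
  exact: lmodF2_cross.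
congr (_ + _).
  apply: (sym_perm (bmon_mult_l n _)).
  by apply: perm_cat => //; apply: perm_cat.
apply: (sym_perm (bmon_mult_r n _)).
by apply: perm_cat => //; apply: perm_map.
Qed.

Lemma relation_mult2 t u : sym_multilinear (fun s => relation_elt t s u).
Proof.
have front x s u' : bmon n (t ++ t ++ (x :: s)) u' = bmon n (x :: t ++ t ++ s) u'.
  apply: (sym_perm (bmon_mult_l n _)).
  by rewrite !catA -cat1s -[x :: (_ ++ _)]cat1s perm_catCA.
split=> [c x y s|s s' ss'].
  rewrite /relation_elt !front !(sym_lin (bmon_mult_l n _)) scalerDr.
  exact: addrACA.
congr (_ + _); apply: (sym_perm (bmon_mult_l n _)) => //.
by apply: perm_cat => //; apply: perm_cat.
Qed.

Lemma relation_mult3 t s : sym_multilinear (relation_elt t s).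
Proof.
have front v u : bmon n s (map (betaV A) t ++ (v :: u)) = bmon n s (v :: map (betaV A) t ++ u).
  apply: (sym_perm (bmon_mult_r n _)).
  by rewrite -cat1s -[v :: (_ ++ _)]cat1s perm_catCA.
split=> [c v w u|u u' uu'].
  rewrite /relation_elt !front !(sym_lin (bmon_mult_r n _)) scalerDr.
  exact: addrACA.
congr (_ + _); apply: (sym_perm (bmon_mult_r n _)) => //.
by apply: perm_cat.
Qed.

(* The k-th component sends x_1 ... x_k (x) y (x) z to
   (x_1^2 ... x_k^2 - b(x_1) ... b(x_k)) y z, where b is betaV. *)
Definition rel_map : {linear trisum n A -> bisum n A} :=
  dsum_lift (V := @trisummand n A) (fun p =>
    tri_sym_lift relation_mult1 relation_mult2 relation_mult3 (val p).1.1 (val p).1.2 (val p).2).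

Lemma rel_mapE t s u : (0 < size t)%N -> rel_map (tmon n t s u) = relation_elt t s u.
Proof.
move=> t0; rewrite -[RHS](@sum_tridegree _ t s u) //.
  by apply: eq_bigr => p _; apply: tri_sym_lift_smonq.
move=> H; rewrite /relation_elt !bmon_deg ?addr0 // !size_cat ?size_map;
  by move: H; move: (size t) (size s) (size u) => *; lia.
Qed.

(** The relation x^2 = b(x) is applied to one entry of [t] at a time, so every component of
    [rel_map] dies in the algebra. *)
Lemma gen_squares t s u : gen n (t ++ t ++ s) u = gen n s (map (betaV A) t ++ u).
Proof.
elim: t s u => [//|x t IH] s u; have H := gen_compat n A.
have -> : gen n ((x :: t) ++ (x :: t) ++ s) u = gen n (x :: x :: t ++ t ++ s) u.
  apply: (compat_perml H); rewrite /= perm_cons perm_sym.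
  by rewrite -[x :: _]cat1s -[x :: t ++ s]cat1s perm_catCA.
rewrite (compat_sq H) IH; apply: (compat_permr H).
by rewrite /= -cat1s -[betaV A x :: (_ ++ _)]cat1s perm_catCA.
Qed.

Lemma bisum_alg_rel x : bisum_alg n A (rel_map x) = 0.
Proof.
elim/trisum_ind: x => [|t s u t0 _].
  exact: (lin_closed_ker rel_map (bisum_alg n A)).
by rewrite rel_mapE // linearD !bisum_algE gen_squares lmodF2_dbl.
Qed.

Lemma coker_pi0 (K : fieldType) (U M : lmodType K) (f : {linear U -> M}) y :
  coker_pi f y = 0 <-> exists x, y = f x.
Proof.
split=> [|Hy]; last exact: lpi_rel.
rewrite -(linear0 (coker_pi f)) => /lpi_eq; rewrite subr0 => /span_ofP.
case=> m [c [g [gb ->]]]; elim/big_ind: _ => [|x z|i _].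
- by exists 0; rewrite linear0.
- by move=> [x' ->] [z' ->]; exists (x' + z'); rewrite linearD.
- by have [x' ->] := gb i; exists (c i *: x'); rewrite linearZ.
Qed.

Lemma coker_pi_surj (K : fieldType) (U M : lmodType K) (f : {linear U -> M}) (z : coker f) :
  exists y, z = coker_pi f y.
Proof. by exists (lrepr z); rewrite -[LHS]lreprK. Qed.

Lemma coker_compat : alg_compat n (fun t u => coker_pi rel_map (bmon n t u)).
Proof.
split=> [c x y t u|c v w t u|t t' u tt'|t u u' uu'|x t u|t u tu].
- by rewrite (sym_lin (bmon_mult_l n _)) linearP.
- by rewrite (sym_lin (bmon_mult_r n _)) linearP.
- by rewrite (sym_perm (bmon_mult_l n _) tt').
- by rewrite (sym_perm (bmon_mult_r n _) uu').
- apply/eqP; rewrite -subr_eq0 -linearB; apply/eqP/coker_pi0.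
  (* The square relation is the component k = 1 of [rel_map]. *)
  exists (tmon n [:: x] t u); rewrite rel_mapE // /relation_elt /=; congr (_ + _).
  by apply/eqP; rewrite eq_sym -addr_eq0 lmodF2_dbl.
- by rewrite bmon_deg // linear0.
Qed.

Definition alg_coker : {linear alg n A -> coker rel_map} := alg_lift coker_compat.

Lemma alg_cokerK y : alg_coker (bisum_alg n A y) = coker_pi rel_map y.
Proof.
elim/bisum_ind: y => [|t u]; last by rewrite bisum_algE alg_liftE.
by split=> [|c x y Hx Hy]; rewrite ?linear0 // !linearP Hx Hy.
Qed.

Lemma bisum_alg_surj r : exists y, bisum_alg n A y = r.
Proof.
elim/alg_ind: r => [|c _ _ [y <-] [z <-]|t u].
- by exists 0; rewrite linear0.
- by exists (c *: y + z); rewrite linearP.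
- by exists (bmon n t u); rewrite bisum_algE.
Qed.

Variable cycA : cyc_built A.

Let eval : {linear bisum n A -> coho 'F_2 A n} := realize cycA n \o bisum_alg n A.

Lemma theta_rel y : (exists x, y = rel_map x) -> eval y = 0.
Proof.
move=> [x ->]; rewrite -[LHS]/(realize cycA n (bisum_alg n A (rel_map x))).
by rewrite bisum_alg_rel linear0.
Qed.

Definition theta : {linear coker rel_map -> coho 'F_2 A n} := lquot_lift theta_rel.

Lemma thetaE y : theta (coker_pi rel_map y) = realize cycA n (bisum_alg n A y).
Proof. exact: (lquot_liftE theta_rel). Qed.

(** [alg_coker] inverts the map from the cokernel to the algebra, so bijectivity of the realization
    carries over. *)
Lemma theta_bij : bijective theta.
Proof.
have [inj surj] := realize_bij cycA n.
have theta_inj z : theta z = 0 -> z = 0.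
  have [y ->] := coker_pi_surj z; rewrite thetaE -alg_cokerK => ry.
  suff -> : bisum_alg n A y = 0 by rewrite linear0.
  have [F [rF _ _]] := represents_std cycA (bisum_alg n A y).
  apply: (inj cycA _ F rF); case: rF => cF hF; rewrite ry => /esym.
  exact: cls_eq0.
have theta_surj z : exists y, theta y = z.
  have [F [cF hF ->]] := cls_surj z.
  have [r [_ _ rE]] := surj cycA F cF hF; have [y yr] := bisum_alg_surj r.
  by exists (coker_pi rel_map y); rewrite thetaE yr rE.
have [g gE] := boolp.choice theta_surj; exists g => // z.
by apply/eqP; rewrite -subr_eq0; apply/eqP/theta_inj; rewrite linearB gE subrr.
Qed.
End TriMonomials.

Section Naturality.
Variables (n : nat) (A B : zmodType) (h : {additive A -> B}).
Local Notation f := (dual_map (mod2_map h)).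
Local Notation g := (dual_map (tors2_map h)).

Lemma bisum_map_bmon t u : bisum_map n h (bmon n t u) = bmon n (map f t) (map g u).
Proof.
apply: functional_extensionality_dep => p.
rewrite -[LHS]/(tensor_map (sym_map _ f) (sym_map _ g) (bmon n t u p)).
by rewrite tensor_mapE !sym_map_smonq.
Qed.

Lemma trisum_map_tmon t s u :
  trisum_map n h (tmon n t s u) = tmon n (map f t) (map f s) (map g u).
Proof.
apply: functional_extensionality_dep => p.
rewrite -[LHS]/(tensor_map (tensor_map (sym_map _ f) (sym_map _ f)) (sym_map _ g) (tmon n t s u p)).
by rewrite !tensor_mapE !sym_map_smonq.
Qed.

Lemma rel_map_natural x : rel_map n A (trisum_map n h x) = bisum_map n h (rel_map n B x).
Proof.
elim/trisum_ind: x => [|t s u t0 _].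
  exact: (lin_closed_comp (trisum_map n h) (rel_map n A) (rel_map n B) (bisum_map n h)).
rewrite trisum_map_tmon !rel_mapE ?size_map // linearD !bisum_map_bmon !map_cat.
congr (_ + bmon n _ (_ ++ _)); rewrite -!map_comp; apply: eq_map => x.
exact: beta_natural.
Qed.

Lemma bisum_alg_natural y : bisum_alg n A (bisum_map n h y) = pull h n (bisum_alg n B y).
Proof.
elim/bisum_ind: y => [|t u]; last by rewrite bisum_map_bmon !bisum_algE pullE.
apply: (lin_closed_eq (f := bisum_alg n A \o bisum_map n h)
  (g := pull h n \o bisum_alg n B)); first exact: linearP.
by move=> c x y; rewrite [LHS](congr1 _ (linearP (bisum_alg n B) c x y)) pullD pullZ.
Qed.

Lemma theta_natural (cycA : cyc_built A) (cycB : cyc_built B) y :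
  theta n cycA (coker_pi (rel_map n A) (bisum_map n h y)) =
  coho_map 'F_2 h n (theta n cycB (coker_pi (rel_map n B) y)).
Proof.
transitivity (realize cycA n (bisum_alg n A (bisum_map n h y))); first exact: thetaE.
rewrite bisum_alg_natural (realize_pull cycA cycB).
by apply: (congr1 (coho_map 'F_2 h n)); apply/esym/thetaE.
Qed.
End Naturality.

(** * The exact sequences in degrees 2 and 3 *)

(** [J] identifies [V] with [Y] and the image of [f] with that of [phi], so exactness is read off
    from the cokernel. *)
Lemma short_exact_coker (K : fieldType) (U V X Y H : lmodType K) (phi : {linear X -> Y})
    (th : {linear coker phi -> H}) (J : {linear V -> Y}) (f : {linear U -> V})
    (g : {linear V -> H}) :
  bijective th -> (forall v, J v = 0 -> v = 0) -> (forall y, exists v, y = J v) ->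
  injective f -> (forall z, exists x, phi z = J (f x)) -> (forall x, exists z, phi z = J (f x)) ->
  (forall v, g v = th (coker_pi phi (J v))) -> short_exact f g.
Proof.
move=> thB J0 Jsurj f_inj phiJ Jphi gE; split=> // [v|h].
  rewrite gE; split=> [gv|[x ->]]; last first.
    have [z zE] := Jphi x; have -> : coker_pi phi (J (f x)) = 0.
      by apply/coker_pi0; exists z.
    by rewrite linear0.
  have : coker_pi phi (J v) = 0 by apply: (bij_inj thB); rewrite gv linear0.
  move=> /coker_pi0[z zE]; have [x xE] := phiJ z; exists x.
  by apply/eqP; rewrite -subr_eq0; apply/eqP/J0; rewrite linearB zE xE subrr.
have [th' thK thK'] := thB; have [y yE] := coker_pi_surj (th' h).
by have [v vE] := Jsurj y; exists v; rewrite gE -vE -yE thK'.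
Qed.

Section SmallSymmetricPowers.
Variables (K : fieldType) (V : lmodType K).

Definition seq1_val (t : seq V) : V := if t is [:: x] then x else 0.
Lemma sym1_multilinear : sym_multilinear seq1_val.
Proof.
split=> [c x y [|z t]|s t st] //; first by rewrite scaler0 addr0.
case: s t st => [|x [|y s]] [|x' [|y' t]] // st; have := perm_size st => //.
by have := perm_mem st x; rewrite !inE eqxx => /esym/eqP.
Qed.

Definition sym1_val : {linear sym 1 V -> V} :=
  HB.pack (@sym_lift K V V 1 seq1_val)
   (GRing.isLinear.Build K (sym 1 V) V _ _ (sym_lift_linear sym1_multilinear (k := 1))).

Lemma sym1_valE x : sym1_val (smon [tuple x]) = x.
Proof. exact: (sym_liftE sym1_multilinear). Qed.

Lemma smon1_linear : linear (fun x : V => smon [tuple x] : sym 1 V).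
Proof.
move=> c x y; have E z : smon [tuple z] = smonq 1 [:: z] :> sym 1 V by rewrite -smonqE.
by rewrite !E (sym_lin (smonq_multilinear V 1)).
Qed.

Definition smon1_fun (x : V) : sym 1 V := smon [tuple x].
Definition smon1 : {linear V -> sym 1 V} :=
  HB.pack smon1_fun
   (GRing.isLinear.Build K V (sym 1 V) _ _ smon1_linear).

Lemma sym0_multilinear : sym_multilinear (fun t : seq V => if t is [::] then 1 else 0 : K^o).
Proof.
split=> [c x y t|s t st] //; first by rewrite scaler0 addr0.
by case: s t st => [|x s] [|y t] // st; have := perm_size st.
Qed.

Lemma tens_unit_r_inj (U : lmodType K) (u : U) :
  tens u (smon [tuple] : sym 0 V) = 0 -> u = 0.
Proof.
pose e := sym_lift (k := 0) (fun t : seq V => if t is [::] then 1 else 0 : K^o).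
have le : linear e by exact: (sym_lift_linear sym0_multilinear).
have e1 : e (smon [tuple]) = 1 by exact: (sym_liftE sym0_multilinear).
have bl c : linear (fun u : U => e c *: u).
  by move=> a x y; rewrite scalerDr !scalerA mulrC.
have br (x : U) : linear (fun c => e c *: x).
  by move=> a c d; rewrite le scalerDl scalerA.
move=> /(congr1 (tensor_lift (b := fun u c => e c *: u) bl br)).
by rewrite tensor_liftE e1 scale1r linear0.
Qed.

Lemma tens_unit_l_inj (U : lmodType K) (u : U) :
  tens (smon [tuple] : sym 0 V) u = 0 -> u = 0.
Proof.
pose e := sym_lift (k := 0) (fun t : seq V => if t is [::] then 1 else 0 : K^o).
have le : linear e by exact: (sym_lift_linear sym0_multilinear).
have e1 : e (smon [tuple]) = 1 by exact: (sym_liftE sym0_multilinear).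
have br c : linear (fun u : U => e c *: u).
  by move=> a x y; rewrite scalerDr !scalerA mulrC.
have bl (x : U) : linear (fun c => e c *: x).
  by move=> a c d; rewrite le scalerDl scalerA.
move=> /(congr1 (tensor_lift (b := fun c u => e c *: u) bl br)).
by rewrite tensor_liftE e1 scale1r linear0.
Qed.
End SmallSymmetricPowers.

Lemma sym_square (V M : lmodType 'F_2) (q : seq V -> M) c x y t : sym_multilinear q ->
  q [:: c *: x + y, c *: x + y & t] = c *: q [:: x, x & t] + q [:: y, y & t].
Proof.
move=> qL; have swap u v : q [:: u, v & t] = q [:: v, u & t].
  by apply: (sym_perm qL); apply: perm_swap2.
rewrite !(sym_lin qL) !(swap _ (c *: x + y)) !(sym_lin qL) scalerDr !scalerA F2_sq (swap y x).
have := lmodF2_cross (c *: q [:: x, x & t]) (c *: q [:: x, y & t]) (q [:: y, y & t]) 0 0.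
by rewrite !addr0.
Qed.

Lemma F2_neq1 (x : 'F_2) : x <> 1 -> x = 0.
Proof. by case: x => [[|[|]]] // i x1; [apply: val_inj | case: x1; apply: val_inj]. Qed.

(** * Separating tensors and symmetric powers by evaluation *)

Section Separation.
Variables (T : lmodType 'F_2).
Local Notation V := (dual T).

Lemma tensor_sum (z : tensor V V) : exists s : seq (V * V), z = \sum_(p <- s) tens p.1 p.2.
Proof.
elim/tensor_ind: z => [|u v]; last by exists [:: (u, v)]; rewrite big_seq1.
split=> [|c _ _ [s ->] [s' ->]]; first by exists [::]; rewrite big_nil.
exists ([seq (c *: p.1, p.2) | p <- s] ++ s'); rewrite big_cat big_map; congr (_ + _).
rewrite scaler_sumr; apply: eq_bigr => p _.
by have := tens_linl p.2 c p.1 0; rewrite tens0l !addr0.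
Qed.

Lemma dual_sum I (r : seq I) (F : I -> V) a : (\sum_(i <- r) F i) a = \sum_(i <- r) F i a.
Proof. by elim/big_rec2: _ => // i u v _ <-. Qed.

(** Elimination on the number of terms. A nonzero [y0] takes the value 1 at some [a0]; the
    hypothesis at [a0] expresses [x0] by the other first entries, and substitution leaves a shorter
    sum with the same property. *)
Lemma tensor_sep (s : seq (V * V)) :
  (forall a b, \sum_(p <- s) p.1 b * p.2 a = 0) -> \sum_(p <- s) tens p.1 p.2 = 0.
Proof.
have [k] := ubnP (size s); elim: k s => // k IH [|[x0 y0] s] /=; first by rewrite big_nil.
rewrite ltnS => sk H; rewrite big_cons /=.
have {}H a b : x0 b * y0 a + \sum_(p <- s) p.1 b * p.2 a = 0 by rewrite -[RHS](H a b) big_cons.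
have [y00|/eqP y0N] := eqVneq y0 0.
  rewrite y00 tens0r add0r; apply: IH => // a b.
  by rewrite -[RHS](H a b) y00 -[X in _ = _ * X + _]/0 mulr0 add0r.
have [a0 ya0] : exists a, y0 a = 1.
  apply: contrapT => noa; apply: y0N; apply: val_inj; apply/funext => a.
  by apply: F2_neq1 => ya; apply: noa; exists a.
have x0E : x0 = \sum_(p <- s) p.2 a0 *: p.1.
  apply: val_inj; apply/funext => b; rewrite -[LHS]/(x0 b) -[RHS]/((\sum_(p <- s) p.2 a0 *: p.1) b).
  rewrite dual_sum; have := H a0 b; rewrite ya0 mulr1 => /eqP; rewrite addr_eq0 F2opp => /eqP ->.
  by apply: eq_bigr => p _; rewrite mulrC.
have -> : tens x0 y0 = \sum_(p <- s) tens p.1 (p.2 a0 *: y0).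
  rewrite x0E; elim: (s) => [|p r IHr]; first by rewrite !big_nil tens0l.
  rewrite !big_cons tens_linl IHr; congr (_ + _).
  by have := tens_linr p.1 (p.2 a0) y0 0; rewrite tens0r !addr0.
rewrite -big_split /=; pose s' : seq (V * V) := [seq ((p : V * V).1, (p : V * V).2 a0 *: y0 + (p : V * V).2) | p <- s].
transitivity (\sum_(p <- s') tens p.1 p.2).
  rewrite big_map; apply: eq_bigr => p _ /=.
  by have := tens_linr p.1 1 (p.2 a0 *: y0) p.2; rewrite !scale1r.
apply: IH; first by rewrite size_map.
move=> a b; rewrite big_map /= -[RHS](H a b).
rewrite x0E dual_sum mulr_suml -big_split; apply: eq_bigr => p _ /=.
transitivity (p.1 b * (p.2 a0 * y0 a + p.2 a)) => //.
by transitivity ((p.2 a0 * p.1 b) * y0 a + p.1 b * p.2 a) => //; F2.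
Qed.

Definition eval_form (a : T) (t : seq V) : ('F_2)^o := \prod_(x <- t) x a.
Lemma eval_form_multilinear a : sym_multilinear (eval_form a).
Proof.
split=> [c x y t|s t st]; last exact: perm_big.
have E : (c *: x + y) a = c * x a + y a by [].
by rewrite /eval_form !big_cons E mulrDl -mulrA.
Qed.

Lemma smon_square_inj (x : V) : smon [tuple x; x] = 0 :> sym 2 V -> x = 0.
Proof.
move=> xx; apply: val_inj; apply/funext => a; rewrite -[LHS]/(x a) -[RHS]/0.
have := sym_liftE (eval_form_multilinear a) [tuple x; x].
by rewrite xx sym_lift0; [rewrite /eval_form /= !big_cons big_nil mulr1 F2_sq | exact: eval_form_multilinear].
Qed.

(* The coefficient of 'X in the product of the x b + x a 'X is the polarisation
   of the evaluation at b in the direction a. *)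
Definition polar_form (a b : T) (t : seq V) : ('F_2)^o :=
  (\prod_(x <- t) ((x b)%:P + x a *: 'X))`_1.
Lemma polar_form_multilinear a b : sym_multilinear (polar_form a b).
Proof.
split=> [c x y t|s t st]; last by rewrite /polar_form (perm_big _ st).
have E d : (c *: x + y) d = c * x d + y d by [].
rewrite /polar_form !big_cons !E -[c *: _ in RHS]coefZ -coefD.
apply: (congr1 (fun p : {poly 'F_2} => p`_1)).
rewrite [c *: (_ * _)]scalerAl -[RHS]mulrDl; congr (_ * _).
by rewrite polyCD polyCM mul_polyC scalerDr scalerA scalerDl addrACA.
Qed.

(** Modulo 2 the square of [x b + x a X] has no linear term, so the linear term comes from [y], with
    coefficient (x b)^2 = x b. *)
Lemma polar_form_cubic a b x y : polar_form a b [:: x; x; y] = x b * y a.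
Proof.
have m1 (p r : {poly 'F_2}) : (p * r)`_1 = p`_0 * r`_1 + p`_1 * r`_0.
  by rewrite coefM big_ord_recl big_ord1.
have m0 (p r : {poly 'F_2}) : (p * r)`_0 = p`_0 * r`_0.
  by rewrite coefM big_ord1.
have l0 (z : V) : ((z b)%:P + z a *: 'X)`_0 = z b.
  by rewrite coefD coefC coefZ coefX mulr0 addr0.
have l1 (z : V) : ((z b)%:P + z a *: 'X)`_1 = z a.
  by rewrite coefD coefC coefZ coefX mulr1 add0r.
rewrite /polar_form !big_cons big_nil mulr1 !(m1, m0, l0, l1).
by rewrite -[x b in RHS]F2_sq; F2.
Qed.
End Separation.

Definition lin_of (K : fieldType) (U V : lmodType K) (f : U -> V) (fL : linear f) :
  {linear U -> V} := HB.pack f (GRing.isLinear.Build K U V _ f fL).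

(* The product with its module structure sealed: unification would otherwise
   unfold the structures of both factors. *)
Definition prodL (K : fieldType) (X Y : lmodType K) : lmodType K := (X * Y)%type.

Section TwoSummands.
Variables (K : fieldType) (I : finType) (V : I -> lmodType K) (i j : I) (X Y : lmodType K).
Variables (f : {linear X -> V i}) (g : {linear Y -> V j}).

Definition two_inj_fun (v : prodL X Y) : dsum V := dinj (f v.1) + dinj (g v.2).

Lemma two_inj_linear : linear two_inj_fun.
Proof.
move=> c x y; rewrite /two_inj_fun [(c *: x + y).1]/(c *: x.1 + y.1).
by rewrite [(c *: x + y).2]/(c *: x.2 + y.2) !linearP !dinj_linear scalerDr addrACA.
Qed.

Definition two_inj : {linear prodL X Y -> dsum V} :=
  lin_of two_inj_linear.

Lemma two_injE x y : two_inj (x, y) = dinj (f x) + dinj (g y).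
Proof. by []. Qed.

Lemma two_injl x : two_inj (x, 0) = dinj (f x).
Proof. by rewrite two_injE linear0 dinj0 addr0. Qed.

Lemma two_injr y : two_inj (0, y) = dinj (g y).
Proof. by rewrite two_injE linear0 dinj0 add0r. Qed.

Lemma two_inj_ker : i != j -> (forall x, f x = 0 -> x = 0) -> (forall y, g y = 0 -> y = 0) ->
  forall v, two_inj v = 0 -> v = 0.
Proof.
move=> ij f0 g0 [x y] e; have E (F G : dsum V) k : (F + G) k = F k + G k by [].
move: (congr1 (fun F : dsum V => F i) e) (congr1 (fun F : dsum V => F j) e).
have ji : j != i by rewrite eq_sym.
rewrite two_injE !E !dinj_same (dinj_other _ ij) (dinj_other _ ji) addr0 add0r.
by move=> /f0 -> /g0 ->.
Qed.
End TwoSummands.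

Section LinearClosure.
Variables (K : fieldType) (U X Y Z : lmodType K).

Lemma lin_closed_image (J : {linear X -> Y}) : lin_closed (fun y => exists v, y = J v).
Proof.
split=> [|c _ _ [v ->] [v' ->]]; first by exists 0; rewrite linear0.
by exists (c *: v + v'); rewrite linearP.
Qed.

Lemma lin_closed_lift (L : {linear Z -> Y}) (J : {linear X -> Y}) (F : {linear U -> X}) :
  lin_closed (fun z => exists x, L z = J (F x)).
Proof.
split=> [|c y y' [x xE] [x' xE']]; first by exists 0; rewrite !linear0.
by exists (c *: x + x'); rewrite !linearP xE xE'.
Qed.

Variables (f : {linear U -> X}) (g : {linear U -> Y}).
Definition pair_lin_fun (u : U) : prodL X Y := (f u, g u).
Lemma pair_lin_linear : linear pair_lin_fun.
Proof. by move=> c x y; rewrite /pair_lin_fun !linearP. Qed.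
Definition pair_lin : {linear U -> prodL X Y} :=
  lin_of pair_lin_linear.
End LinearClosure.

Definition square_fun (V : lmodType 'F_2) (x : V) : sym 2 V := smon [tuple x; x].
Lemma square_linear V : linear (@square_fun V).
Proof.
have E z : square_fun z = smonq 2 [:: z; z] :> sym 2 V by rewrite /square_fun -smonqE.
by move=> c x y; rewrite !E (sym_square _ _ _ _ (smonq_multilinear V 2)).
Qed.
Definition square (V : lmodType 'F_2) : {linear V -> sym 2 V} :=
  lin_of (@square_linear V).

Section TensorWith.
Variables (K : fieldType) (U V : lmodType K).

Definition tensl (v : V) : {linear U -> tensor U V} :=
  lin_of (tens_linl v).

Definition tensr (u : U) : {linear V -> tensor U V} :=
  lin_of (tens_linr u).
End TensorWith.

Lemma rel_map_image n (A : zmodType) (U X : lmodType 'F_2)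
    (J : {linear X -> bisum n A}) (F : {linear U -> X}) :
  (forall t s u, (0 < size t)%N -> (2 * size t + size s + 2 * size u = n)%N ->
     exists x, rel_map n A (tmon n t s u) = J (F x)) ->
  forall z, exists x, rel_map n A z = J (F x).
Proof. exact: (trisum_ind (lin_closed_lift (rel_map n A) J F)). Qed.

Section Degree2.
Variable A : zmodType.
Local Notation V := (mod2V A).
Local Notation W := (tors2V A).

Definition incl20 : {linear sym 2 V -> @bisummand 2 A deg20} :=
  tensl (sym 2 V) (smon [tuple] : sym 0 W).
Definition incl01 : {linear W -> @bisummand 2 A deg01} :=
  tensr (sym 1 W) (smon [tuple] : sym 0 V) \o smon1 W.

Definition J2 : {linear prodL (sym 2 V) W -> bisum 2 A} := two_inj incl20 incl01.

Lemma J2E s w : J2 (s, w) =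
  bi_elt (p := deg20) s (smon [tuple]) + bi_elt (p := deg01) (smon [tuple]) (smon [tuple w]).
Proof. by []. Qed.

Lemma J2_ker v : J2 v = 0 -> v = 0.
Proof.
apply: two_inj_ker => // [s|w]; first exact: tens_unit_r_inj.
by move=> /tens_unit_l_inj w0; rewrite -[w](sym1_valE (V := W)) -[smon _]/(smon1 W w) w0 linear0.
Qed.

Lemma J2_surj y : exists v, y = J2 v.
Proof.
elim/bisum_ind: y => [|t u]; first exact: (lin_closed_image J2).
have [tu|/eqP tu] := eqVneq (size t + 2 * size u)%N 2; last first.
  by exists 0; rewrite linear0 bmon_deg.
case: t u tu => [|x [|y [|? ?]]] [|w [|? ?]] //=; try by lia.
- by move=> _; exists (0, w); rewrite -(bi_eltE (p := deg01) [tuple] [tuple w]) [RHS]two_injr.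
- move=> _; exists (smon [tuple x; y], 0).
  by rewrite -(bi_eltE (p := deg20) [tuple x; y] [tuple]) [RHS]two_injl.
Qed.

Definition rel20 : {linear V -> prodL (sym 2 V) W} := pair_lin (square V) (betaV A).

Lemma rel20E x : rel20 x = (smon [tuple x; x], betaV A x).
Proof. by []. Qed.

Lemma rel20_inj : injective rel20.
Proof.
apply: raddf_inj => x /(congr1 fst); exact: smon_square_inj.
Qed.

Lemma rel_map_rel20 x : rel_map 2 A (tmon 2 [:: x] [::] [::]) = J2 (rel20 x).
Proof.
rewrite rel_mapE // J2E /relation_elt.
rewrite (bi_eltE (p := deg20) [tuple x; x] [tuple]).
by rewrite (bi_eltE (p := deg01) [tuple] [tuple betaV A x]).
Qed.

Lemma rel_map2 z : exists x, rel_map 2 A z = J2 (rel20 x).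
Proof.
move: z; apply: (rel_map_image (J := J2) (F := rel20)) => t s u t0.
(* With k >= 1 the only tridegree of total degree 2 is (1, 0, 0). *)
case: t s u t0 => [|x [|? ?]] [|? ?] [|? ?] //=; try by lia.
by move=> _ _; exists x; apply: rel_map_rel20.
Qed.
Lemma rel20_rel_map x : exists z, J2 (rel20 x) = rel_map 2 A z.
Proof. by exists (tmon 2 [:: x] [::] [::]); rewrite rel_map_rel20. Qed.
End Degree2.

Section SquareTimes.
Variables (V W : lmodType 'F_2) (b : {linear V -> W}).

Definition square_times_fun (x y : V) : sym 3 V := smon [tuple x; x; y].
Lemma square_times_smonq x y : square_times_fun x y = smonq 3 [:: x; x; y].
Proof. by rewrite /square_times_fun -smonqE. Qed.

Lemma square_times_linl y : linear (square_times_fun^~ y).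
Proof.
by move=> c x x'; rewrite !square_times_smonq (sym_square _ _ _ _ (smonq_multilinear V 3)).
Qed.

Lemma square_times_linr x : linear (square_times_fun x).
Proof.
have E y : square_times_fun x y = smonq 3 [:: y; x; x].
  by rewrite square_times_smonq; apply: (sym_perm (smonq_multilinear V 3)); rewrite (perm_catC [:: x; x]).
by move=> c y y'; rewrite !E (sym_lin (smonq_multilinear V 3)).
Qed.

Definition square_times : {linear tensor V V -> sym 3 V} :=
  tensor_lift square_times_linl square_times_linr.

Definition swap_map_fun (x y : V) : tensor V W := tens y (b x).
Lemma swap_map_linl y : linear (swap_map_fun^~ y).
Proof. by move=> c x x'; rewrite /swap_map_fun linearP tens_linr. Qed.
Lemma swap_map_linr x : linear (swap_map_fun x).
Proof. by move=> c y y'; rewrite /swap_map_fun tens_linl. Qed.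

Definition swap_map : {linear tensor V V -> tensor V W} :=
  tensor_lift swap_map_linl swap_map_linr.

Definition rel_cubic : {linear tensor V V -> prodL (sym 3 V) (tensor V W)} :=
  pair_lin square_times swap_map.

Lemma rel_cubicE x y : rel_cubic (tens x y) = (smon [tuple x; x; y], tens y (b x)).
Proof. exact: (congr2 pair (tensor_liftE _ _ x y) (tensor_liftE _ _ x y)). Qed.
End SquareTimes.

(** Polarisation at [b] and [a] turns the image of [z] into the value at (b, a) of the bilinear form
    that [z] defines, and [tensor_sep] recovers [z] from these values. *)
Lemma square_times_ker (T : lmodType 'F_2) (z : tensor (dual T) (dual T)) :
  square_times (dual T) z = 0 -> z = 0.
Proof.
have [s ->] := tensor_sum z; rewrite linear_sum => e; apply: tensor_sep => a b.
have := congr1 (sym_lift (polar_form a b)) e.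
rewrite sym_lift0; last exact: polar_form_multilinear.
apply: etrans; elim: s {e} => [|p s IH].
  by rewrite !big_nil sym_lift0 //; exact: polar_form_multilinear.
have lp := sym_lift_linear (polar_form_multilinear a b) (k := 3).
have D u v : sym_lift (polar_form a b) (u + v) =
    sym_lift (polar_form a b) (u : sym 3 (dual T)) + sym_lift (polar_form a b) (v : sym 3 (dual T)).
  by have := lp 1 u v; rewrite !scale1r.
rewrite !big_cons D -IH tensor_liftE (sym_liftE (polar_form_multilinear a b)).
by rewrite polar_form_cubic.
Qed.

Section TensorOfSym1.
Variables (K : fieldType) (U V : lmodType K).
Definition tensor_smon1 : {linear tensor U V -> tensor (sym 1 U) (sym 1 V)} :=
  tensor_map (smon1 U) (smon1 V).

Lemma tensor_smon1E u v : tensor_smon1 (tens u v) = tens (smon [tuple u]) (smon [tuple v]).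
Proof. exact: tensor_mapE. Qed.

Lemma tensor_smon1_ker z : tensor_smon1 z = 0 -> z = 0.
Proof.
have E : tensor_map (sym1_val U) (sym1_val V) (tensor_smon1 z) = z.
  elim/tensor_ind: z => [|u v]; last by rewrite !tensor_mapE !sym1_valE.
  by split=> [|c x y Hx Hy]; rewrite ?linear0 // !linearP Hx Hy.
by move=> e; rewrite -E e linear0.
Qed.
End TensorOfSym1.

Section Degree3.
Variable A : zmodType.
Local Notation V := (mod2V A).
Local Notation W := (tors2V A).

Definition incl30 : {linear sym 3 V -> @bisummand 3 A deg30} :=
  tensl (sym 3 V) (smon [tuple] : sym 0 W).
Definition incl11 : {linear tensor V W -> @bisummand 3 A deg11} := tensor_smon1 V W.

Definition J3 : {linear prodL (sym 3 V) (tensor V W) -> bisum 3 A} := two_inj incl30 incl11.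

Lemma J3E s v w : J3 (s, tens v w) =
  bi_elt (p := deg30) s (smon [tuple]) + bi_elt (p := deg11) (smon [tuple v]) (smon [tuple w]).
Proof.
by apply: (congr1 (fun z => bi_elt (p := deg30) s (smon [tuple]) + dinj (V := @bisummand 3 A) (i := deg11) z));
  apply: tensor_smon1E.
Qed.

Lemma J3_ker v : J3 v = 0 -> v = 0.
Proof.
apply: two_inj_ker => // [s|w]; first exact: tens_unit_r_inj.
exact: tensor_smon1_ker.
Qed.

Lemma J3_surj y : exists v, y = J3 v.
Proof.
elim/bisum_ind: y => [|t u]; first exact: (lin_closed_image J3).
have [tu|/eqP tu] := eqVneq (size t + 2 * size u)%N 3; last first.
  by exists 0; rewrite linear0 bmon_deg.
case: t u tu => [|x [|y [|z [|? ?]]]] [|w [|? ?]] //=; try by lia.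
- move=> _; exists (0, tens x w); rewrite -(bi_eltE (p := deg11) [tuple x] [tuple w]) [RHS]two_injr.
  by apply: (congr1 (dinj (V := @bisummand 3 A) (i := deg11))); apply/esym/tensor_smon1E.
- move=> _; exists (smon [tuple x; y; z], 0).
  by rewrite -(bi_eltE (p := deg30) [tuple x; y; z] [tuple]) [RHS]two_injl.
Qed.

Definition rel30 : {linear tensor V V -> prodL (sym 3 V) (tensor V W)} := rel_cubic (betaV A).

Lemma rel30_inj : injective rel30.
Proof.
apply: raddf_inj => x /(congr1 fst); exact: square_times_ker.
Qed.

Lemma rel_map_rel30 x y : rel_map 3 A (tmon 3 [:: x] [:: y] [::]) = J3 (rel30 (tens x y)).
Proof.
rewrite rel_mapE // [rel30 _]rel_cubicE J3E /relation_elt.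
rewrite (bi_eltE (p := deg30) [tuple x; x; y] [tuple]).
by rewrite (bi_eltE (p := deg11) [tuple y] [tuple betaV A x]).
Qed.

Lemma rel_map3 z : exists x, rel_map 3 A z = J3 (rel30 x).
Proof.
move: z; apply: (rel_map_image (J := J3) (F := rel30)) => t s u t0.
(* With k >= 1 the only tridegree of total degree 3 is (1, 1, 0). *)
case: t s u t0 => [|x [|? ?]] [|y [|? ?]] [|? ?] //=; try by lia.
by move=> _ _; exists (tens x y); apply: rel_map_rel30.
Qed.

Lemma rel30_rel_map x : exists z, J3 (rel30 x) = rel_map 3 A z.
Proof.
elim/tensor_ind: x => [|x y]; last by exists (tmon 3 [:: x] [:: y] [::]); rewrite rel_map_rel30.
exact: (lin_closed_lift (J3 \o rel30) (rel_map 3 A) idfun).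
Qed.
End Degree3.

Lemma exact_sequence (K : fieldType) (U X Y B Z H : lmodType K) (phi : {linear Z -> B})
    (th : {linear coker phi -> H}) (J : {linear prodL X Y -> B}) (F : {linear U -> prodL X Y}) :
  bijective th -> (forall v, J v = 0 -> v = 0) -> (forall y, exists v, y = J v) ->
  injective F -> (forall z, exists x, phi z = J (F x)) -> (forall x, exists z, J (F x) = phi z) ->
  exists (f : {linear U -> (X * Y)%type}) (g : {linear (X * Y)%type -> H}),
    [/\ forall x, f x = F x, forall v, g v = th (coker_pi phi (J v)) & short_exact f g].
Proof.
move=> thB J0 Js Fi phiJ Jphi; exists F, (th \o coker_pi phi \o J); split=> //.
apply: (short_exact_coker (J := J) thB) => // x.
by have [z zE] := Jphi x; exists z.
Qed.

(* The next two lemmas keep the field abstract because unification is slow on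
   the structures of 'F_2. *)
Lemma exact_sequence2 (K : fieldType) (T T' : lmodType K) (A : zmodType) (B Z : lmodType K)
    (phi : {linear Z -> B}) (th : {linear coker phi -> coho K A 2})
    (J : {linear prodL (sym 2 (dual T)) (dual T') -> B})
    (F : {linear dual T -> prodL (sym 2 (dual T)) (dual T')}) (b : {linear dual T -> dual T'})
    (j : sym 2 (dual T) -> dual T' -> B) :
  bijective th -> (forall v, J v = 0 -> v = 0) -> (forall y, exists v, y = J v) ->
  injective F -> (forall z, exists x, phi z = J (F x)) -> (forall x, exists z, J (F x) = phi z) ->
  (forall x, F x = (smon [tuple x; x], b x)) -> (forall s w, J (s, w) = j s w) ->
  exists (f : {linear dual T -> (sym 2 (dual T) * dual T')%type})
         (g : {linear (sym 2 (dual T) * dual T')%type -> coho K A 2}),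
    [/\ forall x, f x = (smon [tuple x; x], b x),
        forall s w, g (s, w) = th (coker_pi phi (j s w)) & short_exact f g].
Proof.
move=> thB J0 Js Fi phiJ Jphi FE JE.
have [f [g [fE gE ex]]] := exact_sequence thB J0 Js Fi phiJ Jphi.
exists f, g; split=> [x|s w|]; last exact: ex.
  exact: etrans (fE x) (FE x).
by rewrite -JE; apply: gE.
Qed.

Lemma exact_sequence3 (K : fieldType) (T T' : lmodType K) (A : zmodType) (B Z : lmodType K)
    (phi : {linear Z -> B}) (th : {linear coker phi -> coho K A 3})
    (J : {linear prodL (sym 3 (dual T)) (tensor (dual T) (dual T')) -> B})
    (F : {linear tensor (dual T) (dual T) -> prodL (sym 3 (dual T)) (tensor (dual T) (dual T'))})
    (b : {linear dual T -> dual T'})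
    (j : sym 3 (dual T) -> dual T -> dual T' -> B) :
  bijective th -> (forall v, J v = 0 -> v = 0) -> (forall y, exists v, y = J v) ->
  injective F -> (forall z, exists x, phi z = J (F x)) -> (forall x, exists z, J (F x) = phi z) ->
  (forall x y, F (tens x y) = (smon [tuple x; x; y], tens y (b x))) ->
  (forall s v w, J (s, tens v w) = j s v w) ->
  exists (f : {linear tensor (dual T) (dual T) ->
                 (sym 3 (dual T) * tensor (dual T) (dual T'))%type})
         (g : {linear (sym 3 (dual T) * tensor (dual T) (dual T'))%type -> coho K A 3}),
    [/\ forall x y, f (tens x y) = (smon [tuple x; x; y], tens y (b x)),
        forall s v w, g (s, tens v w) = th (coker_pi phi (j s v w)) & short_exact f g].
Proof.
move=> thB J0 Js Fi phiJ Jphi FE JE.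
have [f [g [fE gE ex]]] := exact_sequence thB J0 Js Fi phiJ Jphi.
exists f, g; split=> [x y|s v w|]; last exact: ex.
  exact: etrans (fE _) (FE x y).
by rewrite -JE; apply: gE.
Qed.

Theorem corollary3p4 :
  exists (phi : forall (n : nat) (A : fgAb), {linear trisum n A -> bisum n A})
         (theta : forall (n : nat) (A : fgAb),
            {linear coker (phi n A) -> coho 'F_2 A n}),
    [/\ (forall (n : nat) (A B : fgAb) (h : {additive A -> B}) (x : trisum n B),
           phi n A (trisum_map n h x) = bisum_map n h (phi n B x)),
        (forall (n : nat) (A : fgAb), bijective (theta n A)),
        (forall (n : nat) (A B : fgAb) (h : {additive A -> B}) (y : bisum n B),
           theta n A (coker_pi (phi n A) (bisum_map n h y)) =
           coho_map 'F_2 h n (theta n B (coker_pi (phi n B) y))),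
        (forall A : fgAb,
           exists (f : {linear mod2V A -> (sym 2 (mod2V A) * tors2V A)%type})
                  (g : {linear (sym 2 (mod2V A) * tors2V A)%type ->
                               coho 'F_2 A 2}),
             [/\ forall x, f x = (smon [tuple x; x], betaV A x),
                 forall s w, g (s, w) =
                   theta 2%N A (coker_pi (phi 2%N A)
                     (bi_elt (p := deg20) s (smon [tuple]) +
                      bi_elt (p := deg01) (smon [tuple]) (smon [tuple w])))
               & short_exact f g])
      & (forall A : fgAb,
           exists (f : {linear tensor (mod2V A) (mod2V A) ->
                     (sym 3 (mod2V A) * tensor (mod2V A) (tors2V A))%type})
                  (g : {linear
                     (sym 3 (mod2V A) * tensor (mod2V A) (tors2V A))%type ->
                     coho 'F_2 A 3}),
             [/\ forall x y, f (tens x y) =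
                   (smon [tuple x; x; y], tens y (betaV A x)),
                 forall s v w, g (s, tens v w) =
                   theta 3%N A (coker_pi (phi 3%N A)
                     (bi_elt (p := deg30) s (smon [tuple]) +
                      bi_elt (p := deg11) (smon [tuple v]) (smon [tuple w])))
               & short_exact f g])].
Proof.
exists (fun n A => rel_map n A).
(* Finite generation enters here alone, through the existence of a cyclic decomposition. *)
exists (fun n A => theta n (fin_gen_cyc_built (fgAb_fin_gen A))); split.
- by move=> n A B h x; apply: rel_map_natural.
- by move=> n A; apply: theta_bij.
- by move=> n A B h y; apply: theta_natural.
- move=> A.
  exact: (exact_sequence2 (theta_bij 2 (fin_gen_cyc_built (fgAb_fin_gen A))) (@J2_ker A)
    (@J2_surj A) (@rel20_inj A) (@rel_map2 A) (@rel20_rel_map A) (@rel20E A) (@J2E A)).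
- move=> A.
  exact: (exact_sequence3 (theta_bij 3 (fin_gen_cyc_built (fgAb_fin_gen A))) (@J3_ker A)
    (@J3_surj A) (@rel30_inj A) (@rel_map3 A) (@rel30_rel_map A) (@rel_cubicE _ _ (betaV A))
    (@J3E A)).
Qed.
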